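(* Let $p\colon M\to B$ be a map between topological spaces such that $B$ is a finite simplicial complex and for each $b\in B$ the homotopy fiber of $p$ over $b$ is homotopy finite. Then there exist a compact ENR $E$, a homotopy equivalence $f\colon M\to E$ and an approximate fibration $q\colon E\to B$ such that $q\circ f$ is homotopic to $p$.
   Context: Homotopy finite: homotopy equivalent to a finite CW complex. ENR: Euclidean neighborhood retract. For a metric space $B$ and $\varepsilon\ge 0$, a continuous map $p\colon E\to B$ is an $\varepsilon$-fibration if for every space $X$, every homotopy $h\colon X\times[0,1]\to B$ and every map $f\colon X\to E$ with $p\circ f=h(-,0)$ there is a map $H\colon X\times[0,1]\to E$ with $H(-,0)=f$ and $d(p(H(x,t)),h(x,t))\le\varepsilon$ for all $(x,t)$. For $B$ compact metric, $p$ is an approximate fibration if it is an $\varepsilon$-fibration for every $\varepsilon>0$ (this does not depend on the metric). *)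

(* Defs.v *)
From HB Require Import structures.
From mathcomp Require Import all_boot all_order all_algebra.
From mathcomp Require Import all_classical all_reals all_analysis.

Set Implicit Arguments.
Unset Strict Implicit.
Unset Printing Implicit Defensive.

Import Order.TTheory GRing.Theory Num.Theory.
Import numFieldNormedType.Exports.

Local Open Scope classical_set_scope.
Local Open Scope ring_scope.

Definition homeomorphic (X Y : topologicalType) : Prop :=
  exists (f : X -> Y) (g : Y -> X),
    [/\ continuous f, continuous g, cancel f g & cancel g f].

Definition embedding (X Y : topologicalType) (f : X -> Y) : Prop :=
  [/\ continuous f, injective f &
      forall U : set X, open U -> exists2 V : set Y, open V & f @^-1` V = U].

Section Homotopy.
Variable R : realType.

Definition unitI : topologicalType := set_type [set t : R | 0 <= t <= 1].

Lemma unitI0_subproof : (0 : R) \in [set t : R | 0 <= t <= 1].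
Proof. by rewrite inE /= lexx ler01. Qed.

Lemma unitI1_subproof : (1 : R) \in [set t : R | 0 <= t <= 1].
Proof. by rewrite inE /= lexx ler01. Qed.

Definition I0 : unitI := exist _ 0 unitI0_subproof.
Definition I1 : unitI := exist _ 1 unitI1_subproof.

Definition homotopic (X Y : topologicalType) (f g : X -> Y) : Prop :=
  exists H : X * unitI -> Y,
    [/\ continuous H, forall x, H (x, I0) = f x & forall x, H (x, I1) = g x].

Definition homotopy_equivalence (X Y : topologicalType) (f : X -> Y) : Prop :=
  continuous f /\
  exists g : Y -> X,
    [/\ continuous g, homotopic (g \o f) id & homotopic (f \o g) id].

Definition homotopy_equivalent (X Y : topologicalType) : Prop :=
  exists f : X -> Y, homotopy_equivalence f.

(* [{compact-open, unitI -> B}] carries all functions, hence the explicit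
   continuity condition on [z.2]. *)
Definition hofiber (M B : topologicalType) (p : M -> B) (b : B) :
    topologicalType :=
  set_type [set z : M * {compact-open, unitI -> B} |
    [/\ continuous (z.2 : unitI -> B), z.2 I0 = p z.1 & z.2 I1 = b]].

End Homotopy.

Section FiniteCW.
Variable R : realType.

(* The norm of ['rV[R]_n] is the sup norm, so the round disk is cut out by the
   sum of squares. *)
Definition sqnorm (n : nat) (x : 'rV[R]_n) : R := \sum_(i < n) x ord0 i ^+ 2.

Definition disk (n : nat) : topologicalType :=
  set_type [set x : 'rV[R]_n | sqnorm x <= 1].

Definition disk_interior (n : nat) : set (disk n) :=
  [set x | sqnorm (set_val x) < 1].

Definition disk_boundary (n : nat) : set (disk n) :=
  [set x | sqnorm (set_val x) = 1].

(* The data [Phi] are the characteristic maps of the finitely many cells; the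
   open cells are the images of the disk interiors. *)
Definition finite_CW (X : topologicalType) : Prop :=
  hausdorff_space X /\
  exists (m : nat) (dim : 'I_m -> nat) (Phi : forall i, disk (dim i) -> X),
    let cell i := Phi i @` @disk_interior (dim i) in
    [/\ (forall i, continuous (Phi i)) /\
        (forall i, embedding
           (fun x : set_type (@disk_interior (dim i)) => Phi i (set_val x))),
        forall i j, i != j -> cell i `&` cell j = set0,
        \bigcup_i cell i = [set: X],
        forall i, Phi i @` @disk_boundary (dim i) `<=`
          \bigcup_(j in [set j | (dim j < dim i)%N]) cell j
      & forall A : set X, closed A <-> forall i, closed (Phi i @^-1` A)].

Definition homotopy_finite (X : topologicalType) : Prop :=
  exists2 Y : topologicalType, finite_CW Y & homotopy_equivalent R X Y.

End FiniteCW.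

Record simplicial_complex (n : nat) := SimplicialComplex {
  faces : {set {set 'I_n}};
  faces_neq0 : finset.set0 \notin faces;
  faces_sub : forall s t : {set 'I_n},
    s \in faces -> t \subset s -> t != finset.set0 -> t \in faces }.

Section Spaces.
Variable R : realType.

(* Barycentric coordinates in the simplex spanned by the [n] vertices. *)
Definition realization (n : nat) (K : simplicial_complex n) : topologicalType :=
  set_type [set x : 'rV[R]_n |
    [/\ forall i, 0 <= x ord0 i,
        \sum_(i < n) x ord0 i = 1
      & [set i | x ord0 i != 0]%SET \in faces K]].

Definition finite_simplicial_complex (B : topologicalType) : Prop :=
  exists (n : nat) (K : simplicial_complex n), homeomorphic (realization K) B.

Definition ENR (E : topologicalType) : Prop :=
  exists (n : nat) (Y U : set 'rV[R]_n),
    [/\ homeomorphic E (set_type Y), open U, Y `<=` U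
      & exists r : set_type U -> set_type Y,
          continuous r /\
          forall (u : set_type U) (y : set_type Y),
            set_val u = set_val y -> r u = y].

Definition eps_fibration (E : topologicalType) (B : metricType R)
    (eps : R) (p : E -> B) : Prop :=
  continuous p /\
  forall (X : topologicalType) (h : X * unitI R -> B) (f : X -> E),
    continuous h -> continuous f -> (forall x, p (f x) = h (x, I0 R)) ->
    exists H : X * unitI R -> E,
      [/\ continuous H, forall x, H (x, I0 R) = f x
        & forall z, mdist (p (H z)) (h z) <= eps].

Definition approximate_fibration (E : topologicalType) (B : metricType R)
    (p : E -> B) : Prop :=
  forall eps : R, 0 < eps -> eps_fibration eps p.

End Spaces.

(* Main.v *)
Require Import Defs.
From HB Require Import structures.
From mathcomp Require Import all_boot all_order all_algebra.
From mathcomp Require Import all_classical all_reals all_analysis.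
From mathcomp Require Import lra ring.

(** The space of pairs consisting of a point [m] of [M] and a path in [B] starting at [p m]
    is homotopy equivalent to [M], and the end point map to [B] lifts homotopies strictly.
    It is filtered by the simplices of [B] that contain the end point.  The part over a
    closed simplex is equivalent to a homotopy fibre, hence to a compact ANE, so attaching
    the simplices one at a time by double mapping cylinders yields a compact ANE [G], filtered
    by compact ANEs [G_t], one for each set [t] of vertices, that is equivalent to the path
    space through filtered maps and homotopies.

    The total space [E] consists of the pairs [(g, b)] with [g] in [G_t], where [t] is the set
    of vertices at which the barycentric coordinates of [b] are maximal.  As [t] can only grow
    in the limit, [E] is closed in the product; it is a finite union of products of compact
    ANEs, and the intersections of these are again such products, so [E] is a compact ANE and
    hence an ENR.  Cutting the barycentric coordinates of [b] off at [(1 - th)] times their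
    maximum moves [b] only slightly and makes all coordinates near the maximum maximal.
    This gives mutually inverse homotopy equivalences between [E] and the path space, one of
    them strictly over [B], the other one and the homotopy on [E] only moving points of [B] by
    a truncation.  To lift a homotopy [h] of [B] approximately from [f x], first run the
    homotopy on [E] as long as [h] stays close to its starting point, then follow the strict
    lift in the path space. *)

Set Implicit Arguments.
Unset Strict Implicit.
Unset Printing Implicit Defensive.

Import Order.TTheory GRing.Theory Num.Theory.
Import numFieldNormedType.Exports.

Local Open Scope classical_set_scope.
Local Open Scope ring_scope.

(** The obstacle is that an equivalence between the path space and a compact model has no reason to
    respect the projection to [B]. The filtration repairs this: going to the model and back moves an
    end point only inside its carrier simplex, and the segment back to the right point lies in that
    simplex, so the error is corrected by transporting paths along segments. Transport is constant
    along trivial segments, so the corrections disappear at the end of a homotopy. The fibre of [E]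
    over [b] jumps with the set of maximal coordinates, hence lifts are only approximate. Truncation
    bridges the jumps: the part of [b] that is cut off is, once normalized, supported on coordinates
    that have become maximal, so a path transported there lands in the filtration step required over
    the truncated point. The union theorem for ANEs asks for an ANE as intersection. This is why
    cylinders are attached along injective maps, made so by a contractible cube factor, and why the
    filtration of [G] is closed under intersections. *)

Section ContinuousCombinators.
Context {X Y Z : topologicalType}.

Lemma ct_id : continuous (fun x : X => x).
Proof. by move=> x; exact: cvg_id. Qed.

Lemma ct_cst (y : Y) : continuous (fun _ : X => y).
Proof. by move=> x; exact: cvg_cst. Qed.

Lemma ct_comp (F : Y -> Z) (f : X -> Y) :
  continuous F -> continuous f -> continuous (fun x => F (f x)).
Proof. by move=> cF cf x; apply: continuous_comp; [exact: cf|exact: cF]. Qed.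

Lemma ct_pair (f : X -> Y) (g : X -> Z) :
  continuous f -> continuous g -> continuous (fun x => (f x, g x)).
Proof. by move=> cf cg x; apply: cvg_pair; [exact: cf|exact: cg]. Qed.

Lemma ct_fst (f : X -> Y * Z) : continuous f -> continuous (fun x => (f x).1).
Proof. by move=> cf x; apply: continuous_comp; [exact: cf|exact: cvg_fst]. Qed.

Lemma ct_snd (f : X -> Y * Z) : continuous f -> continuous (fun x => (f x).2).
Proof. by move=> cf x; apply: continuous_comp; [exact: cf|exact: cvg_snd]. Qed.

End ContinuousCombinators.

Section ContinuousReal.
Context {R : realType} {X : topologicalType}.
Implicit Types f g : X -> R.

Lemma ct_add f g : continuous f -> continuous g -> continuous (fun x => f x + g x).
Proof. by move=> cf cg x; apply: cvgD; [exact: cf|exact: cg]. Qed.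

Lemma ct_opp f : continuous f -> continuous (fun x => - f x).
Proof. by move=> cf x; apply: cvgN; exact: cf. Qed.

Lemma ct_mul f g : continuous f -> continuous g -> continuous (fun x => f x * g x).
Proof. by move=> cf cg x; apply: cvgM; [exact: cf|exact: cg]. Qed.

Lemma ct_max f g : continuous f -> continuous g ->
  continuous (fun x => Num.max (f x) (g x)).
Proof. by move=> cf cg x; apply: continuous_max; [exact: cf|exact: cg]. Qed.

Lemma ct_min f g : continuous f -> continuous g ->
  continuous (fun x => Num.min (f x) (g x)).
Proof. by move=> cf cg x; apply: continuous_min; [exact: cf|exact: cg]. Qed.

Lemma ct_inv f : continuous f -> (forall x, f x != 0) ->
  continuous (fun x => (f x)^-1).
Proof. by move=> cf f0 x; apply: cvgV; [exact: f0|exact: cf]. Qed.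

Lemma ct_norm f : continuous f -> continuous (fun x => `|f x|).
Proof. by move=> cf x; apply: cvg_norm; exact: cf. Qed.

Lemma ct_sum (I : Type) (r : seq I) (P : pred I) (f : I -> X -> R) :
  (forall i, continuous (f i)) -> continuous (fun x => \sum_(i <- r | P i) f i x).
Proof.
move=> cf; elim: r => [|i r ih].
  by under eq_fun do rewrite big_nil; exact: ct_cst.
under eq_fun do rewrite big_cons.
by case: (P i) => //; apply: ct_add.
Qed.

End ContinuousReal.

Lemma ct_coord (R : realType) (X : topologicalType) m n (f : X -> 'M[R]_(m, n)) i j :
  continuous f -> continuous (fun x => f x i j).
Proof. by move=> cf; apply: (ct_comp (@coord_continuous R m n i j) cf). Qed.

Lemma ct_mx (R : realType) (X : topologicalType) m n (f : X -> 'M[R]_(m, n)) :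
  (forall i j, continuous (fun x => f x i j)) -> continuous f.
Proof.
move=> cf x P [Q nQ QP]; rewrite nbhs_simpl /=.
suff : \forall y \near x, forall i j, Q i j (f y i j).
  by apply: filterS => y Qy; apply: QP.
apply: filter_forall => i; apply: filter_forall => j.
exact: (cf i j x _ (nQ i j)).
Qed.

Lemma ct_row (R : realType) (X : topologicalType) n (f : 'I_n -> X -> R) :
  (forall i, continuous (f i)) -> continuous (fun x => \row_i f i x).
Proof.
move=> cf; apply: ct_mx => i j.
by rewrite (_ : (fun x => _) = f j)//; apply/funext => x; rewrite mxE.
Qed.

Lemma ct_scale (R : realType) (X : topologicalType) n (f : X -> R) (g : X -> 'rV[R]_n) :
  continuous f -> continuous g -> continuous (fun x => f x *: g x).
Proof. by move=> cf cg x; apply: cvgZ; [exact: cf|exact: cg]. Qed.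

Lemma ct_vadd (R : realType) (X : topologicalType) n (f g : X -> 'rV[R]_n) :
  continuous f -> continuous g -> continuous (fun x => f x + g x).
Proof. by move=> cf cg x; apply: cvgD; [exact: cf|exact: cg]. Qed.

Lemma ct_vopp (R : realType) (X : topologicalType) n (f : X -> 'rV[R]_n) :
  continuous f -> continuous (fun x => - f x).
Proof. by move=> cf x; apply: cvgN; exact: cf. Qed.

Lemma ct_vnorm (R : realType) (X : topologicalType) n (f : X -> 'rV[R]_n) :
  continuous f -> continuous (fun x => `|f x|).
Proof. by move=> cf x; apply: cvg_norm; exact: cf. Qed.

Lemma ct_row_mx (R : realType) (X : topologicalType) m n
    (f : X -> 'rV[R]_m) (g : X -> 'rV[R]_n) :
  continuous f -> continuous g -> continuous (fun x => row_mx (f x) (g x)).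
Proof.
move=> cf cg; apply: ct_mx => i j; rewrite -(splitK j).
case: (fintype.split j) => k /=.
  by under eq_fun do rewrite row_mxEl; exact: ct_coord.
by under eq_fun do rewrite row_mxEr; exact: ct_coord.
Qed.

Ltac cts_more := fail.

Ltac cts_step := first [cts_more |
  match goal with
  | H : continuous ?f |- continuous ?f => exact: H
  | |- continuous (fun x => x) => exact: ct_id
  | |- continuous fst => exact: (ct_fst ct_id)
  | |- continuous snd => exact: (ct_snd ct_id)
  | |- continuous -%R => first [exact: (ct_opp ct_id) | exact: (ct_vopp ct_id)]
  | |- continuous Num.norm => first [exact: (ct_norm ct_id) | exact: (ct_vnorm ct_id)]
  | |- continuous set_val => exact: initial_continuous
  | |- continuous (fun _ => ?c) => exact: ct_cst
  | |- continuous (fun x => (_, _)) => apply: ct_pair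
  | |- continuous (fun x => fst _) => apply: ct_fst
  | |- continuous (fun x => snd _) => apply: ct_snd
  | |- continuous (fun x => \row_i _) => apply: ct_row => ?
  | |- continuous (fun x => row_mx _ _) => apply: ct_row_mx
  | |- continuous (fun x => _ *: _) => apply: ct_scale
  | |- continuous (fun x => _ + _) => first [apply: ct_add | apply: ct_vadd]
  | |- continuous (fun x => - _) => first [apply: ct_opp | apply: ct_vopp]
  | |- continuous (fun x => _ * _) => apply: ct_mul
  | |- continuous (fun x => Num.max _ _) => apply: ct_max
  | |- continuous (fun x => Num.min _ _) => apply: ct_min
  | |- continuous (fun x => Num.norm _) => first [apply: ct_norm | apply: ct_vnorm]
  | |- continuous (fun x => \sum_(_ <- _ | _) _) => apply: ct_sum => ?
  | H : continuous ?F |- continuous (fun x => ?F _) => apply: (ct_comp H)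
  | H : forall i, continuous (?F i) |- continuous (fun x => ?F ?i _) =>
      apply: (ct_comp (H i))
  | |- continuous (fun x => fun_of_matrix _ ?i ?j) => apply: ct_coord
  | |- continuous (fun x => set_val _) => apply: (ct_comp (@initial_continuous _ _ _))
  end].

Ltac cts := repeat cts_step.

(** * Continuity on subspaces, pasting and currying *)

Section Within.
Context {X Y Z : topologicalType}.

Lemma within_comp (A : set X) (B : set Y) (f : X -> Y) (g : Y -> Z) :
  {within A, continuous f} -> (forall x, A x -> B (f x)) ->
  {within B, continuous g} -> {within A, continuous (fun x => g (f x))}.
Proof.
move=> /subspace_continuousP cf AB /subspace_continuousP cg.
apply/subspace_continuousP => x Ax.
have gx := cg _ (AB _ Ax); have fx := cf _ Ax.
move=> U /gx; rewrite /nbhs/= => gU.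
have := fx _ gU; rewrite /nbhs/= /within /=.
by apply: filterS => y /= h Ay; apply: h => //; exact: AB.
Qed.

Lemma within_pair (A : set X) (f : X -> Y) (g : X -> Z) :
  {within A, continuous f} -> {within A, continuous g} ->
  {within A, continuous (fun x => (f x, g x))}.
Proof. by move=> cf cg x; apply: cvg_pair; [exact: cf|exact: cg]. Qed.

Lemma withinT (f : X -> Y) : {within setT, continuous f} -> continuous f.
Proof. by move=> cf; apply/(@continuous_subspace_setT X Y f). Qed.

Lemma within_eq (A : set X) (f g : X -> Y) :
  (forall x, A x -> f x = g x) -> {within A, continuous f} -> {within A, continuous g}.
Proof.
move=> fg cf; apply: (@subspace_eq_continuous _ _ _ f); last exact: cf.
by move=> x /set_mem; exact: fg.
Qed.

Lemma within_set_type (A : set X) (f : X -> Y) :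
  {within A, continuous f} <-> continuous (fun x : set_type A => f (set_val x)).
Proof. exact (@subspace_sigL_continuousP X A Y f). Qed.

End Within.

Lemma ct_within (X Y Z : topologicalType) (B : set Y) (f : X -> Y) (g : Y -> Z) :
  continuous f -> (forall x, B (f x)) -> {within B, continuous g} ->
  continuous (fun x => g (f x)).
Proof.
move=> cf fB cg; apply: withinT.
by apply: (within_comp _ _ cg) => //; exact: continuous_subspaceT.
Qed.

Lemma ct_val (X : topologicalType) (A : set X) : continuous (@set_val X A).
Proof. exact: initial_continuous. Qed.

Lemma ct_sub (X Y : topologicalType) (A : set Y) (f : X -> set_type A) :
  continuous (fun x => set_val (f x)) -> continuous f.
Proof.
move=> cf; apply/continuousP => _ [U oU <-].
rewrite -comp_preimage; move/continuousP: cf; exact.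
Qed.

Lemma set_valP' (X : Type) (A : set X) (x : set_type A) : A (set_val x).
Proof. exact (set_valP x). Qed.

Lemma set_val_inj (X : Type) (A : set X) (x y : set_type A) :
  set_val x = set_val y -> x = y.
Proof. exact: val_inj. Qed.

Definition mksub (X : Type) (A : set X) (x : X) (Ax : A x) : set_type A :=
  exist _ x (mem_set Ax).

Lemma paste_within (R : realType) (X Y : topologicalType) (u : X -> R) (f g : X -> Y) :
  continuous u -> {within [set x | u x <= 0], continuous f} ->
  {within [set x | 0 <= u x], continuous g} ->
  (forall x, u x = 0 -> f x = g x) ->
  continuous (fun x => if u x <= 0 then f x else g x).
Proof.
move=> cu cf cg fg; apply: withinT.
rewrite (_ : setT = [set x | u x <= 0] `|` [set x | 0 <= u x]); last first.
  by apply/seteqP; split=> x //= _; case: (leP (u x) 0) => [|/ltW]; [left|right].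
apply: withinU_continuous.
- rewrite (_ : [set _ | _] = u @^-1` [set t | t <= 0])//.
  by move/continuous_closedP : cu; apply; exact: closed_le.
- rewrite (_ : [set _ | _] = u @^-1` [set t | 0 <= t])//.
  by move/continuous_closedP : cu; apply; exact: closed_ge.
- by apply: (within_eq _ cf) => x /= ->.
- apply: (within_eq _ cg) => x /= u0; case: ifPn => // u0'; apply/esym/fg.
  by apply/eqP; rewrite eq_le u0 u0'.
Qed.

Lemma paste (R : realType) (X Y : topologicalType) (u : X -> R) (f g : X -> Y) :
  continuous u -> continuous f -> continuous g ->
  (forall x, u x = 0 -> f x = g x) ->
  continuous (fun x => if u x <= 0 then f x else g x).
Proof. by move=> cu cf cg fg; apply: paste_within => //; exact: continuous_subspaceT. Qed.

Section Currying.
Context {R : realType} {X Y : topologicalType}.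

Lemma ct_curry (f : X * R -> Y) : continuous f ->
  continuous (fun x => (fun t => f (x, t)) : {compact-open, R -> Y}).
Proof. exact: continuous_curry_fun. Qed.

(** The exponential law asks for a locally compact Hausdorff parameter space, which [R] is; homotopy
    parameters below range over [R]. *)
Lemma ct_uncurry (f : X -> R -> Y) :
  continuous (f : X -> {compact-open, R -> Y}) -> (forall x, continuous (f x)) ->
  continuous (fun z => f z.1 z.2).
Proof.
move=> cf cfx.
have := @continuous_uncurry X R Y f (@locally_compactR R) (@Rhausdorff R) cf cfx.
by rewrite (_ : uncurry f = fun z => f z.1 z.2)//; apply/funext => -[].
Qed.

End Currying.

Lemma mksubK (X : Type) (A : set X) (x : X) (Ax : A x) : set_val (mksub Ax) = x.
Proof. by rewrite set_valE. Qed.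

Lemma ct_mksub (X Y : topologicalType) (A : set Y) (f : X -> Y) (fA : forall x, A (f x)) :
  continuous f -> continuous (fun x => mksub (fA x) : set_type A).
Proof.
move=> cf; apply: ct_sub.
by rewrite (_ : (fun x => _) = f)//; apply/funext => x; rewrite mksubK.
Qed.
Arguments ct_mksub {X Y A f} fA cf.

Definition clamp (R : realType) (t : R) : R := Num.max 0 (Num.min 1 t).

Section Clamp.
Context {R : realType}.
Implicit Types t : R.

Lemma clamp_ge0 t : 0 <= clamp t.
Proof. by rewrite /clamp le_max lexx. Qed.

Lemma clamp_le1 t : clamp t <= 1.
Proof. by rewrite /clamp ge_max ler01 ge_min lexx. Qed.

Lemma clamp_le0 t : t <= 0 -> clamp t = 0.
Proof.
move=> t0; rewrite /clamp; apply/max_idPl.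
by rewrite ge_min t0 orbT.
Qed.

Lemma clamp_ge1 t : 1 <= t -> clamp t = 1.
Proof. by move=> t1; rewrite /clamp (min_idPl t1); apply/max_idPr. Qed.

Lemma clamp_id t : 0 <= t -> t <= 1 -> clamp t = t.
Proof. by move=> t0 t1; rewrite /clamp (min_idPr t1); apply/max_idPr. Qed.

Lemma clampK t : clamp (clamp t) = clamp t.
Proof. by rewrite clamp_id ?clamp_ge0 ?clamp_le1. Qed.

Lemma ct_clamp (X : topologicalType) (f : X -> R) :
  continuous f -> continuous (fun x => clamp (f x)).
Proof. by move=> cf; rewrite /clamp; cts. Qed.

End Clamp.

Ltac cts_more ::=
  match goal with
  | |- continuous clamp => exact: (ct_clamp ct_id)
  | |- continuous (fun x => clamp _) => apply: ct_clamp
  end.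

(** * Filtered homotopy theory *)

(** The family is arbitrary, neither closed nor increasing. With one index and the whole space as
    its set this is ordinary homotopy theory; with the points of a space as indices it expresses
    control, since a filtered map then sends each point into a prescribed set. *)
Record fsp (J : Type) := Fsp {
  fcar :> topologicalType;
  fset : J -> set fcar }.

Section FilteredHomotopy.
Context {R : realType} {J : Type}.
Implicit Types W X Y Z : fsp J.

Definition fmor X Y (f : X -> Y) : Prop :=
  continuous f /\ forall j x, fset j x -> fset j (f x).

(** With the parameter in [R] and constant ends, homotopies can be evaluated at arbitrary affine
    times without passing to a subtype. *)
Definition fhom X Y (f g : X -> Y) : Prop := exists H : X * R -> Y,
  [/\ continuous H, forall x t, t <= 0 -> H (x, t) = f x,
      forall x t, 1 <= t -> H (x, t) = g x
    & forall j x t, fset j x -> fset j (H (x, t))].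

Lemma fhomI X Y (f g : X -> Y) (H : X * R -> Y) : continuous H ->
  (forall x, H (x, 0) = f x) -> (forall x, H (x, 1) = g x) ->
  (forall j x t, 0 <= t -> t <= 1 -> fset j x -> fset j (H (x, t))) -> fhom f g.
Proof.
move=> cH H0 H1 HJ; exists (fun z => H (z.1, clamp z.2)); split=> /=.
- by cts.
- by move=> x t t0; rewrite clamp_le0.
- by move=> x t t1; rewrite clamp_ge1.
- by move=> j x t jx; apply: HJ; rewrite ?clamp_ge0 ?clamp_le1.
Qed.

Lemma fmor_id X : fmor (fun x : X => x).
Proof. by split=> //; cts. Qed.

Lemma fmor_comp X Y Z (f : X -> Y) (g : Y -> Z) :
  fmor f -> fmor g -> fmor (fun x => g (f x)).
Proof. by move=> [cf Jf] [cg Jg]; split; [cts|move=> j x /Jf/Jg]. Qed.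

Lemma fhom_eq X Y (f g : X -> Y) : fmor f -> f =1 g -> fhom f g.
Proof.
by move=> [cf Jf] fg; apply: (@fhomI _ _ _ _ (fun z => f z.1)) => //=; [cts|
 move=> j x t _ _; exact: Jf].
Qed.

Lemma fhom_refl X Y (f : X -> Y) : fmor f -> fhom f f.
Proof. by move=> Ff; exact: fhom_eq. Qed.

Lemma fhom_sym X Y (f g : X -> Y) : fhom f g -> fhom g f.
Proof.
move=> [H [cH H0 H1 HJ]]; apply: (@fhomI _ _ _ _ (fun z => H (z.1, 1 - z.2))) => /=.
- by cts.
- by move=> x; rewrite H1// subr0.
- by move=> x; rewrite H0// subrr.
- by move=> j x t _ _; exact: HJ.
Qed.

Lemma fhom_trans X Y (f g h : X -> Y) : fhom f g -> fhom g h -> fhom f h.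
Proof.
move=> [H [cH H0 H1 HJ]] [K [cK K0 K1 KJ]].
apply: (@fhomI _ _ _ _ (fun z =>
  if 2 * z.2 - 1 <= 0 then H (z.1, 2 * z.2) else K (z.1, 2 * z.2 - 1))) => /=.
- apply: paste; first by cts.
  + by cts.
  + by cts.
  + by move=> [x t]/= t1; rewrite H1 ?K0//; lra.
- by move=> x; rewrite ifT ?H0//; lra.
- by move=> x; rewrite ifF ?K1//; lra.
- by move=> j x t _ _ jx; case: ifP => _; [exact: HJ|exact: KJ].
Qed.

Lemma fhom_comp X Y Z (f f' : X -> Y) (g g' : Y -> Z) :
  fhom f f' -> fhom g g' -> fhom (fun x => g (f x)) (fun x => g' (f' x)).
Proof.
move=> [H [cH H0 H1 HJ]] [K [cK K0 K1 KJ]].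
apply: (@fhomI _ _ _ _ (fun z => K (H z, z.2))) => /=; first by cts.
- by move=> x; rewrite H0// K0.
- by move=> x; rewrite H1// K1.
- by move=> j x t _ _ jx; apply: KJ; exact: HJ.
Qed.

Lemma fhom_mapl X Y (f g : X -> Y) : fhom f g -> fmor f.
Proof.
move=> [H [cH H0 H1 HJ]]; split.
  rewrite (_ : f = fun x => H (x, 0)); first by cts.
  by apply/funext => x; rewrite H0.
by move=> j x jx; rewrite -(H0 x 0)//; exact: HJ.
Qed.

Lemma fhom_mapr X Y (f g : X -> Y) : fhom f g -> fmor g.
Proof. by move=> /fhom_sym; exact: fhom_mapl. Qed.

Definition fhe X Y (f : X -> Y) : Prop := fmor f /\ exists g : Y -> X,
  [/\ fmor g, fhom (fun x => g (f x)) id & fhom (fun y => f (g y)) id].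

Lemma fhe_id X : fhe (fun x : X => x).
Proof.
split; [exact: fmor_id|exists id; split].
- exact: fmor_id.
- exact: (fhom_refl (@fmor_id X)).
- exact: (fhom_refl (@fmor_id X)).
Qed.

(** The one-sided inverses agree up to homotopy, because both are homotopic to the composite of [r],
    [f] and [l]. *)
Lemma fhe_LR X Y (f : X -> Y) (l r : Y -> X) : fmor f -> fmor l -> fmor r ->
  fhom (fun x => l (f x)) id -> fhom (fun y => f (r y)) id -> fhe f.
Proof.
move=> Ff Fl Fr lf fr; split => //; exists l; split => //.
have lr : fhom l r.
  have h1 := fhom_sym (fhom_comp fr (fhom_refl Fl)).
  by apply: fhom_trans h1 _; exact: (fhom_comp (fhom_refl Fr) lf).
by apply: fhom_trans fr; exact: (fhom_comp lr (fhom_refl Ff)).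
Qed.

Lemma fhe_comp X Y Z (f : X -> Y) (g : Y -> Z) : fhe f -> fhe g -> fhe (fun x => g (f x)).
Proof.
move=> [Ff [f' [Ff' f'f ff']]] [Fg [g' [Fg' g'g gg']]].
split; first exact: fmor_comp.
exists (fun z => f' (g' z)); split; first exact: fmor_comp.
- apply: fhom_trans f'f.
  exact: (fhom_comp (fhom_comp (fhom_refl Ff) g'g) (fhom_refl Ff')).
- apply: fhom_trans gg'.
  exact: (fhom_comp (fhom_comp (fhom_refl Fg') ff') (fhom_refl Fg)).
Qed.

Lemma fhe_hom X Y (f f' : X -> Y) : fhom f f' -> fhe f -> fhe f'.
Proof.
move=> ff' [Ff [g [Fg gf fg]]]; split; first exact: fhom_mapr ff'.
exists g; split => //.
- by apply: fhom_trans gf; apply: fhom_comp (fhom_sym ff') (fhom_refl Fg).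
- by apply: fhom_trans fg; apply: fhom_comp (fhom_refl Fg) (fhom_sym ff').
Qed.

(* A part of the two-out-of-six property. *)
Lemma fhe_mid W X Y Z (f : W -> X) (g : X -> Y) (h : Y -> Z) :
  fmor f -> fmor g -> fmor h ->
  fhe (fun x => g (f x)) -> fhe (fun y => h (g y)) -> fhe g.
Proof.
move=> Ff Fg Fh [_ [r [Fr _ gfr]]] [_ [l [Fl lhg _]]].
apply: (@fhe_LR _ _ g (fun y => l (h y)) (fun y => f (r y))) => //.
- exact: (fmor_comp Fh Fl).
- exact: (fmor_comp Fr Ff).
Qed.

Lemma fhe_left X Y Z (f : X -> Y) (g : Y -> Z) :
  fmor f -> fhe g -> fhe (fun x => g (f x)) -> fhe f.
Proof.
move=> Ff [Fg [g' [Fg' g'g gg']]] hgf.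
have [_ hg'] : fhe g' by apply: (@fhe_LR _ _ g' g g).
have h : fhe (fun x => g' (g (f x))).
  by apply: (fhe_comp hgf); split.
apply: fhe_hom h.
exact: (fhom_comp (fhom_refl Ff) g'g).
Qed.

Lemma fhe_right X Y Z (f : X -> Y) (g : Y -> Z) :
  fmor g -> fhe f -> fhe (fun x => g (f x)) -> fhe g.
Proof.
move=> Fg [Ff [f' [Ff' f'f ff']]] hgf.
have hf' : fhe f' by apply: (@fhe_LR _ _ f' f f).
apply: fhe_hom (fhe_comp hf' hgf).
exact: (fhom_comp ff' (fhom_refl Fg)).
Qed.

Definition fequiv X Y : Prop := exists f : X -> Y, fhe f.

Lemma fequiv_refl X : fequiv X X.
Proof. by exists id; exact: fhe_id. Qed.

Lemma fequiv_sym X Y : fequiv X Y -> fequiv Y X.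
Proof. by move=> [f [Ff [g [Fg gf fg]]]]; exists g; apply: (@fhe_LR _ _ g f f). Qed.

Lemma fequiv_trans X Y Z : fequiv X Y -> fequiv Y Z -> fequiv X Z.
Proof. by move=> [f hf] [g hg]; exists (fun x => g (f x)); exact: fhe_comp. Qed.

End FilteredHomotopy.
Arguments fhom R {J X Y}.
Arguments fhe R {J X Y}.
Arguments fequiv R {J}.

(** * Double mapping cylinders *)

(** A disjoint union of [X], the open collar and [F] instead of a quotient: maps out of it are
    defined by cases, and distinct constructors give distinct points. *)
Inductive dmc_point (R : realType) (X A F : Type) : Type :=
  | DMX of X
  | DC of A & {t : R | 0 < t < 1}
  | DMF of F.
Arguments DMX {R X A F}.
Arguments DC {R X A F}.
Arguments DMF {R X A F}.

(* The attaching maps only matter for the topology. *)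
Definition dmc (R : realType) (X A F : topologicalType) (i : A -> X) (w : A -> F) : Type :=
  dmc_point R X A F.

Section DoubleMappingCylinder.
Context {R : realType} {X A F : topologicalType}.
Variables (i : A -> X) (w : A -> F).

Local Notation dmc := (@dmc R X A F i w).

Definition DX (x : X) : dmc := DMX x.
Definition DF (y : F) : dmc := DMF y.

HB.instance Definition _ := gen_eqMixin dmc.
HB.instance Definition _ := gen_choiceMixin dmc.

(* The collar coordinate ranges over all of [R]; it is truncated to [0, 1]. *)
Definition dA (z : A * R) : dmc :=
  if z.2 <= 0 then DX (i z.1) else
  if insub z.2 is Some t then (DC z.1 t : dmc) else DF (w z.1).

(** The final topology for [DX], [dA] and [DF]. It glues the collar, because [dA] takes the values
    [DX (i a)] and [DF (w a)] at its ends. *)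
Definition dmc_open (U : set dmc) :=
  [/\ open (DX @^-1` U), open (dA @^-1` U) & open (DF @^-1` U)].

Lemma dmc_openT : dmc_open setT.
Proof. by split; rewrite preimage_setT; exact: openT. Qed.

Lemma dmc_openI : setI_closed dmc_open.
Proof.
by move=> U V [? ? ?] [? ? ?]; split; rewrite preimage_setI; exact: openI.
Qed.

Lemma dmc_open_bigU (I : Type) (f : I -> set dmc) :
  (forall k, dmc_open (f k)) -> dmc_open (\bigcup_k f k).
Proof.
by move=> h; split; rewrite preimage_bigcup; apply: bigcup_open => k _; case: (h k).
Qed.

HB.instance Definition _ :=
  @isOpenTopological.Build dmc dmc_open dmc_openT dmc_openI dmc_open_bigU.

Lemma dmc_openE (U : set dmc) : open U <-> dmc_open U.
Proof.
split=> [|Uo].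
  rewrite openE => oU.
  rewrite (_ : U = \bigcup_(V : {V : set dmc | dmc_open V /\ V `<=` U}) projT1 V).
    by apply: dmc_open_bigU => -[V []].
  apply/seteqP; split=> x.
    by move=> /oU [V [oV Vx VU]]; exists (exist _ V (conj oV VU)).
  by move=> [[V [oV VU]] _ /= /VU].
by rewrite openE => x Ux; rewrite /interior /=; exists U; split.
Qed.

Lemma dA_le0 a t : t <= 0 -> dA (a, t) = DX (i a).
Proof. by rewrite /dA /= => ->. Qed.

Lemma dA_ge1 a t : 1 <= t -> dA (a, t) = DF (w a).
Proof.
move=> t1; rewrite /dA /= leNgt (lt_le_trans ltr01 t1)/= insubF//.
by rewrite (ltNge t) t1 andbF.
Qed.

Lemma dA_clamp a t : dA (a, clamp t) = dA (a, t).
Proof.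
have [t0|t0] := leP t 0; first by rewrite clamp_le0 ?dA_le0.
have [t1|t1] := leP 1 t; first by rewrite clamp_ge1 ?dA_ge1.
by rewrite clamp_id ?ltW.
Qed.

Variant dmc_spec : dmc -> Type :=
  | DmcX x : dmc_spec (DX x)
  | DmcA a t of 0 < t & t < 1 : dmc_spec (dA (a, t))
  | DmcF y : dmc_spec (DF y).

Lemma dmcP d : dmc_spec d.
Proof.
case: d => [x|a [t t01]|y]; [exact: DmcX| |exact: DmcF].
have -> : (DC a (exist _ t t01) : dmc) = dA (a, t).
  rewrite /dA /= leNgt; case/andP: (t01) => -> _ /=.
  by rewrite insubT; congr (DC _ _); apply: val_inj.
by case/andP: t01 => t0 t1; constructor.
Qed.

Lemma ct_DX : continuous DX.
Proof. by apply/continuousP => U /dmc_openE[]. Qed.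

Lemma ct_dA : continuous dA.
Proof. by apply/continuousP => U /dmc_openE[]. Qed.

Lemma ct_DF : continuous DF.
Proof. by apply/continuousP => U /dmc_openE[]. Qed.

Lemma ct_dmc (Z : topologicalType) (f : dmc -> Z) :
  continuous (fun x => f (DX x)) -> continuous (fun z => f (dA z)) ->
  continuous (fun y => f (DF y)) -> continuous f.
Proof.
move=> /continuousP fX /continuousP fA /continuousP fF; apply/continuousP => U oU.
by apply/dmc_openE; split; [exact: fX|exact: fA|exact: fF].
Qed.

(** A product with [R] keeps the final topology: after currying, [ct_dmc] applies to the map into
    the function space. *)
Lemma ct_dmcR (Z : topologicalType) (f : dmc * R -> Z) :
  continuous (fun z : X * R => f (DX z.1, z.2)) ->
  continuous (fun z : A * R * R => f (dA z.1, z.2)) ->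
  continuous (fun z : F * R => f (DF z.1, z.2)) -> continuous f.
Proof.
move=> fX fA fF.
rewrite (_ : f = fun z => f (z.1, z.2)); last by apply/funext => -[].
apply: (@ct_uncurry R dmc Z (fun d t => f (d, t))).
  apply: ct_dmc.
  - exact: (ct_curry fX).
  - exact: (ct_curry fA).
  - exact: (ct_curry fF).
move=> d; case: (dmcP d) => [x|a t _ _|y].
- by apply: (@ct_comp R (X * R)%type Z _ (fun t => (x, t)) fX); cts.
- by apply: (@ct_comp R (A * R * R)%type Z _ (fun s => ((a, t), s)) fA); cts.
- by apply: (@ct_comp R (F * R)%type Z _ (fun t => (y, t)) fF); cts.
Qed.

Definition dmc_map (Z : Type) (fX : X -> Z) (fA : A * R -> Z) (fF : F -> Z) (d : dmc) :=
  match d with DMX x => fX x | DC a t => fA (a, val t) | DMF y => fF y end.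

Lemma dmc_mapA (Z : Type) (fX : X -> Z) (fA : A * R -> Z) (fF : F -> Z) :
  (forall a, fA (a, 0) = fX (i a)) -> (forall a, fA (a, 1) = fF (w a)) ->
  forall z, dmc_map fX fA fF (dA z) = fA (z.1, clamp z.2).
Proof.
move=> f0 f1 [a t].
have [t0|t0] := leP t 0; first by rewrite dA_le0 // clamp_le0 // f0.
have [t1|t1] := leP 1 t; first by rewrite dA_ge1 // clamp_ge1 // f1.
rewrite clamp_id ?ltW// /dA /= leNgt t0 /=; case: insubP => [[u u01] _ /= ->//|].
by rewrite t0 t1.
Qed.

End DoubleMappingCylinder.


Section FilteredDmc.
Context {R : realType} {J : Type}.

Definition dmc_fset (X A F : fsp J) (j : J) : set (dmc_point R X A F) :=
  fun d => match d with
    DMX x => fset j x | DC a _ => fset j a | DMF y => fset j y end.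
Arguments dmc_fset : simpl never.

Definition dmf (X A F : fsp J) (i : A -> X) (w : A -> F) : fsp J :=
  @Fsp J (@dmc R X A F i w) (@dmc_fset X A F).

Section Maps.
Variables (X A F Y : fsp J) (i : A -> X) (w : A -> F).
Hypotheses (Fi : fmor i) (Fw : fmor w).

Lemma fset_dA j a t : fset j a -> fset j (dA i w (a, t) : dmf i w).
Proof.
move=> ja; rewrite /dA /= /dmc_fset; case: ifP => _ /=; first by case: Fi => _; exact.
by case: insub => [u|]//=; case: Fw => _; exact.
Qed.

Lemma fmor_DX : fmor (@DX R X A F i w : X -> dmf i w).
Proof. by split => //; exact: ct_DX. Qed.

Lemma fmor_DF : fmor (@DF R X A F i w : F -> dmf i w).
Proof. by split => //; exact: ct_DF. Qed.

Lemma fmor_dmc_map (fX : X -> Y) (fA : A * R -> Y) (fF : F -> Y) :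
  (forall a, fA (a, 0) = fX (i a)) -> (forall a, fA (a, 1) = fF (w a)) ->
  fmor fX -> continuous fA ->
  (forall j a t, 0 <= t -> t <= 1 -> fset j a -> fset j (fA (a, t))) ->
  fmor fF -> fmor (dmc_map fX fA fF : dmf i w -> Y).
Proof.
move=> f0 f1 [cX jX] cA jA [cF jF]; split.
  apply: ct_dmc => //=.
  rewrite (_ : (fun z => _) = fun z => fA (z.1, clamp z.2)); first by cts.
  by apply/funext => z; rewrite dmc_mapA.
move=> j; case=> [x|a [t t01]|y]; rewrite /= /dmc_fset /=; [exact: jX| |exact: jF].
by case/andP: t01 => t0 t1; apply: jA; rewrite ltW.
Qed.

Lemma fhom_dmc (f g : dmf i w -> Y)
    (HX : X * R -> Y) (HA : A * R * R -> Y) (HF : F * R -> Y) :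
  continuous HX -> continuous HA -> continuous HF ->
  (forall a s, 0 <= s -> s <= 1 -> HA (a, 0, s) = HX (i a, s)) ->
  (forall a s, 0 <= s -> s <= 1 -> HA (a, 1, s) = HF (w a, s)) ->
  (forall x, f (DX i w x) = HX (x, 0)) -> (forall x, g (DX i w x) = HX (x, 1)) ->
  (forall a t, 0 <= t -> t <= 1 -> f (dA i w (a, t)) = HA (a, t, 0)) ->
  (forall a t, 0 <= t -> t <= 1 -> g (dA i w (a, t)) = HA (a, t, 1)) ->
  (forall y, f (DF i w y) = HF (y, 0)) -> (forall y, g (DF i w y) = HF (y, 1)) ->
  (forall j x s, 0 <= s -> s <= 1 -> fset j x -> fset j (HX (x, s))) ->
  (forall j a t s, 0 <= t -> t <= 1 -> 0 <= s -> s <= 1 -> fset j a ->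
     fset j (HA (a, t, s))) ->
  (forall j y s, 0 <= s -> s <= 1 -> fset j y -> fset j (HF (y, s))) ->
  fhom R f g.
Proof.
move=> cX cA cF H0 H1 fX gX fA gA fF gF jX jA jF.
pose c (z : R) : R := clamp z.
pose H (z : dmf i w * R) := dmc_map (fun x => HX (x, c z.2))
  (fun a => HA (a, c z.2)) (fun y => HF (y, c z.2)) z.1.
have HdA z s : H (dA i w z, s) = HA (z.1, c z.2, c s).
  by rewrite /H /= dmc_mapA// => a; [apply: H0|apply: H1];
    rewrite ?clamp_ge0 ?clamp_le1.
apply: (@fhomI _ _ _ _ _ _ H).
- apply: ct_dmcR => /=.
  + by rewrite /H /c /=; cts.
  + rewrite (_ : (fun _ => _) = fun z => HA (z.1.1, c z.1.2, c z.2)).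
      by rewrite /c; cts.
    by apply/funext => -[z s] /=; exact: HdA.
  + by rewrite /H /c /=; cts.
- have c0 : c 0 = 0 by rewrite /c clamp_le0.
  move=> d; case: (dmcP d) => [x|a t t0 t1|y].
  + by rewrite fX /H /= c0.
  + by rewrite HdA c0 /c clamp_id ?fA// ltW.
  + by rewrite fF /H /= c0.
- have c1 : c 1 = 1 by rewrite /c clamp_ge1.
  move=> d; case: (dmcP d) => [x|a t t0 t1|y].
  + by rewrite gX /H /= c1.
  + by rewrite HdA c1 /c clamp_id ?gA// ltW.
  + by rewrite gF /H /= c1.
- move=> j d s s0 s1; rewrite /H /= /c clamp_id//.
  case: d => [x|a [t t01]|y]; rewrite /= /dmc_fset /=.
  + exact: jX.
  + by case/andP: t01 => t0 t1; apply: jA => //; exact: ltW.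
  + exact: jF.
Qed.

End Maps.
End FilteredDmc.

Ltac cts_more ::=
  match goal with
  | |- continuous clamp => exact: (ct_clamp ct_id)
  | |- continuous (DX _ _) => exact: ct_DX
  | |- continuous (DF _ _) => exact: ct_DF
  | |- continuous (dA _ _) => exact: ct_dA
  | |- continuous (fun x => clamp _) => apply: ct_clamp
  | |- continuous (fun x => DX _ _ _) => apply: (ct_comp (@ct_DX _ _ _ _ _ _))
  | |- continuous (fun x => DF _ _ _) => apply: (ct_comp (@ct_DF _ _ _ _ _ _))
  | |- continuous (fun x => dA _ _ _) => apply: (ct_comp (@ct_dA _ _ _ _ _ _))
  end.

Section DmcInvariance.
Context {R : realType} {J : Type}.
Implicit Types X A F : fsp J.

Local Notation D := (@dmf R J _ _ _).

Section Reparametrisation.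
Variables (X A F : fsp J) (i : A -> X) (w : A -> F).
Hypotheses (Fi : fmor i) (Fw : fmor w).

(** Changes the attaching map along a homotopy [h] from [w] to [w']: the lower half of the collar is
    stretched over the whole collar, the upper half runs along [h] inside [F]. *)
Definition dmc_slide (h : A * R -> F) (w' : A -> F) : D i w' -> D i w :=
  dmc_map (DX i w) (fun z => if 2 * z.2 - 1 <= 0 then dA i w (z.1, 2 * z.2)
                             else DF i w (h (z.1, 2 * z.2 - 1))) (DF i w).

End Reparametrisation.
Arguments dmc_slide {X A F} i w h {w'}.

Section Slide.
Variables (X A F : fsp J) (i : A -> X) (w w' : A -> F) (h : A * R -> F).
Hypotheses (Fi : fmor i) (Fw : fmor w) (Fw' : fmor w').
Hypotheses (ch : continuous h) (h0 : forall a t, t <= 0 -> h (a, t) = w a)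
  (h1 : forall a t, 1 <= t -> h (a, t) = w' a)
  (hJ : forall j a t, fset j a -> fset j (h (a, t))).

Lemma dmc_slideA a t : 0 <= t -> t <= 1 -> dmc_slide i w h (dA i w' (a, t)) =
  if 2 * t - 1 <= 0 then dA i w (a, 2 * t) else DF i w (h (a, 2 * t - 1)).
Proof.
move=> t0 t1; rewrite /dmc_slide dmc_mapA /=.
- by rewrite clamp_id.
- by move=> b; rewrite ifT ?mulr0 ?dA_le0//; lra.
- by move=> b; rewrite ifF ?h1//; lra.
Qed.

Lemma fmor_dmc_slide : fmor (dmc_slide i w h : D i w' -> D i w).
Proof.
apply: fmor_dmc_map => //=.
- by move=> b; rewrite ifT ?mulr0 ?dA_le0//; lra.
- by move=> b; rewrite ifF ?h1//; lra.
- exact: fmor_DX.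
- apply: paste; [by cts|by cts|by cts|].
  by move=> [a t]/= t0; rewrite dA_ge1 ?h0//; lra.
- move=> j a t _ _ ja; case: ifP => _; first exact: (fset_dA Fi Fw).
  by have [_ /(_ j)] := fmor_DF (R := R) i w; apply; exact: hJ.
- exact: fmor_DF.
Qed.

(* The collar of the composite runs along [w] and then forth and back along [h]. *)
Lemma dmc_slideK :
  fhom R (fun d => dmc_slide i w h (dmc_slide i w' (fun z => h (z.1, 1 - z.2)) d)) id.
Proof.
pose K : D i w -> D i w := dmc_map (DX i w) (fun z => dA i w (z.1, 4 * z.2)) (DF i w).
have KA a t : 0 <= t -> t <= 1 -> K (dA i w (a, t)) = dA i w (a, 4 * t).
  move=> t0 t1; rewrite /K dmc_mapA /=; first by rewrite clamp_id.
  - by move=> b; rewrite mulr0 dA_le0.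
  - by move=> b; rewrite dA_ge1//; lra.
apply: (@fhom_trans _ _ _ _ _ K).
(* The composite runs through the collar on [0, 1/4], out along [h] on [1/4, 1/2] and back on
   [1/2, 1]; the minimum is the parameter reached on [h]. The factor [1 - z.2] shrinks the excursion
   to [w a]. *)
- apply: (@fhom_dmc R J X A F (D i w) i w _ _ (fun z => DX i w z.1) (fun z =>
    if 4 * z.1.2 - 1 <= 0 then dA i w (z.1.1, 4 * z.1.2)
    else DF i w (h (z.1.1, (1 - z.2) * Num.min (4 * z.1.2 - 1) (2 - 2 * z.1.2))))
    (fun z => DF i w z.1)) => //=.
  + by cts.
  + apply: paste; [by cts|by cts|by cts|].
    move=> [[a t] s]/= t0; rewrite dA_ge1 ?h0//; last lra.
    by rewrite (_ : Num.min _ _ = 0) ?mulr0//; rewrite minEle; case: ifP => ?; lra.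
  + by cts.
  + by move=> a s _ _; rewrite ifT ?dA_le0//; lra.
  + move=> a s s0 s1; rewrite ifF ?h0//; last lra.
    by rewrite (_ : Num.min _ _ = 0) ?mulr0//; rewrite minEle; case: ifP => ?; lra.
  + move=> a t t0 t1; rewrite [X in dmc_slide i w h X](_ : _ =
      if 2 * t - 1 <= 0 then dA i w' (a, 2 * t) else DF i w' (h (a, 2 - 2 * t))).
      rewrite subr0 mul1r; case: ifPn => t2; last first.
        by rewrite ifF; [rewrite (min_idPr _)//; lra|lra].
      rewrite dmc_slideA; [|lra|lra].
      rewrite (_ : 2 * (2 * t) = 4 * t); last by lra.
      by case: ifP => // t4; rewrite (min_idPl _)//; lra.
    rewrite /dmc_slide dmc_mapA /= ?clamp_id//.
    * by case: ifP => // _; congr (DF _ _ (h (_, _))); lra.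
    * by move=> b; rewrite ifT ?mulr0 ?dA_le0//; lra.
    * by move=> b; rewrite ifF ?h0//; lra.
  + move=> a t t0 t1; rewrite KA// subrr mul0r; case: ifP => // t4.
    by rewrite dA_ge1 ?h0//; lra.
  + by move=> j a t s _ _ _ _ ja; case: ifP => _; [exact: (fset_dA Fi Fw)|rewrite /dmc_fset /=; exact: hJ].
- apply: (@fhom_dmc R J X A F (D i w) i w _ _ (fun z => DX i w z.1) (fun z =>
    dA i w (z.1.1, (1 - z.2) * (4 * z.1.2) + z.2 * z.1.2)) (fun z => DF i w z.1)) => //=.
  + by cts.
  + by cts.
  + by cts.
  + by move=> a s _ _; rewrite dA_le0//; lra.
  + by move=> a s s0 s1; rewrite dA_ge1//; lra.
  + by move=> a t t0 t1; rewrite KA//; congr (dA _ _ (_, _)); lra.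
  + by move=> a t t0 t1; congr (dA _ _ (_, _)); lra.
  + by move=> j a t s _ _ _ _ ja; exact: (fset_dA Fi Fw).
Qed.

End Slide.

Lemma fhe_dmc_slide X A F (i : A -> X) (w w' : A -> F) (h : A * R -> F) :
  fmor i -> fmor w -> fmor w' -> continuous h ->
  (forall a t, t <= 0 -> h (a, t) = w a) -> (forall a t, 1 <= t -> h (a, t) = w' a) ->
  (forall j a t, fset j a -> fset j (h (a, t))) ->
  fhe R (dmc_slide i w h : D i w' -> D i w).
Proof.
move=> Fi Fw Fw' ch h0 h1 hJ; pose k (z : A * R) := h (z.1, 1 - z.2).
have ck : continuous k by rewrite /k; cts.
have k0 a t : t <= 0 -> k (a, t) = w' a by move=> ?; rewrite /k /= h1//; lra.
have k1 a t : 1 <= t -> k (a, t) = w a by move=> ?; rewrite /k /= h0//; lra.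
have kJ j a t : fset j a -> fset j (k (a, t)) by exact: hJ.
split; first exact: fmor_dmc_slide.
exists (dmc_slide i w' k); split; first exact: fmor_dmc_slide.
- have := dmc_slideK Fi Fw' ck k0 k1 kJ.
  rewrite (_ : (fun z => k (z.1, 1 - z.2)) = h)//.
  by apply/funext => -[a t]; rewrite /k /= subKr.
- exact: dmc_slideK.
Qed.

End DmcInvariance.
Arguments dmc_slide {R J X A F} i w h {w'}.

Section DmcTarget.
Context {R : realType} {J : Type}.
Implicit Types X A F : fsp J.

Local Notation D := (@dmf R J _ _ _).

Definition dmc_target X A F F' (i : A -> X) (w : A -> F) (a : F -> F') :
    D i w -> D i (fun x => a (w x)) :=
  dmc_map (DX i _) (dA i (fun x => a (w x))) (fun y => DF i _ (a y)).

Lemma dmc_targetA X A F F' (i : A -> X) (w : A -> F) (a : F -> F') z :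
  dmc_target (i := i) a (dA i w z) = dA i (fun x => a (w x)) z.
Proof.
rewrite /dmc_target dmc_mapA ?dA_clamp -?surjective_pairing//.
- by move=> x; rewrite dA_le0.
- by move=> x; rewrite dA_ge1.
Qed.

Lemma fmor_dmc_target X A F F' (i : A -> X) (w : A -> F) (a : F -> F') :
  fmor i -> fmor w -> fmor a -> fmor (dmc_target a : D i w -> _).
Proof.
move=> Fi Fw Fa; apply: fmor_dmc_map.
- by move=> x; rewrite dA_le0.
- by move=> x; rewrite dA_ge1.
- exact: fmor_DX.
- exact: ct_dA.
- by move=> j x t _ _ jx; apply: (fset_dA Fi (fmor_comp Fw Fa)).
- exact: (fmor_comp Fa (fmor_DF _ _)).
Qed.

(** Followed by the slide along the homotopy from [w] to [e] after [w], which is an equivalence, the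
    map becomes homotopic to the identity; two-out-of-three does the rest. *)
Lemma fhe_dmc_target_id X A F (i : A -> X) (w : A -> F) (e : F -> F) :
  fmor i -> fmor w -> fhom R id e -> fhe R (dmc_target e : D i w -> _).
Proof.
move=> Fi Fw he; have Fe := fhom_mapr he; case: he => [E [cE E0 E1 EJ]].
have cw : continuous w by case: Fw.
pose h (z : A * R) := E (w z.1, z.2).
have ch : continuous h by rewrite /h; cts.
have h0 a t : t <= 0 -> h (a, t) = w a by move=> t0; rewrite /h /= E0.
have h1 a t : 1 <= t -> h (a, t) = e (w a) by move=> t1; rewrite /h /= E1.
pose r := dmc_slide i w h (w' := fun x => e (w x)).
have hr : fhe R (r : D i (fun x => e (w x)) -> D i w).
  apply: fhe_dmc_slide => //.
  - exact: fmor_comp.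
  - by move=> j a t ja; apply: EJ; case: Fw => _; apply.
apply: (fhe_left _ hr); first exact: fmor_dmc_target.
suff h2 : fhom R (fun d => r (dmc_target e d)) id.
  exact: (fhe_hom (fhom_sym h2) (fhe_id _)).
pose K : D i w -> D i w := dmc_map (DX i w) (fun z => dA i w (z.1, 2 * z.2)) (DF i w).
have KA a t : 0 <= t -> t <= 1 -> K (dA i w (a, t)) = dA i w (a, 2 * t).
  move=> t0 t1; rewrite /K dmc_mapA /=; first by rewrite clamp_id.
  - by move=> b; rewrite mulr0 dA_le0.
  - by move=> b; rewrite dA_ge1//; lra.
apply: (@fhom_trans _ _ _ _ _ K).
- apply: (@fhom_dmc R J X A F (D i w) i w _ _ (fun z => DX i w z.1) (fun z =>
    if 2 * z.1.2 - 1 <= 0 then dA i w (z.1.1, 2 * z.1.2)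
    else DF i w (E (w z.1.1, (1 - z.2) * (2 * z.1.2 - 1))))
    (fun z => DF i w (E (z.1, 1 - z.2)))) => //=.
  + by cts.
  + apply: paste; [by cts|by cts|by cts|].
    by move=> [[a t] s]/= t0; rewrite dA_ge1 ?E0//; [nra|lra].
  + by cts.
  + by move=> a s _ _; rewrite ifT ?dA_le0//; lra.
  + move=> a s s0 s1; rewrite ifF; last lra.
    by congr (DF _ _ (E (_, _))); lra.
  + move=> a t t0 t1; rewrite /r dmc_targetA dmc_slideA//.
    by case: ifP => // _; congr (DF _ _ (E (_, _))) => /=; lra.
  + move=> a t t0 t1; rewrite KA// subrr mul0r; case: ifP => // t2.
    by rewrite dA_ge1 ?E0//; lra.
  + by move=> y; rewrite E1 ?subr0.
  + by move=> y; rewrite E0 ?subrr.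
  + move=> j a t s _ _ _ _ ja; case: ifP => _; first exact: (fset_dA Fi Fw).
    by rewrite /dmc_fset /=; apply: EJ; case: Fw => _; apply.
  + by move=> j y s _ _ jy; rewrite /dmc_fset /=; apply: EJ.
- apply: (@fhom_dmc R J X A F (D i w) i w _ _ (fun z => DX i w z.1) (fun z =>
    dA i w (z.1.1, (1 - z.2) * (2 * z.1.2) + z.2 * z.1.2)) (fun z => DF i w z.1)) => //=.
  + by cts.
  + by cts.
  + by cts.
  + by move=> a s _ _; rewrite dA_le0//; lra.
  + by move=> a s s0 s1; rewrite dA_ge1//; lra.
  + by move=> a t t0 t1; rewrite KA//; congr (dA _ _ (_, _)); lra.
  + by move=> a t t0 t1; congr (dA _ _ (_, _)); lra.
  + by move=> j a t s _ _ _ _ ja; exact: (fset_dA Fi Fw).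
Qed.

Lemma dmc_target_comp X A F F' F'' (i : A -> X) (w : A -> F) (a : F -> F') (b : F' -> F'')
    (d : D i w) :
  dmc_target b (dmc_target a d) = dmc_target (fun y => b (a y)) d.
Proof.
case: (dmcP d) => [x|x t t0 t1|y] //.
by rewrite !dmc_targetA.
Qed.

(** The inverse [c] of [a] does not lead back to [D i w], since it changes the attaching map once
    more. In the chain induced by [a], [c], [a] both composites of neighbours are equivalences, so
    the middle map is one and then the first is. *)
Lemma fhe_dmc_target X A F F' (i : A -> X) (w : A -> F) (a : F -> F') :
  fmor i -> fmor w -> fhe R a -> fhe R (dmc_target a : D i w -> _).
Proof.
move=> Fi Fw [Fa [c [Fc ca ac]]]; have Faw := fmor_comp Fw Fa.
have h1 : fhe R (fun d : D i w => dmc_target c (dmc_target a d)).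
  apply: (fhe_hom _ (fhe_dmc_target_id Fi Fw (fhom_sym ca))).
  apply: fhom_eq => [|d]; last by rewrite dmc_target_comp.
  by apply: fmor_dmc_target => //; exact: fmor_comp Fa Fc.
have h2 : fhe R (fun d : D i (fun x => a (w x)) =>
    dmc_target a (dmc_target c d)).
  apply: (fhe_hom _ (fhe_dmc_target_id Fi Faw (fhom_sym ac))).
  apply: fhom_eq => [|d]; last by rewrite dmc_target_comp.
  by apply: fmor_dmc_target => //; exact: fmor_comp Fc Fa.
apply: (fhe_left _ _ h1); first exact: fmor_dmc_target.
apply: (fhe_mid _ _ _ h1 h2); try exact: fmor_dmc_target.
by apply: fmor_dmc_target => //; exact: fmor_comp Faw Fc.
Qed.

Definition dmc_swap X A F (i : A -> X) (w : A -> F) : D i w -> D w i :=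
  dmc_map (DF w i) (fun z => dA w i (z.1, 1 - z.2)) (DX w i).

Lemma dmc_swapA X A F (i : A -> X) (w : A -> F) a t :
  dmc_swap (dA i w (a, t)) = dA w i (a, 1 - t).
Proof.
rewrite /dmc_swap dmc_mapA /=.
- rewrite -[RHS]dA_clamp; congr (dA _ _ (_, _)).
  have [t0|t0] := leP t 0; first by rewrite clamp_le0 ?clamp_ge1//; lra.
  have [t1|t1] := leP 1 t; first by rewrite clamp_ge1 ?clamp_le0//; lra.
  by rewrite !clamp_id//; lra.
- by move=> b; rewrite dA_ge1//; lra.
- by move=> b; rewrite dA_le0//; lra.
Qed.

Lemma fmor_dmc_swap X A F (i : A -> X) (w : A -> F) :
  fmor i -> fmor w -> fmor (@dmc_swap X A F i w).
Proof.
move=> Fi Fw; apply: fmor_dmc_map => /=.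
- by move=> b; rewrite dA_ge1//; lra.
- by move=> b; rewrite dA_le0//; lra.
- exact: fmor_DF.
- by cts.
- by move=> j a t _ _ ja; exact: (fset_dA Fw Fi).
- exact: fmor_DX.
Qed.

Lemma fequiv_dmc_swap X A F (i : A -> X) (w : A -> F) :
  fmor i -> fmor w -> fequiv R (D i w) (D w i).
Proof.
have swapK X' A' F' (k : A' -> X') (v : A' -> F') (d : D k v) :
    dmc_swap (dmc_swap d) = d.
  case: (dmcP d) => [x|x t t0 t1|y] //.
  by rewrite !dmc_swapA; congr (dA _ _ (_, _)); lra.
move=> Fi Fw; exists (@dmc_swap X A F i w); split; first exact: fmor_dmc_swap.
exists (@dmc_swap F A X w i); split; first exact: fmor_dmc_swap.
- apply: fhom_eq; last by move=> d; rewrite swapK.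
  by apply: fmor_comp; exact: fmor_dmc_swap.
- apply: fhom_eq; last by move=> d; rewrite swapK.
  by apply: fmor_comp; exact: fmor_dmc_swap.
Qed.

End DmcTarget.

Section DmcSource.
Context {R : realType} {J : Type}.
Implicit Types X A F : fsp J.

Local Notation D := (@dmf R J _ _ _).

Definition dmc_source X A X' A' F (i : A -> X) (i' : A' -> X') (w : A' -> F)
    (fX : X -> X') (fA : A -> A') : D i (fun a => w (fA a)) -> D i' w :=
  dmc_map (fun x => DX i' w (fX x)) (fun z => dA i' w (fA z.1, z.2)) (DF i' w).

Arguments dmc_source {X A X' A' F} i i' w fX fA d.

Section Basics.
Variables (X A X' A' F : fsp J) (i : A -> X) (i' : A' -> X') (w : A' -> F).
Variables (fX : X -> X') (fA : A -> A').
Hypotheses (Fi : fmor i) (Fi' : fmor i') (Fw : fmor w) (FX : fmor fX) (FA : fmor fA).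
Hypothesis fi : forall a, fX (i a) = i' (fA a).

Lemma dmc_sourceA a t :
  dmc_source i i' w fX fA (dA i (fun a => w (fA a)) (a, t)) = dA i' w (fA a, t).
Proof.
rewrite /dmc_source dmc_mapA ?dA_clamp//=.
- by move=> x; rewrite dA_le0// fi.
- by move=> x; rewrite dA_ge1.
Qed.

Lemma fmor_dmc_source : fmor (dmc_source i i' w fX fA).
Proof.
have [cX jX] := FX; have [cA jA] := FA; apply: fmor_dmc_map.
- by move=> x; rewrite dA_le0// fi.
- by move=> x; rewrite dA_ge1.
- exact: (fmor_comp FX (fmor_DX _ _)).
- by cts.
- by move=> j x t _ _ jx; apply: (fset_dA Fi' Fw); exact: jA.
- exact: fmor_DF.
Qed.

End Basics.

Lemma dmc_source_comp X A X' A' X'' A'' F (i : A -> X) (i' : A' -> X') (i'' : A'' -> X'')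
    (w : A'' -> F) (fX : X -> X') (fA : A -> A') (gX : X' -> X'') (gA : A' -> A'') :
  (forall a, fX (i a) = i' (fA a)) -> (forall a, gX (i' a) = i'' (gA a)) ->
  forall d, dmc_source i' i'' w gX gA
              (dmc_source i i' (fun a => w (gA a)) fX fA d) =
            dmc_source i i'' w (fun x => gX (fX x)) (fun a => gA (fA a)) d.
Proof.
move=> fi gi d; case: (dmcP d) => [x|a t t0 t1|y]//.
by rewrite !dmc_sourceA// => a'; rewrite fi gi.
Qed.

(* A pair of self-maps commuting with [i] is deformed to the identity by
   homotopies commuting with [i]. *)
Definition arrow_id X A (i : A -> X) (eX : X -> X) (eA : A -> A) : Prop :=
  exists (EX : X * R -> X) (EA : A * R -> A),
    [/\ [/\ continuous EX, (forall x t, t <= 0 -> EX (x, t) = eX x),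
            (forall x t, 1 <= t -> EX (x, t) = x)
          & (forall j x t, fset j x -> fset j (EX (x, t)))],
        [/\ continuous EA, (forall x t, t <= 0 -> EA (x, t) = eA x),
            (forall x t, 1 <= t -> EA (x, t) = x)
          & (forall j x t, fset j x -> fset j (EA (x, t)))]
      & forall a t, EX (i a, t) = i (EA (a, t))].

(** The map is homotopic to the slide along [w] after [EA]. That [EX] and [EA] commute with [i]
    keeps the deformation compatible at the [X] end of the collar. *)
Lemma fhe_dmc_source_id X A F (i : A -> X) (w : A -> F) (eX : X -> X) (eA : A -> A) :
  fmor i -> fmor w -> fmor eX -> fmor eA -> arrow_id i eX eA ->
  fhe R (dmc_source i i w eX eA).
Proof.
move=> Fi Fw FeX FeA [EX [EA [[cX X0 X1 XJ] [cA A0 A1 AJ] Ei]]].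
have ei a : eX (i a) = i (eA a) by rewrite -(X0 _ 0)// Ei A0.
have [cw jw] := Fw; have [cX' jX'] := FeX; have [cA' jA'] := FeA.
have Fwe := fmor_comp FeA Fw.
pose h (z : A * R) := w (EA (z.1, 1 - z.2)).
have ch : continuous h by rewrite /h; cts.
have h0 a t : t <= 0 -> h (a, t) = w a by move=> t0; rewrite /h /= A1//; lra.
have h1 a t : 1 <= t -> h (a, t) = w (eA a) by move=> t1; rewrite /h /= A0//; lra.
pose r : D i (fun a => w (eA a)) -> D i w := dmc_slide i w h.
have hr : fhe R r.
  by apply: fhe_dmc_slide => // j a t ja; apply: jw; exact: AJ.
apply: (fhe_hom _ hr); apply: fhom_sym.
pose K : D i (fun a => w (eA a)) -> D i w := dmc_map (fun x => DX i w (eX x))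
  (fun z => dA i w (eA z.1, 2 * z.2)) (DF i w).
have KA a t : 0 <= t -> t <= 1 ->
    K (dA i (fun a => w (eA a)) (a, t)) = dA i w (eA a, 2 * t).
  move=> t0 t1; rewrite /K dmc_mapA /=; first by rewrite clamp_id.
  - by move=> b; rewrite mulr0 dA_le0// ei.
  - by move=> b; rewrite dA_ge1//; lra.
apply: (@fhom_trans _ _ _ _ _ K).
- apply: (@fhom_dmc R J X A F (D i w) i (fun a => w (eA a)) _ _
    (fun z => DX i w (eX z.1)) (fun z =>
    dA i w (eA z.1.1, (1 - z.2) * z.1.2 + z.2 * (2 * z.1.2))) (fun z => DF i w z.1)) => //=.
  + by cts.
  + by cts.
  + by cts.
  + by move=> a s _ _; rewrite dA_le0 ?ei//; lra.
  + by move=> a s s0 s1; rewrite dA_ge1//; lra.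
  + by move=> a t t0 t1; rewrite dmc_sourceA//; congr (dA _ _ (_, _)); lra.
  + by move=> a t t0 t1; rewrite KA//; congr (dA _ _ (_, _)); lra.
  + by move=> j x s _ _ jx; rewrite /dmc_fset /=; exact: jX'.
  + by move=> j a t s _ _ _ _ ja; apply: (fset_dA Fi Fw); exact: jA'.
- apply: (@fhom_dmc R J X A F (D i w) i (fun a => w (eA a)) _ _
    (fun z => DX i w (EX z)) (fun z =>
    if 2 * z.1.2 - 1 <= 0 then dA i w (EA (z.1.1, z.2), 2 * z.1.2)
    else DF i w (w (EA (z.1.1, z.2 * (2 - 2 * z.1.2))))) (fun z => DF i w z.1)) => //=.
  + by cts.
  + apply: paste; [by cts|by cts|by cts|].
    move=> [[a t] s]/= t0; rewrite dA_ge1; last lra.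
    by congr (DF _ _ (w (EA (_, _)))); nra.
  + by cts.
  + by move=> a s _ _; rewrite ifT ?dA_le0 ?Ei//; lra.
  + by move=> a s s0 s1; rewrite ifF ?A0//; nra.
  + by move=> x; rewrite X0.
  + by move=> x; rewrite X1.
  + move=> a t t0 t1; rewrite KA// mul0r !A0//; case: ifP => // t2.
    by rewrite dA_ge1//; lra.
  + move=> a t t0 t1; rewrite /r dmc_slideA// A1//; case: ifP => // _.
    by rewrite /h /=; congr (DF _ _ (w (EA (_, _)))); lra.
  + by move=> j x s _ _ jx; rewrite /dmc_fset /=; exact: XJ.
  + move=> j a t s _ _ _ _ ja; case: ifP => _; first by apply: (fset_dA Fi Fw); exact: AJ.
    by rewrite /dmc_fset /=; apply: jw; exact: AJ.
Qed.

(** The pattern of [fhe_dmc_target]: a chain of three induced maps whose neighbouring composites are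
    equivalences. *)
Lemma fhe_dmc_source X A X' A' F (i : A -> X) (i' : A' -> X') (w : A' -> F)
    (fX : X -> X') (fA : A -> A') (gX : X' -> X) (gA : A' -> A) :
  fmor i -> fmor i' -> fmor w -> fmor fX -> fmor fA -> fmor gX -> fmor gA ->
  (forall a, fX (i a) = i' (fA a)) -> (forall a, gX (i' a) = i (gA a)) ->
  arrow_id i (fun x => gX (fX x)) (fun a => gA (fA a)) ->
  arrow_id i' (fun x => fX (gX x)) (fun a => fA (gA a)) ->
  fhe R (dmc_source i i' w fX fA).
Proof.
move=> Fi Fi' Fw FfX FfA FgX FgA fi gi gf fg.
have FwA := fmor_comp FfA Fw.
have h1 : fhe R (fun d => dmc_source i i' w fX fA
    (dmc_source i' i (fun a => w (fA a)) gX gA d)).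
  have FX := fmor_comp FgX FfX; have FA := fmor_comp FgA FfA.
  apply: (fhe_hom _ (fhe_dmc_source_id Fi' Fw FX FA fg)).
  apply: fhom_eq => [|d]; last by rewrite dmc_source_comp.
  by apply: fmor_dmc_source => // a; rewrite gi fi.
have h2 : fhe R (fun d => dmc_source i' i (fun a => w (fA a)) gX gA
    (dmc_source i i' (fun a => w (fA (gA a))) fX fA d)).
  have FX := fmor_comp FfX FgX; have FA := fmor_comp FfA FgA.
  apply: (fhe_hom _ (fhe_dmc_source_id Fi FwA FX FA gf)).
  apply: fhom_eq => [|d]; last by rewrite dmc_source_comp.
  by apply: fmor_dmc_source => // a; rewrite fi gi.
have Fg := fmor_dmc_source Fi FwA FgX FgA gi.
have Ff := fmor_dmc_source Fi' Fw FfX FfA fi.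
have Ff' := fmor_dmc_source Fi' (fmor_comp FgA FwA) FfX FfA fi.
apply: (fhe_right Ff _ h1).
exact: (fhe_mid Ff' Fg Ff h2 h1).
Qed.

End DmcSource.
Arguments dmc_source {R J X A X' A' F} i i' w fX fA d.

(** * Pushouts along collared maps *)

Section Pushout.
Context {X A F Q : topologicalType}.
Variables (i : A -> X) (w : A -> F) (iX : X -> Q) (iF : F -> Q).

(** Uniqueness of [h] is contained in the clause that [iX] and [iF] are jointly onto. *)
Definition is_pushout : Prop :=
  [/\ continuous iX, continuous iF, forall a, iX (i a) = iF (w a),
      forall q, (exists x, q = iX x) \/ (exists y, q = iF y)
    & forall (Z : topologicalType) (hX : X -> Z) (hF : F -> Z),
        continuous hX -> continuous hF -> (forall a, hX (i a) = hF (w a)) ->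
        exists h : Q -> Z, [/\ continuous h, forall x, h (iX x) = hX x
                             & forall y, h (iF y) = hF y]].

(** For closed maps a pushout of sets is one of spaces: the preimage of a closed set under the glued
    map is the union of two images of closed sets. *)
Lemma closed_pushout :
  continuous iX -> continuous iF ->
  (forall C, closed C -> closed (iX @` C)) -> (forall C, closed C -> closed (iF @` C)) ->
  (forall a, iX (i a) = iF (w a)) ->
  (forall q, (exists x, q = iX x) \/ (exists y, q = iF y)) ->
  injective iF ->
  (forall x y, iX x = iF y -> exists2 a, i a = x & w a = y) ->
  (forall x x', iX x = iX x' -> x = x' \/
     exists a a', [/\ i a = x, i a' = x' & w a = w a']) ->
  is_pushout.
Proof.
move=> cX cF clX clF iw srj injF XF XX; split=> // Z hX hF chX chF hiw.
have /choice [h hP] : forall q, exists z,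
    (forall x, q = iX x -> z = hX x) /\ (forall y, q = iF y -> z = hF y).
  move=> q; have [[x ->]|[y ->]] := srj q.
  - exists (hX x); split.
    + move=> x' /XX [->//|[a [a' [<- <- waa']]]].
      by rewrite !hiw waa'.
    + by move=> y /XF [a <- <-].
  - exists (hF y); split; last by move=> y' /injF ->.
    by move=> x /esym/XF [a <- <-].
have hiX x : h (iX x) = hX x by case: (hP (iX x)) => /(_ x erefl).
have hiF y : h (iF y) = hF y by case: (hP (iF y)) => _ /(_ y erefl).
exists h; split => //; apply/continuous_closedP => C clC.
rewrite (_ : h @^-1` C = iX @` (hX @^-1` C) `|` iF @` (hF @^-1` C)).
  apply: closedU; [apply: clX|apply: clF].
  - by move/continuous_closedP : chX; apply.
  - by move/continuous_closedP : chF; apply.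
apply/seteqP; split => q /=.
  have [[x ->]|[y ->]] := srj q; rewrite ?hiX ?hiF => Cq.
  - by left; exists x.
  - by right; exists y.
by case=> -[x /= Cx <-]; rewrite ?hiX ?hiF.
Qed.

Lemma pushout_homotopy (R : realType) (Z : topologicalType)
    (hX : X * R -> Z) (hF : F * R -> Z) : is_pushout ->
  continuous hX -> continuous hF -> (forall a t, hX (i a, t) = hF (w a, t)) ->
  exists h : Q * R -> Z, [/\ continuous h, forall x t, h (iX x, t) = hX (x, t)
                           & forall y t, h (iF y, t) = hF (y, t)].
Proof.
move=> [_ _ _ srj univ] cX cF hiw.
have [] := univ {compact-open, R -> Z} (fun x t => hX (x, t)) (fun y t => hF (y, t)).
- exact: ct_curry.
- exact: ct_curry.
- by move=> a; apply/funext => t; exact: hiw.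
move=> h [ch hhX hhF]; exists (fun z => h z.1 z.2); split => /=.
- apply: ct_uncurry => // q; have [[x ->]|[y ->]] := srj q.
  + by rewrite hhX; apply: (@ct_comp R (X * R)%type Z hX (fun t => (x, t)) cX); cts.
  + by rewrite hhF; apply: (@ct_comp R (F * R)%type Z hF (fun t => (y, t)) cF); cts.
- by move=> x t; rewrite hhX.
- by move=> x t; rewrite hhF.
Qed.

End Pushout.

Section Collar.
Context {R : realType} {J : Type}.
Variables (X A F Q : fsp J) (i : A -> X) (w : A -> F) (iX : X -> Q) (iF : F -> Q).
Local Notation D := (@dmf R J X A F i w).
Let k : D -> Q := dmc_map iX (fun z => iX (i z.1)) iF.

Variables (u : X -> R) (H : X * R -> X) (c : X * R -> D).
Hypotheses (Fi : fmor i) (Fw : fmor w) (FX : fmor iX) (FF : fmor iF).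
Hypothesis po : is_pushout i w iX iF.
Hypothesis QF : forall j y, fset j (iF y) -> fset j y.
Hypothesis QX : forall j x, fset j (iX x) -> fset j x \/ exists y, iX x = iF y.
Hypotheses (cu : continuous u) (cH : continuous H)
  (cc : {within [set z | u z.1 <= 1], continuous c}).
Hypotheses (u0 : forall a, u (i a) = 0) (H0 : forall x, H (x, 0) = x)
  (Hi : forall a t, H (i a, t) = i a)
  (c0 : forall x, u x <= 1 -> c (x, 0) = DX i w (H (x, 1)))
  (ci : forall a t, c (i a, t) = dA i w (a, t))
  (kc : forall x t, u x <= 1 -> k (c (x, t)) = iX (H (x, 1))).
Hypotheses (HJ : forall j x t, 0 <= t -> t <= 1 -> fset j x -> fset j (H (x, t)))
  (cJ : forall j x t, u x <= 1 -> fset j x -> fset j (c (x, t))).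

(** At time 1 this is the homotopy inverse of [k] on [X]: a point of depth [u x] at most 1 is put at
    height [1 - u x] of the collar, so that depth 0 meets [F] and depth 1 meets [H (x, 1)] in [X].
    Time scales the height. *)
Let col (z : X * R) : D :=
  if u z.1 - 1 <= 0 then c (z.1, z.2 * (1 - u z.1)) else DX i w (H (z.1, 1)).

Let ct_col : continuous col.
Proof.
apply: paste_within; first by cts.
- apply: (@within_comp _ _ _ [set z : X * R | u z.1 - 1 <= 0] [set z : X * R | u z.1 <= 1]
    (fun z => (z.1, z.2 * (1 - u z.1))) c _ _ cc).
    by apply: continuous_subspaceT; cts.
  by move=> z /=; lra.
- by apply: continuous_subspaceT; cts.
- move=> [x t]/= ux; have ux1 : 1 - u x = 0 by lra.
  by rewrite ux1 mulr0 c0//; lra.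
Qed.

Let col_fset j x t : fset j x -> fset j (col (x, t)).
Proof.
move=> jx; rewrite /col /=; case: ifPn => ux; first by apply: cJ => //; lra.
by rewrite /dmc_fset /=; apply: HJ.
Qed.

(** [k] collapses the collar, and the inverse reopens it in the region where [u] is at most 1. A map
    [c] into the cylinder takes the place of a retraction onto [A], so that an empty [A] is covered
    too. By [QX] a point of [X] may lie in a step of [Q] only by way of [F]. *)
Lemma fequiv_collar_pushout_map : fequiv R D Q.
Proof.
have [cX jX] := FX; have [cF jF] := FF; have [ci' ji] := Fi.
have [_ _ iw srj univ] := po.
have kA a t : k (dA i w (a, t)) = iX (i a) by rewrite /k dmc_mapA.
have Fk : fmor k.
  apply: fmor_dmc_map => //; first by cts.
  by move=> j a t _ _ ja; apply/jX/ji.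
have cc1 : continuous (fun x => col (x, 1)).
  by apply: (ct_comp ct_col); cts.
have [|p [cp pX pF]] := univ _ _ (DF i w) cc1 (@ct_DF _ _ _ _ _ _).
  by move=> a; rewrite /col /= u0 ci ifT ?dA_ge1//; lra.
have Fp : fmor (p : Q -> D).
  split => // j q jq; have [[x qx]|[y qy]] := srj q; last first.
    by rewrite qy in jq *; rewrite pF /= /dmc_fset /=; exact: QF.
  rewrite qx in jq *; have [jx|[y xy]] := QX jq.
    by rewrite pX; exact: col_fset.
  by rewrite xy in jq *; rewrite pF /= /dmc_fset /=; exact: QF.
exists k; split => //; exists p; split => //.
- apply: fhom_sym.
  pose M : D -> D := dmc_map (fun x => DX i w (H (x, 1))) (dA i w) (DF i w).
  have MA a t : M (dA i w (a, t)) = dA i w (a, t).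
    rewrite /M dmc_mapA ?dA_clamp//.
    - by move=> b; rewrite dA_le0 ?Hi.
    - by move=> b; rewrite dA_ge1.
  apply: (@fhom_trans _ _ _ _ _ M).
  + apply: (@fhom_dmc R J X A F D i w _ _ (fun z => DX i w (H z)) (fun z =>
      dA i w z.1) (fun z => DF i w z.1)) => //=.
    * by cts.
    * by cts.
    * by cts.
    * by move=> a s _ _; rewrite dA_le0 ?Hi.
    * by move=> a s _ _; rewrite dA_ge1.
    * by move=> x; rewrite H0.
    * by move=> j a t s _ _ _ _ ja; exact: (fset_dA Fi Fw).
  + apply: (@fhom_dmc R J X A F D i w _ _ col (fun z =>
      dA i w (z.1.1, Num.max z.1.2 z.2)) (fun z => DF i w z.1)) => //=.
    * by cts.
    * by cts.
    * move=> a s s0 s1; rewrite /col /= u0 ci ifT; last lra.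
      by rewrite (max_idPr s0) subr0 mulr1.
    * by move=> a s s0 s1; rewrite dA_ge1// le_max lexx.
    * move=> x; rewrite /col /=; case: ifP => // ux.
      by rewrite mul0r c0//; lra.
    * by move=> a t t0 t1; rewrite MA (max_idPl t0).
    * by move=> a t t0 t1; rewrite kA iw pF dA_ge1// le_max lexx orbT.
    * by move=> j x s _ _ jx; exact: col_fset.
    * by move=> j a t s _ _ _ _ ja; exact: (fset_dA Fi Fw).
- have cHX : continuous (fun z : X * R => iX (H (z.1, 1 - clamp z.2))) by cts.
  have cHF : continuous (fun z : F * R => iF z.1) by cts.
  have [|h [ch hX hF]] := pushout_homotopy po cHX cHF.
    by move=> a t /=; rewrite Hi iw.
  apply: (@fhomI _ _ _ _ _ _ h) => //.
  + move=> q; have [[x ->]|[y ->]] := srj q; last by rewrite hF pF.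
    rewrite hX pX /= clamp_le0// subr0 /col /=; case: ifP => // ux.
    by rewrite kc//; lra.
  + move=> q; have [[x ->]|[y ->]] := srj q; last by rewrite hF.
    by rewrite hX /= clamp_ge1// subrr H0.
  + move=> j q t t0 t1 jq; have [[x qx]|[y qy]] := srj q; last by rewrite qy hF -qy.
    rewrite qx in jq *; have [jx|[y xy]] := QX jq; last by rewrite xy hF -xy.
    rewrite hX /=; apply: jX; apply: HJ => //.
    * by rewrite subr_ge0 clamp_le1.
    * by rewrite gerBl clamp_ge0.
Qed.

End Collar.

(** [H] deforms the region of depth at most 1 into [A], with end map [rho]; such a point has the
    collar over [rho x] available. *)
Lemma fequiv_collar_pushout (R : realType) (J : Type) (X A F Q : fsp J)
    (i : A -> X) (w : A -> F) (iX : X -> Q) (iF : F -> Q)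
    (u : X -> R) (H : X * R -> X) (rho : X -> A) :
  fmor i -> fmor w -> fmor iX -> fmor iF -> is_pushout i w iX iF ->
  (forall j y, fset j (iF y) -> fset j y) ->
  (forall j x, fset j (iX x) -> fset j x \/ exists y, iX x = iF y) ->
  continuous u -> continuous H -> {within [set x | u x <= 1], continuous rho} ->
  (forall a, u (i a) = 0) -> (forall x, H (x, 0) = x) -> (forall a t, H (i a, t) = i a) ->
  (forall x, u x <= 1 -> H (x, 1) = i (rho x)) -> (forall a, rho (i a) = a) ->
  (forall j x t, 0 <= t -> t <= 1 -> fset j x -> fset j (H (x, t))) ->
  (forall j x, u x <= 1 -> fset j x -> fset j (rho x)) ->
  fequiv R (@dmf R J X A F i w) Q.
Proof.
move=> Fi Fw FX FF po QF QX cu cH crho u0 H0 Hi H1 rhoi HJ rhoJ.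
apply: (@fequiv_collar_pushout_map _ _ _ _ _ _ i w iX iF u H
  (fun z => dA i w (rho z.1, z.2))) => //.
- have c1 : {within [set z : X * R | u z.1 <= 1], continuous
      (fun z => (rho z.1, z.2))}.
    apply: within_pair; last by apply: continuous_subspaceT; cts.
    apply: (within_comp (B := [set x | u x <= 1]) _ _ crho) => //.
    by apply: continuous_subspaceT; cts.
  by apply: (within_comp (B := setT) c1) => //; apply: continuous_subspaceT; cts.
- by move=> x ux; rewrite dA_le0 ?H1.
- by move=> a t /=; rewrite rhoi.
- by move=> x t ux /=; rewrite dmc_mapA ?H1//; case: po.
- by move=> j x t ux jx; apply: (fset_dA Fi Fw); exact: rhoJ.
Qed.

(* Without attaching the collar is irrelevant; there may be no map [X -> A]. *)
Lemma fequiv_empty_pushout (R : realType) (J : Type) (X A F Q : fsp J)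
    (i : A -> X) (w : A -> F) (iX : X -> Q) (iF : F -> Q) : ~ inhabited A ->
  fmor iX -> fmor iF -> is_pushout i w iX iF ->
  (forall j y, fset j (iF y) -> fset j y) ->
  (forall j x, fset j (iX x) -> fset j x \/ exists y, iX x = iF y) ->
  fequiv R (@dmf R J X A F i w) Q.
Proof.
move=> A0 FX FF po QF QX.
have A0' (a : A) : False by case: A0.
have Fa (Y : fsp J) (f : A -> Y) : fmor f.
  by split => [a|j a]; case: (A0' a).
apply: (@fequiv_collar_pushout_map _ _ _ _ _ _ i w iX iF (fun=> 2) fst
  (fun z => DX i w z.1)) => //.
- by cts.
- by cts.
- by apply: continuous_subspaceT; cts.
Qed.

(** * Absolute neighbourhood extensors *)

Section DistanceToSet.
Context {R : realType} {n : nat}.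
Variable A : set 'rV[R]_n.
Hypothesis A0 : A !=set0.

Definition set_dist (z : 'rV[R]_n) : R := inf [set `|z - a| | a in A].

Let dist_lb z : has_lbound [set `|z - a| | a in A].
Proof. by exists 0 => _ [a _ <-]; exact: normr_ge0. Qed.

Lemma set_dist_ge0 z : 0 <= set_dist z.
Proof.
apply: lb_le_inf; first by have [a Aa] := A0; exists `|z - a|, a.
by move=> _ [a _ <-]; exact: normr_ge0.
Qed.

Lemma set_dist_lip z y : set_dist z <= `|z - y| + set_dist y.
Proof.
rewrite -lerBlDl; apply: lb_le_inf.
  by have [a Aa] := A0; exists `|y - a|, a.
move=> _ [a Aa <-]; rewrite lerBlDl; apply: (@le_trans _ _ `|z - a|).
  by apply: ge_inf; [exact: dist_lb|exists a].
by rewrite -[z - a](subrKA y) ler_normD.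
Qed.

Lemma set_dist_continuous : continuous set_dist.
Proof.
move=> z; apply: (proj2 (@cvgrPdist_lt _ _ _ (nbhs z) (nbhs_filter z) _ _)) => e e0.
have c : continuous (fun y : 'rV[R]_n => `|z - y|) by cts.
have := proj1 (@cvgrPdist_lt _ _ _ (nbhs z) (nbhs_filter z) _ _) (c z) e e0.
apply: (@filterS _ _ (nbhs_filter z)) => y.
rewrite subrr normr0 sub0r normrN normr_id; apply: le_lt_trans.
rewrite ler_norml.
have := set_dist_lip z y; have := set_dist_lip y z; rewrite (distrC y z).
by move=> *; apply/andP; split; lra.
Qed.

Lemma set_dist_mem z : A z -> set_dist z = 0.
Proof.
move=> Az; apply/eqP; rewrite eq_le set_dist_ge0 andbT.
by apply: ge_inf; [exact: dist_lb|exists z => //; rewrite subrr normr0].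
Qed.

Lemma set_dist_eq0 z : closed A -> set_dist z = 0 -> A z.
Proof.
move=> cA dz; apply: cA => U /nbhs_ballP [e /= e0 eU].
have [_ [a Aa <-] ae] : exists2 r, [set `|z - a| | a in A] r & r < e.
  have hi : has_inf [set `|z - a| | a in A].
    by split; [have [a Aa] := A0; exists `|z - a|, a|exact: dist_lb].
  have [r Er rlt] := inf_adherent e0 hi; exists r => //.
  by move: rlt; rewrite -/(set_dist z) dz add0r.
exists a; split => //; apply: eU.
by rewrite -ball_normE.
Qed.

End DistanceToSet.

Lemma closed_within_preimage (X Y : topologicalType) (A : set X) (f : X -> Y) (C : set Y) :
  closed A -> {within A, continuous f} -> closed C -> closed (A `&` f @^-1` C).
Proof.
move=> clA /continuous_closedP cf clC.
have /closed_subspaceP [V clV VE] := cf _ clC.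
by rewrite setIC -VE; exact: closedI.
Qed.

Lemma closed_leF (R : realType) (X : topologicalType) (f g : X -> R) :
  continuous f -> continuous g -> closed [set x | f x <= g x].
Proof.
move=> cf cg; rewrite (_ : [set _ | _] = (fun x => g x - f x) @^-1` [set t | 0 <= t]).
  have c : continuous (fun x => g x - f x) by cts.
  by move/continuous_closedP : c; apply; exact: closed_ge.
by apply/seteqP; split => x /=; rewrite subr_ge0.
Qed.

(** Closed subsets of Euclidean spaces suffice as domains, since compact spaces are embedded there
    in the end. The notion is relative to a subset [S] so that pieces of a space can be united and
    intersected without passing to subtypes. *)
Definition ANE (R : realType) (T : topologicalType) (S : set T) : Prop :=
  forall n (A : set 'rV[R]_n) (f : 'rV[R]_n -> T),
    closed A -> {within A, continuous f} -> (forall x, A x -> S (f x)) ->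
    exists U (g : 'rV[R]_n -> T), [/\ open U, A `<=` U, {within U, continuous g},
      (forall x, U x -> S (g x)) & (forall x, A x -> g x = f x)].

Section ANE.
Context {R : realType}.

Lemma ANE_set0 (T : topologicalType) : ANE R (@set0 T).
Proof.
move=> n A f clA cf Af; exists set0, f; split.
- exact: open0.
- by move=> x /Af.
- exact: continuous_subspace0.
- by [].
- by [].
Qed.

Lemma ANE_retract (T T' : topologicalType) (S : set T) (S' : set T')
    (i : T -> T') (r : T' -> T) :
  {within S, continuous i} -> (forall x, S x -> S' (i x)) ->
  {within S', continuous r} -> (forall y, S' y -> S (r y)) ->
  (forall x, S x -> r (i x) = x) -> ANE R S' -> ANE R S.
Proof.
move=> ci iS cr rS ri S'A n A f clA cf Af.
have [U [g [oU AU cg gU gf]]] := S'A _ _ (fun x => i (f x)) clA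
  (within_comp cf Af ci) (fun x Ax => iS _ (Af x Ax)).
exists U, (fun x => r (g x)); split => //.
- exact: within_comp cg gU cr.
- by move=> x Ux; exact/rS/gU.
- by move=> x Ax; rewrite gf// ri//; exact: Af.
Qed.

Lemma ANE_setX (T T' : topologicalType) (S : set T) (S' : set T') :
  ANE R S -> ANE R S' -> ANE R (S `*` S').
Proof.
move=> hS hS' n A f clA cf Af.
have c1 : {within A, continuous (fun x => (f x).1)}.
  by apply: (within_comp (B := setT) (g := fst) cf) => //; apply: continuous_subspaceT; cts.
have c2 : {within A, continuous (fun x => (f x).2)}.
  by apply: (within_comp (B := setT) (g := snd) cf) => //; apply: continuous_subspaceT; cts.
have [U [g [oU AU cg gU gf]]] := hS _ _ _ clA c1 (fun x Ax => (Af x Ax).1).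
have [V [h [oV AV ch hV hf]]] := hS' _ _ _ clA c2 (fun x Ax => (Af x Ax).2).
exists (U `&` V), (fun x => (g x, h x)); split.
- exact: openI.
- by move=> x Ax; split; [exact: AU|exact: AV].
- apply: within_pair.
  + by apply: continuous_subspaceW cg => x [].
  + by apply: continuous_subspaceW ch => x [].
- by move=> x [Ux Vx]; split; [exact: gU|exact: hV].
- by move=> x Ax; rewrite gf// hf// -surjective_pairing.
Qed.

(** Tietze's theorem extends the composite with [i] coordinate by coordinate, and [r] is applied
    where the extension lies in [U]. The bound [M] is there because Tietze's theorem is applied to
    bounded functions. *)
Lemma ANE_nbhd_retract (T : topologicalType) (S : set T) m (M : R) (U : set 'rV[R]_m)
    (i : T -> 'rV[R]_m) (r : 'rV[R]_m -> T) : 0 < M ->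
  {within S, continuous i} -> (forall x, S x -> U (i x)) -> open U ->
  {within U, continuous r} -> (forall y, U y -> S (r y)) ->
  (forall x, S x -> r (i x) = x) -> (forall x j, S x -> `|i x ord0 j| <= M) -> ANE R S.
Proof.
move=> M0 ci iU oU cr rS ri iM n A f clA cf Af.
have cif : {within A, continuous (fun x => i (f x))} by exact: within_comp cf Af ci.
have /choice [g gP] : forall j, exists g : 'rV[R]_n -> R,
    continuous g /\ (forall x, A x -> g x = i (f x) ord0 j).
  move=> j.
  have cj : {within A, continuous (fun x => i (f x) ord0 j)}.
    apply: (within_comp (B := setT) (g := fun v : 'rV[R]_m => v ord0 j) cif) => //.
    by apply: continuous_subspaceT; exact: (@coord_continuous R 1 m ord0 j).
  have [|g [gE cg _]] := continuous_bounded_extension (@pseudometric_normal R _) clA M0 cj.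
    by move=> x Ax; apply: iM; exact: Af.
  by exists g; split => // x Ax; rewrite -gE// inE.
pose G x := \row_j g j x.
have cG : continuous G by apply: ct_row => j; case: (gP j).
have GE x : A x -> G x = i (f x).
  by move=> Ax; apply/rowP => j; rewrite mxE; case: (gP j) => _ ->//; rewrite ord1.
exists (G @^-1` U), (fun x => r (G x)); split.
- by move/continuousP : cG; apply.
- by move=> x Ax; rewrite /= GE//; exact/iU/Af.
- by apply: (within_comp (B := U) _ _ cr) => //; exact: continuous_subspaceT.
- by move=> x /= Ux; exact: rS.
- by move=> x Ax; rewrite GE// ri//; exact: Af.
Qed.

(** Points closer to [A1] and points closer to [A2] are separated by a seam, which meets [A] only in
    [A1]&[A2]. The map is extended near that intersection into [X1]&[X2] and then, with the values
    on the seam prescribed, on each side into [X1] or [X2]. *)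
Lemma ANE_setU (T : topologicalType) (X1 X2 : set T) : closed X1 -> closed X2 ->
  ANE R X1 -> ANE R X2 -> ANE R (X1 `&` X2) -> ANE R (X1 `|` X2).
Proof.
move=> cl1 cl2 h1 h2 h0 n A f clA cf Af.
pose A1 := A `&` f @^-1` X1; pose A2 := A `&` f @^-1` X2.
have clA1 : closed A1 by exact: closed_within_preimage.
have clA2 : closed A2 by exact: closed_within_preimage.
have A12 x : A x -> A1 x \/ A2 x by move=> Ax; case: (Af x Ax); [left|right].
have [A1n|A1n] := pselect (A1 !=set0); last first.
  have [|U [g [oU AU cg gU gf]]] := h2 _ _ _ clA cf.
    by move=> x Ax; case: (A12 x Ax) => [A1x|[]//]; case: A1n; exists x.
  by exists U, g; split => // x Ux; right; exact: gU.
have [A2n|A2n] := pselect (A2 !=set0); last first.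
  have [|U [g [oU AU cg gU gf]]] := h1 _ _ _ clA cf.
    by move=> x Ax; case: (A12 x Ax) => [[]//|A2x]; case: A2n; exists x.
  by exists U, g; split => // x Ux; left; exact: gU.
pose d1 := set_dist A1; pose d2 := set_dist A2.
have cd1 : continuous d1 by exact: set_dist_continuous.
have cd2 : continuous d2 by exact: set_dist_continuous.
pose Z1 := [set z | d1 z <= d2 z]; pose Z2 := [set z | d2 z <= d1 z].
have clZ1 : closed Z1 by exact: closed_leF.
have clZ2 : closed Z2 by exact: closed_leF.
have AZ1 x : A x -> Z1 x -> A1 x.
  move=> Ax Z1x; case: (A12 x Ax) => // A2x; apply: set_dist_eq0 => //.
  apply/eqP; rewrite eq_le set_dist_ge0// andbT.
  by rewrite -(set_dist_mem A2n A2x).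
have AZ2 x : A x -> Z2 x -> A2 x.
  move=> Ax Z2x; case: (A12 x Ax) => // A1x; apply: set_dist_eq0 => //.
  apply/eqP; rewrite eq_le set_dist_ge0// andbT.
  by rewrite -(set_dist_mem A1n A1x).
pose A0 := A1 `&` A2.
have clA0 : closed A0 by exact: closedI.
have [||U0 [g0 [oU0 AU0 cg0 gU0 gf0]]] := h0 _ _ f clA0.
- by apply: continuous_subspaceW cf => x [[]].
- by move=> x [[_ ?] [_ ?]].
have [V nV VU] : exists2 V, set_nbhs A0 V & closure V `<=` U0.
  apply: (@pseudometric_normal R 'rV[R]_n) => //.
  by apply/set_nbhsP; exists U0; split.
pose C0 := closure V `&` (Z1 `&` Z2).
have clC0 : closed C0 by apply: closedI; [exact: closed_closure|exact: closedI].
have cg00 : {within C0, continuous g0} by apply: continuous_subspaceW cg0 => x [/VU].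
have ext (Ai : set 'rV[R]_n) (Xi : set T) : closed Ai -> ANE R Xi ->
    Ai `<=` A -> (forall x, Ai x -> Xi (f x)) -> X1 `&` X2 `<=` Xi ->
    (forall x, Ai x -> (Z1 `&` Z2) x -> A0 x) ->
    exists U g, [/\ open U, Ai `<=` U, C0 `<=` U, {within U, continuous g} &
     [/\ forall x, U x -> Xi (g x), forall x, Ai x -> g x = f x
       & forall x, C0 x -> g x = g0 x]].
  move=> clAi hi AiA fi Xi0 AiZ.
  pose fi' x := if x \in Ai then f x else g0 x.
  have fiA x : Ai x -> fi' x = f x by rewrite /fi'; move/mem_set ->.
  have fiC x : C0 x -> fi' x = g0 x.
    move=> C0x; rewrite /fi'; case: ifPn => // /set_mem Aix.
    by rewrite gf0//; apply: AiZ => //; case: C0x.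
  have cfi : {within Ai `|` C0, continuous fi'}.
    apply: withinU_continuous => //.
    - apply: (within_eq (f := f)) => [x Ax|]; first by rewrite fiA.
      exact: continuous_subspaceW cf.
    - by apply: (within_eq (f := g0)) => // x Ax; rewrite fiC.
  have [|U [g [oU AU cg gU gf]]] := hi _ _ _ (closedU clAi clC0) cfi.
    move=> x [Ax|C0x]; first by rewrite fiA//; exact: fi.
    by rewrite fiC//; apply/Xi0/gU0/VU; case: C0x.
  exists U, g; split => //.
  - by move=> x Ax; apply: AU; left.
  - by move=> x Ax; apply: AU; right.
  - split => //.
    + by move=> x Ax; rewrite gf ?fiA//; left.
    + by move=> x Cx; rewrite gf ?fiC//; right.
have [U1 [g1 [oU1 AU1 CU1 cg1 [gX1 gf1 g10]]]] : exists U g, [/\ open U, A1 `<=` U,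
    C0 `<=` U, {within U, continuous g} & [/\ forall x, U x -> X1 (g x),
    forall x, A1 x -> g x = f x & forall x, C0 x -> g x = g0 x]].
  apply: ext clA1 h1 _ _ _ _.
  - by move=> x [].
  - by move=> x [].
  - by move=> x [].
  - by move=> x A1x [_ Z2x]; split => //; apply: AZ2 => //; case: A1x.
have [U2 [g2 [oU2 AU2 CU2 cg2 [gX2 gf2 g20]]]] : exists U g, [/\ open U, A2 `<=` U,
    C0 `<=` U, {within U, continuous g} & [/\ forall x, U x -> X2 (g x),
    forall x, A2 x -> g x = f x & forall x, C0 x -> g x = g0 x]].
  apply: ext clA2 h2 _ _ _ _.
  - by move=> x [].
  - by move=> x [].
  - by move=> x [].
  - by move=> x A2x [Z1x _]; split => //; apply: AZ1 => //; case: A2x.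
(* A point is kept if the extension for its side is defined there; on the seam it must also lie in
   the interior of [V], where [g1] and [g2] agree. *)
pose U := (~` Z1 `|` U1) `&` (~` Z2 `|` U2) `&` (~` (Z1 `&` Z2) `|` V°).
have ZZ x : d1 x <= d2 x \/ d2 x <= d1 x.
  by case: (leP (d1 x) (d2 x)) => [|/ltW]; [left|right].
exists U, (fun x => if d1 x - d2 x <= 0 then g1 x else g2 x); split.
- apply: openI; [apply: openI|]; apply: openU => //.
  + exact: closed_openC.
  + exact: closed_openC.
  + by apply: closed_openC; exact: closedI.
  + exact: open_interior.
- move=> x Ax; split; [split|].
  + have [Z1x|?] := pselect (Z1 x); last by left.
    by right; apply/AU1/AZ1.
  + have [Z2x|?] := pselect (Z2 x); last by left.
    by right; apply/AU2/AZ2.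
  + have [[Z1x Z2x]|?] := pselect ((Z1 `&` Z2) x); last by left.
    by right; apply: nV; split; [exact: AZ1|exact: AZ2].
- apply/within_set_type; apply: paste_within; first by cts.
  + have c : {within [set x : set_type U | d1 (set_val x) - d2 (set_val x) <= 0],
        continuous set_val} by apply: continuous_subspaceT; cts.
    apply: (within_comp c _ cg1) => -[x Ux]; rewrite /= set_valE /=.
    by move: (set_mem Ux) => [[[nZ|//] _] _]; rewrite subr_le0.
  + have c : {within [set x : set_type U | 0 <= d1 (set_val x) - d2 (set_val x)],
        continuous set_val} by apply: continuous_subspaceT; cts.
    apply: (within_comp c _ cg2) => -[x Ux]; rewrite /= set_valE /=.
    by move: (set_mem Ux) => [[_ [nZ|//]] _]; rewrite subr_ge0.
  + move=> x /eqP; rewrite subr_eq0 => /eqP dd.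
    have Zx : (Z1 `&` Z2) (set_val x) by split; rewrite /Z1 /Z2 /= dd.
    have Cx : C0 (set_val x).
      split => //; apply: subset_closure; apply: interior_subset.
      by have [_ [nZ|]] := set_valP' x.
    by rewrite g10// g20.
- move=> x [[Z1U Z2U] _]; case: ifPn => dd.
  + by left; apply: gX1; case: Z1U => // nZ; case: nZ; rewrite /Z1/= -subr_le0.
  + right; apply: gX2; case: Z2U => // nZ; case: nZ; rewrite /Z2/= -subr_ge0.
    by move: dd; rewrite -ltNge => /ltW.
- move=> x Ax; case: ifPn => dd.
  + by apply: gf1; apply: AZ1 => //; rewrite /Z1/= -subr_le0.
  + apply: gf2; apply: AZ2 => //; rewrite /Z2/= -subr_ge0.
    by move: dd; rewrite -ltNge => /ltW.
Qed.

End ANE.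

(** * Compact ANEs *)

Lemma compact_setU2 (T : topologicalType) (A B : set T) :
  compact A -> compact B -> compact (A `|` B).
Proof.
move=> /compact_near_coveringP cA /compact_near_coveringP cB.
apply/compact_near_coveringP => I F P FF AB.
have hA := cA I F P FF (fun x Ax => AB x (or_introl Ax)).
have hB := cB I F P FF (fun x Bx => AB x (or_intror Bx)).
by apply: filterS2 hA hB => i hA hB x [/hA|/hB].
Qed.

Lemma compact_set_type (T : topologicalType) (S : set T) :
  compact S -> compact [set: set_type S].
Proof.
move=> cS F PF _.
have PG : ProperFilter (set_val @ F) by apply: fmap_proper_filter.
have GS : (set_val @ F) S.
  rewrite /nbhs/= (_ : set_val @^-1` S = setT); first exact: filterT.
  by apply/seteqP; split => // x _; exact: set_valP'.
have [x [Sx clx]] := cS _ PG GS.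
exists (mksub Sx); split => // A B FA [C [[D oD DC] Cx CB]].
have Dx : D x by move: Cx; rewrite -DC /= mksubK.
have [|y [[a Aa <-] Dy]] := clx (set_val @` A) D _ (open_nbhs_nbhs (conj oD Dx)).
  by rewrite /nbhs/=; apply: filterS FA => a Aa; exists a.
by exists a; split => //; apply: CB; rewrite -DC.
Qed.

Lemma compact_bigcup_seq (T : topologicalType) (I : eqType) (l : seq I) (F : I -> set T) :
  (forall i, compact (F i)) -> compact [set x | exists2 i, i \in l & F i x].
Proof.
move=> cF; elim: l => [|a l ih].
  rewrite (_ : [set _ | _] = set0); first exact: compact0.
  by apply/seteqP; split => x //= -[].
rewrite (_ : [set _ | _] = F a `|` [set x | exists2 i, i \in l & F i x]).
  exact: compact_setU2.
apply/seteqP; split => x /=.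
- move=> [i]; rewrite inE => /orP[/eqP ->|il Fx]; first by left.
  by right; exists i.
- move=> [Fx|[i il Fx]]; first by exists a; rewrite ?mem_head.
  by exists i; rewrite // inE il orbT.
Qed.

Section CompactANE.
Context {R : realType}.

Lemma compact_image (T U : topologicalType) (f : T -> U) (A : set T) :
  continuous f -> compact A -> compact (f @` A).
Proof. by move=> cf; apply: continuous_compact; exact: continuous_subspaceT. Qed.

Lemma hausdorff_inj (T U : topologicalType) (f : T -> U) :
  continuous f -> injective f -> hausdorff_space U -> hausdorff_space T.
Proof.
move=> cf injf hU x y cxy; apply: injf; apply: hU => A B nA nB.
have [z [/= Az Bz]] := cxy _ _ (cf x _ nA) (cf y _ nB).
by exists (f z).
Qed.

(** A continuous injection is enough, as it is an embedding when [T] is compact. *)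
Definition embeddable (T : topologicalType) : Prop :=
  exists N (e : T -> 'rV[R]_N), continuous e /\ injective e.

Lemma embeddable_hausdorff T : embeddable T -> hausdorff_space T.
Proof. by move=> [N [e [ce ie]]]; apply: (hausdorff_inj ce ie); exact: norm_hausdorff. Qed.

Lemma embeddable_prod T U : embeddable T -> embeddable U -> embeddable (T * U)%type.
Proof.
move=> [N [e [ce ie]]] [N' [e' [ce' ie']]].
exists (N + N')%N, (fun z => row_mx (e z.1) (e' z.2)); split; first by cts.
by move=> [x y] [x' y'] /= /eq_row_mx [/ie -> /ie' ->].
Qed.

Lemma embeddable_inj (T U : topologicalType) (f : T -> U) :
  continuous f -> injective f -> embeddable U -> embeddable T.
Proof.
move=> cf jf [N [e [ce ie]]]; exists N, (fun x => e (f x)); split; first by cts.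
by move=> x y /ie/jf.
Qed.

Lemma embeddable_rV n : embeddable 'rV[R]_n.
Proof. by exists n, (fun x => x); split; [cts|move=> x y]. Qed.

Lemma embeddable_R : embeddable R.
Proof.
exists 1%N, (fun t => \row_(j < 1) t); split; first by cts.
by move=> s t /rowP /(_ ord0); rewrite !mxE.
Qed.

Lemma compact_inverse (T U : topologicalType) (f : T -> U) (S : set T) (x0 : T) :
  compact S -> {within S, continuous f} -> hausdorff_space U ->
  (forall x y, S x -> S y -> f x = f y -> x = y) ->
  exists g : U -> T, [/\ {within f @` S, continuous g}, forall y, (f @` S) y -> S (g y)
                       & forall x, S x -> g (f x) = x].
Proof.
move=> cS cf hU injf.
pose g y := if pselect (exists2 x, S x & f x = y) is left h then s2val (cid2 h) else x0.
have gf x : S x -> g (f x) = x.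
  move=> Sx; rewrite /g; case: pselect => [h|[]]; last by exists x.
  by case: cid2 => x' Sx' fx' /=; exact: injf.
exists g; split; [|by move=> _ [x Sx <-]; rewrite (gf _ Sx)|exact: gf].
apply/continuous_closedP => C clC; apply/closed_subspaceP.
exists (f @` (S `&` C)).
  apply: compact_closed => //; apply: continuous_compact.
    by apply: continuous_subspaceW cf => x [].
  exact: compact_closedI.
apply/seteqP; split => y /=.
- move=> [[x [Sx Cx] <-] fy]; split => //; by rewrite /from_subspace gf.
- move=> [+ [x Sx xy]]; rewrite -xy /from_subspace gf// => Cx.
  by split; exists x.
Qed.

Lemma ANE_image (T U : topologicalType) (f : T -> U) (S : set T) :
  compact S -> {within S, continuous f} -> hausdorff_space U ->
  (forall x y, S x -> S y -> f x = f y -> x = y) -> ANE R S -> ANE R (f @` S).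
Proof.
move=> cS cf hU injf hS.
have [[x0 _]|S0] := pselect (S !=set0); last first.
  rewrite (_ : S = set0) ?image_set0; first exact: ANE_set0.
  by apply/seteqP; split => x // Sx; case: S0; exists x.
have [g [cg gS gf]] := compact_inverse x0 cS cf hU injf.
apply: (ANE_retract (i := g) (r := f) cg gS cf _ _ hS).
- by move=> x Sx; exists x.
- by move=> _ [x Sx <-]; rewrite gf.
Qed.

(** [F a] meets the union of the others in the union of the sets [F a]&[F i], to which the induction
    hypothesis applies; this is why all finite intersections are assumed to be ANEs. *)
Lemma ANE_bigcup_seq (T : topologicalType) (I : choiceType) (F : I -> set T) (l : seq I) :
  (forall i, closed (F i)) ->
  (forall i (J : seq I), ANE R (F i `&` [set x | forall j, j \in J -> F j x])) ->
  ANE R [set x | exists2 i, i \in l & F i x].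
Proof.
elim: l F => [F _ _|a l ih F clF hF].
  rewrite (_ : [set _ | _] = set0); first exact: ANE_set0.
  by apply/seteqP; split => x //= -[].
rewrite (_ : [set _ | _] = F a `|` [set x | exists2 i, i \in l & F i x]); last first.
  apply/seteqP; split => x /=.
  - move=> [i]; rewrite inE => /orP[/eqP ->|il Fx]; first by left.
    by right; exists i.
  - move=> [Fx|[i il Fx]]; first by exists a; rewrite ?mem_head.
    by exists i; rewrite // inE il orbT.
apply: ANE_setU => //.
- rewrite (_ : [set _ | _] = \bigcup_(i in [set` l]) F i).
    by apply: closed_bigcup => //; exact: finite_seq.
  by apply/seteqP; split => x /= [i il Fx]; exists i.
- have := hF a [::]; rewrite (_ : _ `&` _ = F a)//.
  by apply/seteqP; split => x //= [].
- exact: ih.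
- rewrite (_ : _ `&` _ = [set x | exists2 i, i \in l & (F a `&` F i) x]); last first.
    apply/seteqP; split => x /=.
    + by move=> [Fa [i il Fi]]; exists i.
    + by move=> [i il [Fa Fi]]; split => //; exists i.
  apply: ih => [i|i J]; first exact: closedI.
  suff <- : F i `&` [set x | forall j, j \in a :: J -> F j x] =
      (F a `&` F i) `&` [set x | forall j, j \in J -> (F a `&` F j) x] by exact: hF.
  apply/seteqP; split => x /=.
  + move=> [Fi h]; split; first by split => //; apply: h; rewrite mem_head.
    by move=> j jJ; split; apply: h; rewrite ?mem_head// inE jJ orbT.
  + move=> [[Fa Fi] h]; split => // j; rewrite inE => /orP[/eqP ->//|/h[]//].
Qed.

Lemma ANE_interval : ANE R [set t : R | 0 <= t <= 1].
Proof.
apply: (@ANE_nbhd_retract R R _ 1 1 setT (fun t => \row_(j < 1) t)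
  (fun v => clamp (v ord0 ord0))).
- exact: ltr01.
- by apply: continuous_subspaceT; cts.
- by [].
- exact: openT.
- by apply: continuous_subspaceT; cts.
- by move=> y _ /=; rewrite clamp_ge0 clamp_le1.
- by move=> t /= /andP[t0 t1]; rewrite mxE clamp_id.
- by move=> t j /= /andP[t0 t1]; rewrite mxE ger0_norm.
Qed.

Lemma compact_interval : compact [set t : R | 0 <= t <= 1].
Proof.
rewrite (_ : [set _ | _] = `[0, 1]%classic); first exact: segment_compact.
by apply/seteqP; split => t /=; rewrite in_itv.
Qed.

Lemma ANE_set_type (T : topologicalType) (S : set T) :
  ANE R S <-> ANE R [set: set_type S].
Proof.
have [[x0 Sx0]|S0] := pselect (S !=set0); last first.
  have E : S = set0 by apply/seteqP; split => x // Sx; case: S0; exists x.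
  split=> _; last by rewrite E; exact: ANE_set0.
  rewrite (_ : setT = set0); first exact: ANE_set0.
  by apply/seteqP; split => x // _; case: S0; exists (set_val x); exact: set_valP'.
pose r x : set_type S := if pselect (S x) is left Sx then mksub Sx else mksub Sx0.
have rK x : S x -> set_val (r x) = x.
  by move=> Sx; rewrite /r; case: pselect => // h; rewrite mksubK.
have cr : {within S, continuous r}.
  apply/within_set_type; apply: ct_sub.
  rewrite (_ : (fun x => _) = set_val); first by cts.
  by apply/funext => x; rewrite rK//; exact: set_valP'.
have cv : {within [set: set_type S], continuous set_val}.
  by apply: continuous_subspaceT; cts.
split => h.
- apply: (ANE_retract (i := set_val) (r := r) cv _ cr _ _ h) => //.
  + by move=> x _; exact: set_valP'.
  + by move=> x _; apply: set_val_inj; rewrite rK//; exact: set_valP'.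
- apply: (ANE_retract (i := r) (r := set_val) cr _ cv _ _ h) => //.
  by move=> x _; exact: set_valP'.
Qed.

Definition cANE (T : topologicalType) : Prop :=
  [/\ compact [set: T], embeddable T & ANE R [set: T]].

Lemma cANE_prod T U : cANE T -> cANE U -> cANE (T * U)%type.
Proof.
move=> [cT eT aT] [cU eU aU]; split.
- by rewrite -setXTT; exact: compact_setX.
- exact: embeddable_prod.
- by rewrite -setXTT; exact: ANE_setX.
Qed.

(** The inverse of the embedding extends to a neighbourhood of the image; followed by the embedding
    it is the retraction. *)
Lemma cANE_ENR (T : topologicalType) : cANE T -> ENR R T.
Proof.
move=> [cT [N [e [ce ie]]] aT]; pose Y := range e.
have [[x0 _]|T0] := pselect ([set: T] !=set0); last first.
  have noT (x : T) : False by case: T0; exists x.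
  have noY (y : set_type Y) : False by have [x _ _] := set_valP' y; exact: noT x.
  exists N, Y, set0; split.
  - exists (fun x => match noT x with end), (fun y => match noY y with end).
    by split => [x|y|x|y]; case: (noT x) || case: (noY y).
  - exact: open0.
  - by move=> y [x]; case: (noT x).
  - have no0 (u : set_type (@set0 'rV[R]_N)) : False := set_valP' u.
    by exists (fun u => match no0 u with end); split => u; case: (no0 u).
have [g [cg gS ge]] := compact_inverse x0 cT (continuous_subspaceT ce)
  (@norm_hausdorff _ _) (fun x y _ _ => ie x y).
have clY : closed Y by apply: compact_closed; [exact: norm_hausdorff|exact: compact_image].
have [U [h [oU YU ch _ hg]]] := aT _ _ _ clY cg (fun y _ => I).
have Ye x : Y (e x) by exists x.
exists N, Y, U; split => //.
- exists (fun x => mksub (Ye x)), (fun y => g (set_val y)); split.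
  + exact: ct_mksub.
  + exact/within_set_type.
  + by move=> x /=; rewrite mksubK ge.
  + move=> y /=; apply: set_val_inj; rewrite mksubK.
    by have [x _ <-] := set_valP' y; rewrite ge.
- exists (fun u => mksub (Ye (h (set_val u)))); split.
  + apply: ct_mksub; apply: (ct_comp ce).
    exact/within_set_type.
  + move=> u y uy; apply: set_val_inj; rewrite mksubK uy hg//; last exact: set_valP'.
    by have [x _ <-] := set_valP' y; rewrite ge.
Qed.

End CompactANE.
Arguments embeddable R T : clear implicits.
Arguments cANE R T : clear implicits.

(** [C] is a cube containing the image of [e]. Being contractible, it can be added as a factor
    without changing the homotopy type, and [c] is injective as soon as [e] is. *)
Lemma cube_envelope (R : realType) (X : topologicalType) N (e : X -> 'rV[R]_N) :
  compact [set: X] -> continuous e ->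
  exists (C : topologicalType) (c : X -> C) (v : C -> 'rV[R]_N) (o : C) (K : C * R -> C),
    [/\ cANE R C, continuous c, continuous v, forall x, v (c x) = e x
      & [/\ continuous K, forall y, K (y, 0) = o & forall y, K (y, 1) = y]].
Proof.
move=> cX ce.
have [M M1 eM] : exists2 M : R, 1 <= M & forall x j, `|e x ord0 j| <= M.
  have [M [_ hM]] := compact_bounded (compact_image ce cX).
  exists (Num.max 1 (M + 1)) => [|x j]; first by rewrite le_max lexx.
  apply: (@le_trans _ _ `|e x|); last first.
    by apply: hM => /=; [rewrite lt_max ltrDl ltr01 orbT|exists x].
  by rewrite [leRHS]mx_normrE; apply: (le_bigmax _ (fun ij => `|e x ij.1 ij.2|) (ord0, j)).
have M0 : 0 < M by exact: lt_le_trans M1.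
pose Q := [set v : 'rV[R]_N | forall j, - M <= v ord0 j <= M].
have Qe x : Q (e x) by move=> j; rewrite -ler_norml.
have Q0 : Q 0 by move=> j; rewrite mxE; apply/andP; split; lra.
have cQ : compact Q.
  pose I := [set t : R | - M <= t <= M].
  have cI : compact I.
    rewrite (_ : I = `[- M, M]%classic); first exact: segment_compact.
    by apply/seteqP; split => t /=; rewrite in_itv.
  exact: (@rV_compact R N (fun=> I) (fun=> cI)).
have KQ (y : set_type Q) t : Q (clamp t *: set_val y).
  move=> j; rewrite mxE -ler_norml normrM ger0_norm ?clamp_ge0//.
  have := set_valP' y j; rewrite -ler_norml => yM.
  apply: le_trans (ler_piMl _ _) yM => //; exact: clamp_le1.
exists (set_type Q), (fun x => mksub (Qe x)), set_val, (mksub Q0),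
  (fun z => mksub (KQ z.1 z.2)); split.
- split.
  + exact: compact_set_type.
  + exists N, set_val; split; first by cts.
    exact: set_val_inj.
  + apply: (proj1 (ANE_set_type Q)).
    pose r (v : 'rV[R]_N) := \row_j Num.max (- M) (Num.min M (v ord0 j)).
    apply: (@ANE_nbhd_retract R 'rV[R]_N Q N M setT (fun v => v) r) => //.
    * by apply: continuous_subspaceT; cts.
    * exact: openT.
    * by apply: continuous_subspaceT; rewrite /r; cts.
    * move=> y _ j; rewrite mxE le_max lexx /= ge_max ge_min lexx /= andbT.
      by lra.
    * move=> v Qv; apply/rowP => j; rewrite mxE; have /andP[v1 v2] := Qv j.
      by rewrite (min_idPr v2) (max_idPr v1).
    * by move=> v j Qv; rewrite ler_norml; exact: Qv.
- exact: ct_mksub.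
- by cts.
- by move=> x; rewrite mksubK.
- split.
  + by apply: ct_mksub; cts.
  + by move=> y; apply: set_val_inj; rewrite !mksubK /= clamp_le0// scale0r.
  + by move=> y; apply: set_val_inj; rewrite !mksubK /= clamp_ge1// scale1r.
Qed.

(** * Double mapping cylinders of compact ANEs *)

Section CompactDmc.
Context {R : realType} {X A F : topologicalType}.
Variables (i : A -> X) (w : A -> F).
Hypotheses (ci : continuous i) (cw : continuous w) (ii : injective i) (iw : injective w).
Local Notation D := (@dmc R X A F i w).

Lemma dA_in a t (t01 : 0 < t < 1) : dA i w (a, t) = DC (R := R) a (exist _ t t01).
Proof.
rewrite /dA /= leNgt; case/andP: (t01) => -> _ /=.
by rewrite insubT; congr (DC _ _); apply: val_inj.
Qed.

Let pos : D -> R := dmc_map (fun=> 0) snd (fun=> 1).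

Let posA a t : 0 <= t -> t <= 1 -> pos (dA i w (a, t)) = t.
Proof. by move=> t0 t1; rewrite /pos dmc_mapA//= clamp_id. Qed.

Lemma dA_inj a a' t t' : 0 <= t -> t <= 1 -> 0 <= t' -> t' <= 1 ->
  dA (R := R) i w (a, t) = dA i w (a', t') -> a = a' /\ t = t'.
Proof.
move=> t0 t1 t'0 t'1 E; have tt' : t = t' by rewrite -(posA a t0 t1) E posA.
split => //; move: E; rewrite -{}tt' {t' t'0 t'1}.
have [t00|t00] := leP t 0; first by rewrite !dA_le0// => -[] /ii.
have [t11|t11] := leP 1 t; first by rewrite !dA_ge1// => -[] /iw.
have t01 : 0 < t < 1 by rewrite t00 t11.
by rewrite !dA_in => -[].
Qed.

(** The coordinates are a position of [X], the height in the collar, and the height times a position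
    of [F]. The factor makes the last one vanish at the bottom; [c] makes the first one match at the
    top. *)
Lemma embeddable_dmc N k (eX : X -> 'rV[R]_N) (eF : F -> 'rV[R]_k) (c : F -> 'rV[R]_N) :
  continuous eX -> injective eX -> continuous eF -> injective eF -> continuous c ->
  (forall a, c (w a) = eX (i a)) -> embeddable R D.
Proof.
move=> ceX ieX ceF ieF cc cwi.
pose f : D -> 'rV[R]_N * R * 'rV[R]_k := dmc_map (fun x => (eX x, 0, 0))
  (fun z => (eX (i z.1), z.2, z.2 *: eF (w z.1))) (fun y => (c y, 1, eF y)).
have fA z : f (dA i w z) = (eX (i z.1), clamp z.2, clamp z.2 *: eF (w z.1)).
  rewrite /f dmc_mapA//= => a; first by rewrite scale0r.
  by rewrite cwi scale1r.
apply: (@embeddable_inj R _ _ f).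
- apply: ct_dmc => /=.
  + by cts.
  + rewrite (_ : (fun z => _) = fun z => (eX (i z.1), clamp z.2, clamp z.2 *: eF (w z.1))); last exact/funext.
    by cts.
  + by cts.
- move=> d d'; case: (dmcP d) => [x|a t t0 t1|y]; case: (dmcP d') => [x'|a' t' t'0 t'1|y'].
  + by move=> [] /ieX ->.
  + by rewrite fA /= clamp_id ?ltW// => -[_ E]; move: t'0; rewrite -E ltxx.
  + by move=> [_ /eqP]; rewrite eq_sym oner_eq0.
  + by rewrite fA /= clamp_id ?ltW// => -[_ E]; move: t0; rewrite E ltxx.
  + by rewrite !fA /= !clamp_id ?ltW// => -[] /ieX/ii -> ->.
  + by rewrite fA /= clamp_id ?ltW// => -[_ E]; move: t1; rewrite E ltxx.
  + by move=> [_ /eqP]; rewrite oner_eq0.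
  + by rewrite fA /= clamp_id ?ltW// => -[_ E]; move: t'1; rewrite -E ltxx.
  + by move=> [_ /ieF ->].
- apply: embeddable_prod; last exact: embeddable_rV.
  by apply: embeddable_prod; [exact: embeddable_rV|exact: embeddable_R].
Qed.

Definition dmc_hull (S : set X) : set D :=
  DX i w @` S `|` dA i w @` ([set: A] `*` [set t | 0 <= t <= 1]) `|` DF i w @` [set: F].

Hypotheses (hD : hausdorff_space D) (cA : compact [set: A]) (cF : compact [set: F]).

Lemma compact_dmc_hull S : compact S -> compact (dmc_hull S).
Proof.
move=> cS; apply: compact_setU2; first apply: compact_setU2.
- by apply: compact_image => //; exact: ct_DX.
- apply: compact_image; first exact: ct_dA.
  by apply: compact_setX => //; exact: compact_interval.
- by apply: compact_image => //; exact: ct_DF.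
Qed.

Lemma ANE_dmc_DX S : compact S -> ANE R S -> ANE R (DX i w @` S : set D).
Proof.
move=> cS aS; apply: ANE_image => //.
- by apply: continuous_subspaceT; exact: ct_DX.
- by move=> x y _ _ [].
Qed.

(** As [i] and [w] are injective, the closed collar is an embedded [A] times an interval, and it
    meets the two ends in copies of [A]; the union theorem applies twice. *)
Lemma ANE_dmc_hull S : (forall a, S (i a)) -> compact S -> ANE R S ->
  ANE R [set: A] -> ANE R [set: F] -> ANE R (dmc_hull S).
Proof.
move=> Si cS aS aA aF.
have clX : closed (DX i w @` S : set D).
  by apply: compact_closed => //; apply: compact_image => //; exact: ct_DX.
have clF : closed (DF i w @` setT : set D).
  by apply: compact_closed => //; apply: compact_image => //; exact: ct_DF.
pose P := [set: A] `*` [set t : R | 0 <= t <= 1].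
have cP : compact P by apply: compact_setX => //; exact: compact_interval.
have clP : closed (dA i w @` P : set D).
  by apply: compact_closed => //; apply: compact_image => //; exact: ct_dA.
apply: ANE_setU => //; first exact: closedU.
- apply: ANE_setU => //.
  + exact: ANE_dmc_DX.
  + apply: ANE_image => //.
    * by apply: continuous_subspaceT; exact: ct_dA.
    * move=> [a t] [a' t'] [_ /= /andP[t0 t1]] [_ /= /andP[t'0 t'1]] /dA_inj.
      by move=> /(_ t0 t1 t'0 t'1)[-> ->].
    * by apply: ANE_setX => //; exact: ANE_interval.
  + rewrite (_ : _ `&` _ = (fun a => DX i w (i a)) @` setT).
      apply: ANE_image => //.
      * by apply: continuous_subspaceT; cts.
      * by move=> a b _ _ [] /ii.
    apply/seteqP; split => d /=.
    * move=> [[x Sx <-] [[a t] [_ /= /andP[t0 t1]] E]].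
      have [t00|t00] := leP t 0; first by rewrite -E dA_le0//; exists a.
      have := posA a t0 t1; rewrite E /= => t00'.
      by move: t00; rewrite -t00' ltxx.
    * move=> [a _ <-]; split; first by exists (i a).
      by exists (a, 0); rewrite ?dA_le0//; split => //=; rewrite lexx ler01.
- apply: ANE_image => //.
  + by apply: continuous_subspaceT; exact: ct_DF.
  + by move=> x y _ _ [].
- rewrite (_ : _ `&` _ = (fun a => DF i w (w a)) @` setT).
    apply: ANE_image => //.
    * by apply: continuous_subspaceT; cts.
    * by move=> a b _ _ [] /iw.
  apply/seteqP; split => d /=.
  + move=> [[[x Sx <-] [y _]//|[[a t] [_ /= /andP[t0 t1]] <-]] [y _ E]].
    have := posA a t0 t1; rewrite -E /= => t11.
    exists a => //; rewrite E dA_ge1//; lra.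
  + move=> [a _ <-]; split; last by exists (w a).
    by right; exists (a, 1); rewrite ?dA_ge1//; split => //=; rewrite lexx ler01.
Qed.

End CompactDmc.

(** * All-or-nothing filtrations, unfiltered homotopy, and attaching a compact ANE *)

Section AllOrNothing.
Context {R : realType} {J : Type}.

(** For this filtration every continuous map and every homotopy is filtered, so unfiltered
    equivalences can be used when a simplex is attached. *)
Definition aon (b : J -> Prop) (X : topologicalType) : fsp J :=
  @Fsp J X (fun j => [set _ | b j]).

Lemma fmor_aon b (X Y : topologicalType) (f : X -> Y) :
  continuous f -> fmor (f : aon b X -> aon b Y).
Proof. by split. Qed.

Lemma fmor_aonl b (X : topologicalType) (Y : fsp J) (f : X -> Y) : continuous f ->
  (forall j x, b j -> fset j (f x)) -> fmor (f : aon b X -> Y).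
Proof. by move=> cf jf; split => // j x; exact: jf. Qed.

Lemma fhom_aon b (X Y : topologicalType) (f g : X -> Y) (H : X * R -> Y) :
  continuous H -> (forall x, H (x, 0) = f x) -> (forall x, H (x, 1) = g x) ->
  fhom R (f : aon b X -> aon b Y) g.
Proof. by move=> cH H0 H1; by apply: (@fhomI R J (aon b X) (aon b Y) f g H). Qed.

End AllOrNothing.

Definition plain (X : topologicalType) : fsp unit := aon (fun=> True) X.

Lemma fequiv_aon (R : realType) (J : Type) (b : J -> Prop) (X Y : topologicalType) :
  fequiv R (plain X) (plain Y) -> fequiv R (aon b X) (aon b Y).
Proof.
move=> [f [[cf _] [g [[cg _] [H [cH H0 H1 _]] [K [cK K0 K1 _]]]]]].
exists f; split; first exact: fmor_aon.
exists g; split; first exact: fmor_aon.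
- by apply: (fhom_aon _ cH) => x; [rewrite H0|rewrite H1].
- by apply: (fhom_aon _ cK) => x; [rewrite K0|rewrite K1].
Qed.

Lemma plain_full (R : realType) (X : fsp unit) :
  (forall j x, @fset _ X j x) -> fequiv R X (plain X).
Proof.
move=> full; exists id; split; first by split => // x; exact: cvg_id.
exists id; split; first by split => [x|j x _]; [exact: cvg_id|exact: full].
- by apply: fhom_refl; exact: fmor_id.
- by apply: fhom_refl; exact: fmor_id.
Qed.

Section UnitInterval.
Context {R : realType}.

Lemma clampP (t : R) : [set t : R | 0 <= t <= 1] (clamp t).
Proof. by rewrite /= clamp_ge0 clamp_le1. Qed.

Definition to_I (t : R) : unitI R := mksub (clampP t).

Lemma ct_to_I : continuous to_I.
Proof. exact (ct_mksub clampP (ct_clamp ct_id)). Qed.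

Lemma to_IK (s : unitI R) : to_I (set_val s) = s.
Proof.
apply: set_val_inj; rewrite mksubK; have /= /andP[s0 s1] := set_valP' s.
by rewrite clamp_id.
Qed.

Lemma to_I_val t : set_val (to_I t) = clamp t.
Proof. exact: mksubK. Qed.

Lemma to_I0 t : t <= 0 -> to_I t = I0 R.
Proof. by move=> t0; apply: set_val_inj; rewrite mksubK clamp_le0// set_valE. Qed.

Lemma to_I1 t : 1 <= t -> to_I t = I1 R.
Proof. by move=> t0; apply: set_val_inj; rewrite mksubK clamp_ge1// set_valE. Qed.

Lemma val_I0 : set_val (I0 R) = 0.
Proof. by rewrite set_valE. Qed.

Lemma val_I1 : set_val (I1 R) = 1.
Proof. by rewrite set_valE. Qed.

Lemma homotopic_fhom (X Y : topologicalType) (f g : X -> Y) :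
  homotopic R f g <-> fhom R (f : plain X -> plain Y) g.
Proof.
split.
- move=> [H [cH H0 H1]].
  apply: (@fhom_aon _ _ _ _ _ _ _ (fun z => H (z.1, to_I z.2))).
  + by have := ct_to_I => cI; cts.
  + by move=> x /=; rewrite to_I0.
  + by move=> x /=; rewrite to_I1.
- move=> [H [cH H0 H1 _]]; exists (fun z => H (z.1, set_val z.2)); split.
  + have c : continuous (fun z : X * unitI R => (z.1, set_val z.2)).
      by apply: ct_pair; [cts|apply: ct_comp; [exact: ct_val|cts]].
    exact: (ct_comp cH c).
  + by move=> x; rewrite /= val_I0 H0.
  + by move=> x; rewrite /= val_I1 H1.
Qed.

Lemma homotopy_equivalence_fhe (X Y : topologicalType) (f : X -> Y) :
  homotopy_equivalence R f <-> fhe R (f : plain X -> plain Y).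
Proof.
split.
- move=> [cf [g [cg /homotopic_fhom gf /homotopic_fhom fg]]].
  by split; [exact: fmor_aon|exists g; split => //; exact: fmor_aon].
- move=> [[cf _] [g [[cg _] gf fg]]]; split => //; exists g; split => //.
  + exact/homotopic_fhom.
  + exact/homotopic_fhom.
Qed.

Lemma homotopy_equivalent_fequiv (X Y : topologicalType) :
  homotopy_equivalent R X Y -> fequiv R (plain X) (plain Y).
Proof. by move=> [f /homotopy_equivalence_fhe]; exists f. Qed.

End UnitInterval.

(** [w] need not be injective. Pairing it with the embedding of [X] in a cube [C] makes it so, while
    [F * C] is equivalent to [F]. A step of the new cylinder is the corresponding step of [X],
    together with the whole collar and [F * C] in case [b j] holds. *)
Lemma attach_cANE (R : realType) (J : Type) (b : J -> Prop) (X : fsp J)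
    (A F : topologicalType) (i : A -> X) (w : A -> F) :
  continuous i -> injective i -> continuous w -> cANE R X -> cANE R A -> cANE R F ->
  (forall j, compact (@fset _ X j)) -> (forall j, ANE R (@fset _ X j)) ->
  (forall j a, b j -> fset j (i a)) ->
  exists (F' : topologicalType) (w' : A -> F'), [/\ continuous w',
    cANE R (@dmc R X A F' i w'),
    forall j, compact (fset j : set (@dmf R J X (aon b A) (aon b F') i w')),
    forall j, ANE R (fset j : set (@dmf R J X (aon b A) (aon b F') i w'))
  & fequiv R (@dmf R J X (aon b A) (aon b F) i w) (@dmf R J X (aon b A) (aon b F') i w')].
Proof.
move=> ci ii cw [cX [N [eX [ceX ieX]]] aX] [cA eA aA] hF cXj aXj bi.
have [C [c [v [y0 [K [hC cc cv vc [cK K0 K1]]]]]]] := cube_envelope cX ceX.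
pose w' a := (w a, c (i a)).
have cw' : continuous w' by rewrite /w'; cts.
have iw' : injective w'.
  by move=> a a' [_ E]; apply/ii/ieX; rewrite -!vc E.
have hFC := cANE_prod hF hC; have [cFC [k [eF [ceF ieF]]] aFC] := hFC.
(* The cube coordinate extends the embedding of [X] over the new target: [v (w' a).2] is
   [eX (i a)]. *)
have eD : embeddable R (@dmc R X A (F * C)%type i w').
  apply: (embeddable_dmc (R := R) ci cw' ii (eX := eX) (eF := eF) (c := fun z => v z.2)) => //.
    by cts.
  by move=> a; rewrite /w' /= vc.
have hD := embeddable_hausdorff eD.
have hull (S : set X) : (forall a, S (i a)) -> compact S -> ANE R S ->
    compact (dmc_hull (R := R) (i := i) (w := w') S) /\ ANE R (dmc_hull (R := R) (i := i) (w := w') S).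
  by move=> Si cS aS; split; [exact: compact_dmc_hull|apply: (ANE_dmc_hull ci cw' ii iw' hD cA cFC Si cS aS aA aFC)].
have bT j : b j -> dmc_hull (R := R) (i := i) (w := w') (fset j) =
    (fset j : set (@dmf R J X (aon b A) (aon b (F * C)%type) i w')).
  move=> bj; apply/seteqP; split => d.
  - move=> [[[x jx <-]//|[[a t] _ <-]]|[y _ <-]]; last by [].
    apply: (@fset_dA R J X (aon b A) (aon b (F * C)%type) i w') => //.
  - case: (dmcP d) => [x jx|a t t0 t1 _|y _].
    + by left; left; exists x.
    + by left; right; exists (a, t); split => //=; rewrite !ltW.
    + by right; exists y.
have bF j : ~ b j -> DX i w' @` (fset j) =
    (fset j : set (@dmf R J X (aon b A) (aon b (F * C)%type) i w')).
  move=> bj; apply/seteqP; split => [_ [x jx <-]//|].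
  case=> [x jx|a t /bj//|y /bj//].
  by exists x.
exists (F * C)%type, w'; split => //.
- have [h1 h2] := hull setT (fun=> I) cX aX.
  have E : dmc_hull (R := R) (i := i) (w := w') setT = setT.
    apply/seteqP; split => // d _; case: (dmcP d) => [x|a t t0 t1|y].
    + by left; left; exists x.
    + by left; right; exists (a, t); split => //=; rewrite !ltW.
    + by right; exists y.
  by rewrite E in h1 h2.
- move=> j; have [bj|bj] := pselect (b j).
    by rewrite -bT//; apply: (hull _ _ _ _).1 => // a; exact: bi.
  by rewrite -bF//; apply: compact_image => //; exact: ct_DX.
- move=> j; have [bj|bj] := pselect (b j).
    by rewrite -bT//; apply: (hull _ _ _ _).2 => // a; exact: bi.
  by rewrite -bF//; exact: ANE_dmc_DX.
- apply: fequiv_sym; exists (dmc_target (fst : aon b (F * C)%type -> aon b F)).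
  apply: fhe_dmc_target.
  + exact: (@fmor_aonl J b A X i ci bi).
  + exact: fmor_aon.
  + split; first by apply: fmor_aon; cts.
    exists (fun y => (y, y0)); split; first by apply: fmor_aon; cts.
    * by apply: (fhom_aon _ (H := fun z => (z.1.1, K (z.1.2, z.2)))) => [|[y z]|[y z]] /=;
        rewrite ?K0 ?K1//; cts.
    * by apply: fhom_refl; exact: fmor_id.
Qed.

(** * Disks, spheres and finite CW complexes *)

Lemma compact_closed_map (X Y : topologicalType) (f : X -> Y) :
  compact [set: X] -> hausdorff_space Y -> continuous f ->
  forall C, closed C -> closed (f @` C).
Proof.
move=> cX hY cf C clC; apply: compact_closed => //; apply: compact_image => //.
by rewrite -(setTI C); exact: compact_closedI.
Qed.

Lemma closed_compact_set_type (T : topologicalType) (S : set T) :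
  compact [set: T] -> closed S -> compact [set: set_type S].
Proof.
by move=> cT clS; apply: compact_set_type; rewrite -(setTI S); exact: compact_closedI.
Qed.

Section Disk.
Context {R : realType} (n : nat).
Implicit Types v : 'rV[R]_n.

Definition enorm v : R := Num.sqrt (sqnorm v).

Lemma sqnorm_ge0 v : 0 <= sqnorm v.
Proof. by apply: sumr_ge0 => j _; exact: sqr_ge0. Qed.

Lemma ct_sqnorm (T : topologicalType) (f : T -> 'rV[R]_n) :
  continuous f -> continuous (fun x => sqnorm (f x)).
Proof.
move=> cf; apply: ct_sum => j; apply: (ct_mul (f := fun x => f x ord0 j)); exact: ct_coord.
Qed.

Lemma ct_enorm (T : topologicalType) (f : T -> 'rV[R]_n) :
  continuous f -> continuous (fun x => enorm (f x)).
Proof. by move=> cf; apply: (ct_comp (@sqrt_continuous R)); exact: ct_sqnorm. Qed.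

Lemma enorm_ge0 v : 0 <= enorm v.
Proof. exact: sqrtr_ge0. Qed.

Lemma sqr_enorm v : enorm v ^+ 2 = sqnorm v.
Proof. by rewrite sqr_sqrtr// sqnorm_ge0. Qed.

Lemma sqnormZ c v : sqnorm (c *: v) = c ^+ 2 * sqnorm v.
Proof. by rewrite /sqnorm mulr_sumr; apply: eq_bigr => j _; rewrite mxE exprMn. Qed.

Lemma sqnorm_le1 v : (sqnorm v <= 1) = (enorm v <= 1).
Proof. by rewrite -sqr_enorm expr_le1// enorm_ge0. Qed.

Lemma enormZ c v : 0 <= c -> enorm (c *: v) = c * enorm v.
Proof. by move=> c0; rewrite /enorm sqnormZ sqrtrM ?sqr_ge0// sqrtr_sqr ger0_norm. Qed.

Lemma enorm_coord v j : `|v ord0 j| <= enorm v.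
Proof.
rewrite -(sqrtr_sqr (v ord0 j)) ler_wsqrtr// /sqnorm (bigD1 j)//=.
by rewrite lerDl; apply: sumr_ge0 => k _; exact: sqr_ge0.
Qed.

Definition radial v : 'rV[R]_n := (enorm v)^-1 *: v.

Lemma enorm_radial v : 0 < enorm v -> enorm (radial v) = 1.
Proof. by move=> v0; rewrite enormZ ?invr_ge0 ?enorm_ge0// mulVf// gt_eqF. Qed.

Lemma radial_le1 v : sqnorm (radial v) <= 1.
Proof.
rewrite sqnorm_le1; have [v0|v0] := ltP 0 (enorm v); first by rewrite enorm_radial.
have -> : enorm (radial v) = (enorm v)^-1 * enorm v.
  by rewrite enormZ// invr_ge0 enorm_ge0.
by rewrite (_ : enorm v = 0) ?mulr0//; apply/eqP; rewrite eq_le v0 enorm_ge0.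
Qed.

Definition disk_radial v : disk R n :=
  @mksub _ [set v | sqnorm v <= 1] (radial v) (radial_le1 v).

Lemma disk_radial_val v : set_val (disk_radial v) = radial v.
Proof. exact: mksubK. Qed.

Lemma within_radial : {within [set v | 0 < enorm v], continuous radial}.
Proof.
apply/within_set_type.
have c1 : continuous (fun x : set_type [set v | 0 < enorm v] => enorm (set_val x)).
  by apply: ct_enorm; cts.
apply: ct_scale; last by cts.
by apply: ct_inv => // x; rewrite gt_eqF//; exact: (set_valP' x).
Qed.

Lemma disk_cANE : cANE R (disk R n).
Proof.
split.
- apply: compact_set_type.
  pose I := [set t : R | -1 <= t <= 1].
  have cI : compact I.
    rewrite (_ : I = `[-1, 1]%classic); first exact: segment_compact.
    by apply/seteqP; split => t /=; rewrite in_itv.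
  rewrite (_ : [set _ | _] = [set v : 'rV[R]_n | forall j, I (v ord0 j)] `&`
    [set v | sqnorm v <= 1]).
    apply: compact_closedI; first exact: (@rV_compact R n (fun=> I) (fun=> cI)).
    apply: closed_leF; last by cts.
    by apply: (ct_sqnorm (f := fun x => x)); cts.
  apply/seteqP; split => v /=; last by case.
  move=> v1; split => // j; rewrite /I /= -ler_norml.
  by apply: le_trans (enorm_coord v j) _; rewrite -sqnorm_le1.
- by apply: (embeddable_inj (f := set_val)); [cts|exact: set_val_inj|exact: embeddable_rV].
- apply: (proj1 (ANE_set_type _)).
  apply: (@ANE_nbhd_retract R 'rV[R]_n [set v | sqnorm v <= 1] n 1 setT (fun v => v)
    (fun v => (Num.max 1 (enorm v))^-1 *: v)).
  + exact: ltr01.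
  + by apply: continuous_subspaceT; cts.
  + by [].
  + exact: openT.
  + apply: continuous_subspaceT; apply: ct_scale; last by cts.
    have c1 : continuous enorm by apply: (ct_enorm (f := fun v => v)); cts.
    apply: ct_inv; first by cts.
    by move=> v; rewrite gt_eqF// lt_max ltr01.
  + move=> v _ /=; rewrite sqnorm_le1 enormZ; last by rewrite invr_ge0 le_max ler01.
    by rewrite mulrC ler_pdivrMr ?mul1r ?le_max ?lexx ?orbT// lt_max ltr01.
  + by move=> v /=; rewrite sqnorm_le1 => v1; rewrite (max_idPl v1) invr1 scale1r.
  + move=> v j /= v1.
    by apply: le_trans (enorm_coord v j) _; rewrite -sqnorm_le1.
Qed.

Lemma closed_disk_boundary : closed (@disk_boundary R n).
Proof.
have c : continuous (fun x : disk R n => sqnorm (set_val x)).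
  by apply: ct_sqnorm; exact: ct_val.
rewrite (_ : @disk_boundary R n = (fun x : disk R n => sqnorm (set_val x)) @^-1` [set t | t = 1])//.
by move/continuous_closedP : c; apply; exact: closed_eq.
Qed.

Lemma sphere_cANE : cANE R (set_type (@disk_boundary R n)).
Proof.
have [cD [N [e [ce ie]]] aD] := disk_cANE; split.
- exact: closed_compact_set_type closed_disk_boundary.
- apply: (embeddable_inj (f := set_val)); [exact: ct_val|exact: set_val_inj|].
  by exists N, e.
- apply: (proj1 (ANE_set_type _)).
  apply: (@ANE_nbhd_retract R (disk R n) (@disk_boundary R n) n 1 [set v | 0 < enorm v]
    (fun x : disk R n => set_val x) disk_radial).
  + exact: ltr01.
  + by apply: continuous_subspaceT; exact: ct_val.
  + by move=> x /= x1; rewrite /enorm x1 sqrtr1.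
  + have c1 : continuous enorm by apply: (ct_enorm (f := fun v => v)); cts.
    rewrite (_ : [set _ | _] = enorm @^-1` [set t | 0 < t])//.
    by move/continuousP : c1; apply; exact: open_gt.
  + apply/within_set_type; apply: ct_sub.
    rewrite (_ : (fun x => _) = fun x => radial (set_val x)).
      exact/within_set_type/within_radial.
    by apply/funext => x; rewrite disk_radial_val.
  + by move=> v /= v0; rewrite /disk_boundary /= disk_radial_val -sqr_enorm enorm_radial// expr1n.
  + move=> x /= x1; apply: set_val_inj; rewrite disk_radial_val /radial.
    by rewrite /enorm x1 sqrtr1 invr1 scale1r.
  + move=> x j /= x1; apply: le_trans (enorm_coord _ j) _.
    by rewrite /enorm x1 sqrtr1.
Qed.

Let N (x : disk R n) := enorm (set_val x).

Let cN : continuous N.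
Proof. by apply: ct_enorm; exact: ct_val. Qed.

(** At time 1 the factor is the inverse of the maximum of 1/2 and the Euclidean norm: the shell of
    radius at least 1/2, where [disk_depth] is at most 1, goes to the sphere, and the ball inside is
    doubled. *)
Let collar_coef (x : disk R n) (t : R) : R :=
  1 - clamp t + clamp t * (Num.max (N x) 2^-1)^-1.

Let max_gt0 (x : disk R n) : 0 < Num.max (N x) 2^-1.
Proof. by rewrite lt_max invr_gt0 ltr0n orbT. Qed.

Lemma disk_collar_subproof (x : disk R n) (t : R) :
  [set v | sqnorm v <= 1] (collar_coef x t *: set_val x).
Proof.
have t0 := clamp_ge0 t; have t1 := clamp_le1 t.
have c0 : 0 <= collar_coef x t.
  by rewrite /collar_coef addr_ge0 ?subr_ge0// mulr_ge0// invr_ge0 ltW.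
rewrite /= sqnorm_le1 enormZ// -/(N x) /collar_coef mulrDl.
have x1 : N x <= 1 by rewrite /N -sqnorm_le1; exact: (set_valP' x).
have x0 : 0 <= N x by exact: enorm_ge0.
have q : (Num.max (N x) 2^-1)^-1 * N x <= 1.
  by rewrite mulrC ler_pdivrMr// mul1r le_max lexx.
by rewrite -mulrA; nra.
Qed.

Definition disk_collar (z : disk R n * R) : disk R n :=
  mksub (disk_collar_subproof z.1 z.2).

Lemma ct_disk_collar : continuous disk_collar.
Proof.
apply: (ct_mksub (fun z => disk_collar_subproof z.1 z.2)).
apply: ct_scale; last by apply: (ct_comp (@ct_val _ _)); cts.
apply: ct_add; first by cts.
apply: ct_mul; first by cts.
apply: ct_inv; first by cts.
by move=> z; rewrite gt_eqF.
Qed.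

Lemma disk_collar0 x : disk_collar (x, 0) = x.
Proof.
apply: set_val_inj; rewrite mksubK /collar_coef /= clamp_le0//.
by rewrite subr0 mul0r addr0 scale1r.
Qed.

Lemma disk_collar_fix (a : set_type (@disk_boundary R n)) t :
  disk_collar (set_val a, t) = set_val a.
Proof.
apply: set_val_inj; rewrite mksubK /collar_coef /=.
have -> : N (set_val a) = 1.
  by rewrite /N /enorm (set_valP' a : sqnorm _ = 1) sqrtr1.
by rewrite (max_idPl _) ?invf_le1// ?ler1n// invr1 mulr1 subrK scale1r.
Qed.

Definition disk_depth (x : disk R n) : R := 2 * (1 - N x).

Lemma disk_retraction (a0 : set_type (@disk_boundary R n)) :
  exists rho : disk R n -> set_type (@disk_boundary R n),
    [/\ {within [set x | disk_depth x <= 1], continuous rho},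
        forall a, rho (set_val a) = a
      & forall x, disk_depth x <= 1 -> disk_collar (x, 1) = set_val (rho x)].
Proof.
have bd (x : disk R n) : disk_depth x <= 1 ->
    @disk_boundary R n (disk_radial (set_val x)).
  rewrite /disk_depth => x1; rewrite /disk_boundary /= disk_radial_val -sqr_enorm.
  by rewrite enorm_radial ?expr1n// -/(N x); lra.
pose rho (x : disk R n) : set_type (@disk_boundary R n) := if pselect (@disk_boundary R n (disk_radial (set_val x)))
  is left h then mksub h else a0.
have rhoE x : disk_depth x <= 1 -> set_val (rho x) = disk_radial (set_val x).
  by move=> /bd x1; rewrite /rho; case: pselect => // h; rewrite mksubK.
exists rho; split.
- apply/within_set_type; apply: ct_sub; apply: ct_sub.
  rewrite (_ : (fun x => _) =
    fun x : set_type [set x | disk_depth x <= 1] => radial (set_val (set_val x))).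
    apply: (ct_within _ _ within_radial).
      by apply: (ct_comp (@ct_val _ _)); exact: ct_val.
    move=> x /=; have := set_valP' x; rewrite /= /disk_depth /N => x1; lra.
  by apply/funext => x; rewrite rhoE ?disk_radial_val//; exact: (set_valP' x).
- move=> a; have a1 : enorm (set_val (set_val a)) = 1.
    by rewrite /enorm (set_valP' a : sqnorm _ = 1) sqrtr1.
  apply: set_val_inj; rewrite rhoE; last by rewrite /disk_depth /N a1 subrr mulr0 ler01.
  by apply: set_val_inj; rewrite disk_radial_val /radial a1 invr1 scale1r.
- move=> x x1; rewrite rhoE//; apply: set_val_inj; rewrite disk_radial_val mksubK /collar_coef /=.
  rewrite clamp_ge1// subrr add0r mul1r (max_idPl _)//.
  by move: x1; rewrite /disk_depth; lra.
Qed.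

Lemma disk_depth0 (a : set_type (@disk_boundary R n)) : disk_depth (set_val a) = 0.
Proof.
by rewrite /disk_depth /N /enorm (set_valP' a : sqnorm _ = 1) sqrtr1 subrr mulr0.
Qed.

Lemma ct_disk_depth : continuous disk_depth.
Proof. by rewrite /disk_depth; cts. Qed.

End Disk.

Lemma empty_cANE (R : realType) (T : topologicalType) : ~ inhabited T -> cANE R T.
Proof.
move=> T0; have noT (x : T) : False by case: T0.
have E : [set: T] = set0 by apply/seteqP; split => x // _; case: (noT x).
split; rewrite ?E.
- exact: compact0.
- by exists 0%N, (fun=> 0); split => [|x]; [cts|case: (noT x)].
- exact: ANE_set0.
Qed.

Section FiniteCWComplex.
Context {R : realType} (Y : topologicalType).
Variables (hY : hausdorff_space Y) (m : nat) (dim : 'I_m -> nat)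
  (Phi : forall k, disk R (dim k) -> Y).
Let cell k := @Phi k @` @disk_interior R (dim k).
Hypotheses (cPhi : forall k, continuous (@Phi k))
  (iPhi : forall k, injective
     (fun x : set_type (@disk_interior R (dim k)) => @Phi k (set_val x)))
  (disj : forall k l, k != l -> cell k `&` cell l = set0)
  (bdry : forall k, @Phi k @` @disk_boundary R (dim k) `<=`
     \bigcup_(l in [set l | (dim l < dim k)%N]) cell l).

(** This contains all cells met by boundaries of cells of [S], and it survives the removal of a cell
    of largest dimension. *)
Let lower (S : {set 'I_m}) := forall k l, k \in S -> (dim l < dim k)%N -> l \in S.

Let skel (S : {set 'I_m}) : set Y := [set y | exists2 k, k \in S & cell k y].

Let disk_cases k (x : disk R (dim k)) :
  @disk_interior R (dim k) x \/ @disk_boundary R (dim k) x.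
Proof.
have /= := set_valP' x; rewrite le_eqVlt => /orP[/eqP x1|x1]; [by right|by left].
Qed.

Let skel_bd S k (x : disk R (dim k)) : lower S -> k \in S ->
  @disk_boundary R (dim k) x -> exists2 l, l \in S & cell l (@Phi k x) /\ (dim l < dim k)%N.
Proof.
move=> lS kS bx; have [l /= lk cl] := @bdry k (@Phi k x) (ex_intro2 _ _ x bx erefl).
by exists l => //; exact: lS kS lk.
Qed.

Let skel_disk S k (x : disk R (dim k)) : lower S -> k \in S -> skel S (@Phi k x).
Proof.
move=> lS kS; have [ix|bx] := disk_cases x; first by exists k => //; exists x.
by have [l lS' [cl _]] := skel_bd lS kS bx; exists l.
Qed.

Let compact_skel S : lower S -> compact [set: set_type (skel S)].
Proof.
move=> lS; apply: compact_set_type.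
rewrite (_ : skel S = [set y | exists2 k, k \in enum S & (@Phi k @` setT) y]).
  apply: compact_bigcup_seq => k; apply: compact_image; first exact: cPhi.
  by have [] := @disk_cANE R (dim k).
apply/seteqP; split => y /=.
- by move=> [k kS [x _ <-]]; exists k; rewrite ?mem_enum//; exists x.
- by move=> [k]; rewrite mem_enum => kS [x _ <-]; exact: skel_disk.
Qed.

(** Induction on the number of cells, splitting off one of largest dimension. Compactness makes the
    maps closed, so the skeleton is a pushout along the boundary sphere; the collar of the disk
    turns it into a double mapping cylinder, in which the smaller skeleton can be replaced by its
    model. *)
Lemma skeleton_cANE S : lower S ->
  exists2 Z, cANE R Z & fequiv R (plain (set_type (skel S))) (plain Z).
Proof.
move: {2}#|S| (erefl #|S|) => r; elim: r S => [|r ih] S Sr lS.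
  exists (set_type (skel S)); last exact: fequiv_refl.
  apply: empty_cANE => -[y]; have [k + _] := set_valP' y.
  by rewrite (cards0_eq Sr) finset.in_set0.
have [k0 k0S] : exists k, k \in S by apply/set0Pn; rewrite -card_gt0 Sr.
pose k := [arg max_(k > k0 in S) dim k]%N.
have [kS kmax] : k \in S /\ forall l, l \in S -> (dim l <= dim k)%N.
  by rewrite /k; case: arg_maxnP => // l lS' hl; split.
pose S' := S :\ k.
have S'r : #|S'| = r.
  by apply/eqP; rewrite -eqSS -Sr (cardsD1 k S) kS.
have lS' : lower S'.
  move=> l l'; rewrite !in_setD1 => /andP[lk lS0] l'l.
  rewrite (lS _ _ lS0 l'l) andbT; apply: contraTneq l'l => ->.
  by rewrite -leqNgt; exact: kmax.
have SS' y : skel S' y -> skel S y.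
  by move=> [l + cl]; rewrite in_setD1 => /andP[_ lS0]; exists l.
have [Z hZ ZY] := ih _ S'r lS'.
have bdS' (a : set_type (@disk_boundary R (dim k))) : skel S' (@Phi k (set_val a)).
  have [l lS0 [cl lk]] := skel_bd lS kS (set_valP' a); exists l => //.
  by rewrite in_setD1 lS0 andbT; apply: contraTneq lk => ->; rewrite ltnn.
pose i (a : set_type (@disk_boundary R (dim k))) : disk R (dim k) := set_val a.
have ci : continuous i by exact: ct_val.
pose w a : set_type (skel S') := mksub (bdS' a).
have cw : continuous w.
  by apply: (ct_mksub bdS'); apply: (ct_comp (@cPhi k)); exact: ci.
pose iX x : set_type (skel S) := mksub (skel_disk x lS kS).
have ciX : continuous iX by apply: (ct_mksub (fun x => skel_disk x lS kS)); exact: cPhi.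
pose iF y : set_type (skel S) := mksub (SS' _ (set_valP' y)).
have ciF : continuous iF.
  by apply: (ct_mksub (fun y => SS' _ (set_valP' y))); exact: ct_val.
have hS : hausdorff_space (set_type (skel S)).
  by apply: (hausdorff_inj (f := set_val)); [exact: ct_val|exact: set_val_inj|].
have int_cell (x : disk R (dim k)) : @disk_interior R (dim k) x -> ~ skel S' (@Phi k x).
  move=> ix [l + cl]; rewrite in_setD1 => /andP[lk _].
  have : (cell l `&` cell k) (@Phi k x) by split => //; exists x.
  by rewrite disj.
have po : is_pushout i w iX iF.
  apply: closed_pushout => //.
  - by apply: compact_closed_map => //; have [] := @disk_cANE R (dim k).
  - by apply: compact_closed_map => //; exact: compact_skel.
  - by move=> a; apply: set_val_inj; rewrite !mksubK.
  - move=> y; have [l lS0 cl] := set_valP' y; have [lk|lk] := eqVneq l k.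
      left; move: cl; rewrite lk => -[x _ xy]; exists x.
      by apply: set_val_inj; rewrite mksubK.
    have S'y : skel S' (set_val y) by exists l => //; rewrite in_setD1 lk.
    by right; exists (mksub S'y); apply: set_val_inj; rewrite !mksubK.
  - by move=> y y' /(congr1 set_val); rewrite !mksubK => /set_val_inj.
  - move=> x y /(congr1 set_val); rewrite !mksubK => xy.
    have [ix|bx] := disk_cases x.
      by case: (int_cell _ ix); rewrite xy; exact: set_valP'.
    exists (mksub bx); first by rewrite /i mksubK.
    by apply: set_val_inj; rewrite !mksubK.
  - move=> x x' /(congr1 set_val); rewrite !mksubK => xx'.
    have [ix|bx] := disk_cases x; have [ix'|bx'] := disk_cases x'.
    + left; have : mksub ix = mksub ix' by apply: iPhi; rewrite !mksubK.
      by move/(congr1 set_val); rewrite !mksubK.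
    + case: (int_cell _ ix); rewrite xx'.
      by have := bdS' (mksub bx'); rewrite mksubK.
    + case: (int_cell _ ix'); rewrite -xx'.
      by have := bdS' (mksub bx); rewrite mksubK.
    + right; exists (mksub bx), (mksub bx'); rewrite /i !mksubK; split => //.
      by apply: set_val_inj; rewrite !mksubK.
have plain_fmor (T U : topologicalType) (f : T -> U) :
    continuous f -> fmor (f : plain T -> plain U) by exact: fmor_aon.
have Fi := plain_fmor _ _ _ ci; have Fw := plain_fmor _ _ _ cw.
have DQ : fequiv R (@dmf R unit (plain (disk R (dim k))) (plain _) (plain _) i w)
    (plain (set_type (skel S))).
  (* The boundary of a 0-cell is empty, and nothing retracts onto it. *)
  have [[a0]|noA] := pselect (inhabited (set_type (@disk_boundary R (dim k)))).
  - have [rho [crho rhoi rho1]] := disk_retraction a0.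
    apply: (@fequiv_collar_pushout R unit (plain (disk R (dim k)))
      (plain (set_type (@disk_boundary R (dim k)))) (plain (set_type (skel S')))
      (plain (set_type (skel S))) i w iX iF (@disk_depth R (dim k))
      (@disk_collar R (dim k)) rho) => //.
    + by move=> j x _; left.
    + exact: ct_disk_depth.
    + exact: ct_disk_collar.
    + exact: disk_depth0.
    + exact: disk_collar0.
    + by move=> a t; exact: disk_collar_fix.
  - apply: (@fequiv_empty_pushout R unit (plain (disk R (dim k)))
      (plain (set_type (@disk_boundary R (dim k)))) (plain (set_type (skel S')))
      (plain (set_type (skel S))) i w iX iF noA) => //.
    by move=> j x _; left.
have [f hf] := ZY; have [[cf _] _] := hf.
have DZ := fhe_dmc_target Fi Fw hf.
have cfw : continuous (fun a => f (w a)) by cts.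
have [|||F' [w' [cw' hD' _ _ DD']]] :=
    attach_cANE (b := fun _ : unit => True) (X := plain (disk R (dim k))) ci
      (@set_val_inj _ _) cfw (@disk_cANE R _) (@sphere_cANE R _) hZ.
- by move=> j; have [] := @disk_cANE R (dim k).
- by move=> j; have [] := @disk_cANE R (dim k).
- by [].
exists (@dmc R (disk R (dim k)) _ F' i w') => //.
apply: fequiv_trans (fequiv_sym DQ) _.
apply: (fequiv_trans (ex_intro _ _ DZ)).
apply: (fequiv_trans DD').
apply: plain_full => j d.
by case: d.
Qed.

End FiniteCWComplex.

Lemma finite_CW_cANE (R : realType) (Y : topologicalType) :
  finite_CW R Y -> exists2 Z, cANE R Z & fequiv R (plain Y) (plain Z).
Proof.
move=> [hY [m [dim [Phi [[cPhi ePhi] disj cov bdry _]]]]].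
have iPhi k : injective (fun x : set_type (@disk_interior R (dim k)) => Phi k (set_val x)).
  by case: (ePhi k).
have lowT : forall k l : 'I_m, k \in [set: 'I_m]%SET -> (dim l < dim k)%N ->
    l \in [set: 'I_m]%SET by move=> *; rewrite finset.in_setT.
have [Z hZ YZ] := skeleton_cANE (Phi := Phi) hY cPhi iPhi disj bdry lowT.
exists Z => //; apply: fequiv_trans YZ.
set W := (X in set_type X).
have Wy y : W y.
  have : [set: Y] y by [].
  by rewrite -cov => -[k _ cy]; exists k; rewrite ?finset.in_setT.
have c1 : continuous (fun y => mksub (Wy y)).
  by apply: (ct_mksub Wy); exact: ct_id.
exists (fun y => mksub (Wy y)); split; first exact: fmor_aon.
exists set_val; split; first by apply: fmor_aon; exact: ct_val.
- apply: fhom_eq => [|y]; last by rewrite mksubK.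
  by apply: fmor_aon; under eq_fun do rewrite mksubK; exact: ct_id.
- apply: fhom_eq => [|y]; last by apply: set_val_inj; rewrite mksubK.
  by apply: fmor_aon; apply: (ct_comp c1); exact: ct_val.
Qed.

(** * The path space of a map to a complex *)

Lemma unitI_hausdorff (R : realType) : hausdorff_space (unitI R).
Proof. apply: (hausdorff_inj (f := set_val)); [exact: ct_val|exact: set_val_inj|exact: Rhausdorff]. Qed.

Lemma unitI_locally_compact (R : realType) : locally_compact [set: unitI R].
Proof.
move=> x _; exists setT; first exact: filterT.
split; last exact: closedT.
exact: (compact_set_type (@compact_interval R)).
Qed.

(* Both [clamp (t / l)] and [1 / l] are discontinuous at [l = 0], but the product
   is squeezed by [d]. *)
Lemma ct_squeezed (R : realType) (X : topologicalType) (t l d : X -> R) :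
  continuous t -> continuous l -> continuous d -> (forall x, `|d x| <= l x) ->
  continuous (fun x => clamp (t x / l x) * d x).
Proof.
move=> ct cl cd dl x.
have [lx|lx] := eqVneq (l x) 0; last first.
  apply: cvgM; last exact: cd.
  have : {for x, continuous (fun x => t x / l x)}.
    by apply: cvgM; [exact: ct|apply: cvgV => //; exact: cl].
  move=> c; have cc : continuous (@clamp R) by exact: (ct_clamp ct_id).
  exact: (continuous_comp c (cc _)).
have dx : d x = 0.
  by apply/eqP; rewrite -normr_eq0 eq_le normr_ge0 andbT -lx dl.
rewrite /continuous_at dx mulr0; apply/(@cvgrPdist_lt _ _ _ (nbhs x)) => eps eps0.
have := proj1 (@cvgrPdist_lt _ _ _ (nbhs x) (nbhs_filter x) _ _) (cd x) _ eps0.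
apply: filterS => y; rewrite dx !sub0r !normrN => dy.
apply: le_lt_trans dy; rewrite normrM ger0_norm ?clamp_ge0//.
by rewrite ler_piMl// clamp_le1.
Qed.

Section Complex.
Context {R : realType} {n : nat} (K : simplicial_complex n).

Definition supp (x : 'rV[R]_n) : {set 'I_n} := [set i | x ord0 i != 0]%SET.

Definition polyhedron : set 'rV[R]_n :=
  [set x : 'rV[R]_n |
    [/\ forall i, 0 <= x ord0 i, \sum_(i < n) x ord0 i = 1 & supp x \in faces K]].

Lemma supp_neq0 (x : 'rV[R]_n) : \sum_(i < n) x ord0 i = 1 -> supp x != finset.set0.
Proof.
move=> x1; apply: contra_eq_neq x1 => /eqP x0.
rewrite big1 => [|i _]; first by rewrite eq_sym oner_eq0.
apply/eqP; have : i \notin supp x by rewrite (eqP x0) finset.in_set0.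
by rewrite inE negbK.
Qed.

Lemma polyhedron_face (x : 'rV[R]_n) (F : {set 'I_n}) :
  (forall i, 0 <= x ord0 i) -> \sum_(i < n) x ord0 i = 1 -> supp x \subset F ->
  F \in faces K -> polyhedron x.
Proof.
move=> x0 x1 xF FK; split => //.
by apply: (faces_sub FK) => //; exact: supp_neq0.
Qed.

Lemma supp_conv (x y : 'rV[R]_n) c : supp (x + c *: (y - x)) \subset supp x :|: supp y.
Proof.
apply/fintype.subsetP => i; rewrite !inE !mxE; apply: contraR.
rewrite negb_or !negbK => /andP[/eqP -> /eqP ->].
by rewrite subrr mulr0 addr0.
Qed.

Lemma polyhedron_conv (x y : 'rV[R]_n) c : polyhedron x -> polyhedron y ->
  supp x :|: supp y \in faces K -> 0 <= c -> c <= 1 -> polyhedron (x + c *: (y - x)).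
Proof.
move=> [x0 x1 _] [y0 y1 _] xyK c0 c1.
apply: (polyhedron_face _ _ (supp_conv _ _ _) xyK).
- move=> i; rewrite !mxE; have := x0 i; have := y0 i; nra.
- under eq_bigr do rewrite !mxE.
  by rewrite big_split /= -mulr_sumr sumrB x1 y1 subrr mulr0 addr0.
Qed.

End Complex.

Section PathSpace.
Context {R : realType} {n : nat} (K : simplicial_complex n).
Variables (M B : topologicalType) (p : M -> B) (e : B -> 'rV[R]_n) (s : 'rV[R]_n -> B).
Hypotheses (cp : continuous p) (ce : continuous e) (eK : forall b, polyhedron K (e b))
  (cs : {within polyhedron K, continuous s}) (se : forall b, s (e b) = b)
  (es : forall x, polyhedron K x -> e (s x) = x).

Definition paths : topologicalType :=
  set_type [set z : M * {compact-open, unitI R -> B} |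
    continuous (z.2 : unitI R -> B) /\ z.2 (I0 R) = p z.1].

Definition pstart (z : paths) : M := (set_val z).1.
Definition pev (z : paths * R) : B := (set_val z.1).2 (to_I z.2).
Definition pend (z : paths) : B := pev (z, 1).

Lemma ct_pstart : continuous pstart.
Proof. by apply: (ct_fst (f := set_val)); exact: ct_val. Qed.

Lemma ct_pev : continuous pev.
Proof.
have c1 : continuous (uncurry (fun z : paths => (set_val z).2 : unitI R -> B)).
  apply: continuous_uncurry.
  - exact: unitI_locally_compact.
  - exact: unitI_hausdorff.
  - by apply: (ct_snd (f := set_val)); exact: ct_val.
  - by move=> z; have [] := set_valP' z.
apply: (@ct_comp _ _ _ _ (fun z : paths * R => (z.1, to_I z.2)) c1).
by have := @ct_to_I R => cI; cts.
Qed.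

Lemma ct_pend : continuous pend.
Proof. by apply: (ct_comp ct_pev); cts. Qed.

Lemma pev_le0 z t : t <= 0 -> pev (z, t) = p (pstart z).
Proof. by move=> t0; rewrite /pev to_I0//; have [] := set_valP' z. Qed.

Lemma pev_ge1 z t : 1 <= t -> pev (z, t) = pend z.
Proof. by move=> t1; rewrite /pend /pev !to_I1. Qed.

Lemma paths_ext (z z' : paths) : pstart z = pstart z' ->
  (forall t, 0 <= t -> t <= 1 -> pev (z, t) = pev (z', t)) -> z = z'.
Proof.
move=> zz' ev; apply: set_val_inj.
rewrite [set_val z]surjective_pairing [set_val z']surjective_pairing.
congr pair => //; apply/funext => u; rewrite -(to_IK u).
by apply: ev; have /= /andP[] := set_valP' u.
Qed.

Lemma paths_mk (X : topologicalType) (m : X -> M) (G : X * R -> B) :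
  continuous m -> continuous G -> (forall x, G (x, 0) = p (m x)) ->
  exists F : X -> paths, [/\ continuous F, forall x, pstart (F x) = m x,
    forall x t, pev (F x, t) = G (x, clamp t) & forall x, pend (F x) = G (x, 1)].
Proof.
move=> cm cG G0.
pose f x : M * {compact-open, unitI R -> B} := (m x, fun u => G (x, set_val u)).
have cGI : continuous (fun z : X * unitI R => G (z.1, set_val z.2)).
  apply: (ct_comp cG); apply: ct_pair; first by cts.
  by apply: (ct_comp (@ct_val _ _)); cts.
have fP x : [set z : M * {compact-open, unitI R -> B} |
    continuous (z.2 : unitI R -> B) /\ z.2 (I0 R) = p z.1] (f x).
  split => /=; last by rewrite val_I0.
  by apply: (@ct_comp (unitI R) (X * unitI R)%type B _ (fun u => (x, u)) cGI); cts.
exists (fun x => mksub (fP x)).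
have evE x t : pev (mksub (fP x), t) = G (x, clamp t).
  by rewrite /pev mksubK /= to_I_val.
split.
- apply: (ct_mksub fP); apply: ct_pair => //.
  by have [] := continuous_curry cGI.
- by move=> x; rewrite /pstart mksubK.
- exact: evE.
- by move=> x; rewrite /pend evE clamp_ge1.
Qed.

(** The track of [h] up to time [t] is appended to the path, and the result is run at speed
    [1 + clamp t]. At [t = 0] the speed is 1, so the lift starts at [f x] itself and not at a
    reparametrization. *)
Lemma path_lift (X : topologicalType) (h : X * R -> B) (f : X -> paths) :
  continuous h -> continuous f -> (forall x, pend (f x) = h (x, 0)) ->
  exists L : X * R -> paths, [/\ continuous L, forall x, L (x, 0) = f x
    & forall x t, pend (L (x, t)) = h (x, clamp t)].
Proof.
move=> ch cf fh; have cev := ct_pev; have cst := ct_pstart.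
pose T (z : X * R * R) := z.2 * (1 + clamp z.1.2).
pose G (z : X * R * R) := if T z - 1 <= 0 then pev (f z.1.1, T z)
  else h (z.1.1, Num.min (clamp z.1.2) (T z - 1)).
have cG : continuous G.
  apply: paste; rewrite /T; [by cts|by cts|by cts|].
  move=> [[x t] a] /= a1; rewrite pev_ge1; last lra.
  by rewrite a1 (min_idPr (clamp_ge0 _)) fh.
have [||L [cL Ls Lev Lend]] := paths_mk (m := fun z => pstart (f z.1)) _ cG.
- by cts.
- by move=> [x t]; rewrite /G /T /= mul0r ifT ?pev_le0//; lra.
exists L; split => //.
- move=> x; apply: paths_ext; first by rewrite Ls.
  move=> t t0 t1; rewrite Lev /G /T /= (clamp_le0 (lexx 0)) addr0 mulr1.
  by rewrite clamp_id// ifT//; lra.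
- move=> x t; rewrite Lend /G /T /= mul1r; have t0 := clamp_ge0 t.
  have -> : 1 + clamp t - 1 = clamp t by lra.
  case: ifP => ct; last by rewrite minxx.
  have -> : clamp t = 0 by apply/eqP; rewrite eq_le ct t0.
  by rewrite addr0; exact: fh.
Qed.

(* Pairs [(z, y)] such that the segment from the end of [z] to [y] lies in a simplex. *)
Definition extendable : set (paths * 'rV[R]_n) :=
  [set w | polyhedron K w.2 /\ supp (e (pend w.1)) :|: supp w.2 \in faces K].

Let len (w : paths * 'rV[R]_n) : R := `|w.2 - e (pend w.1)|.

Let pt (w : (paths * 'rV[R]_n) * R) : 'rV[R]_n :=
  e (pev (w.1.1, w.2 * (1 + len w.1))) +
  \row_j (clamp ((w.2 * (1 + len w.1) - 1) / len w.1) *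
          (w.1.2 - e (pend w.1.1)) ord0 j).

Let cpt : continuous pt.
Proof.
have cev := ct_pev; have cend := ct_pend; rewrite /pt /len.
apply: ct_vadd; first by cts.
apply: ct_row => j; apply: ct_squeezed; [by cts|by cts|by cts|].
by move=> w; rewrite [leRHS]mx_normrE; apply: (le_bigmax _ _ (ord0, j)).
Qed.

Let ptE w t : pt (w, t) = e (pev (w.1, t * (1 + len w))) +
  clamp ((t * (1 + len w) - 1) / len w) *: (w.2 - e (pend w.1)).
Proof. by rewrite /pt; congr (_ + _); apply/rowP => j; rewrite !mxE. Qed.

Let len_ge0 w : 0 <= len w.
Proof. exact: normr_ge0. Qed.

Let ptK w t : extendable w -> polyhedron K (pt (w, t)).
Proof.
move=> [wK wF]; rewrite ptE.
have [t1|t1] := leP (t * (1 + len w)) 1.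
  rewrite clamp_le0 ?scale0r ?addr0//.
  by rewrite mulr_le0_ge0 ?invr_ge0//; lra.
by rewrite pev_ge1 ?ltW//; apply: polyhedron_conv => //; rewrite ?clamp_ge0 ?clamp_le1.
Qed.

(* Transport is regular: constant along trivial segments. This is what the
   time-scaling by the length of the segment is for. *)
Lemma transport_exists : exists tr : paths * 'rV[R]_n -> paths,
  [/\ {within extendable, continuous tr},
      forall w, extendable w -> e (pend (tr w)) = w.2
    & forall z, tr (z, e (pend z)) = z].
Proof.
pose m (w : set_type extendable) := pstart (set_val w).1.
pose G (w : set_type extendable * R) := s (pt (set_val w.1, w.2)).
have cG : continuous G.
  apply: (ct_within (B := polyhedron K) _ _ cs) => [|w]; last first.
    by apply: ptK; exact: set_valP'.
  apply: (ct_comp cpt); apply: ct_pair; last by cts.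
  by apply: (ct_comp (@ct_val _ _)); cts.
have cm : continuous m.
  by apply: (ct_comp ct_pstart); apply: ct_fst; exact: ct_val.
have [|F [cF Fs Fev Fend]] := paths_mk cm cG.
  move=> w; rewrite /G ptE /= mul0r pev_le0// sub0r clamp_le0 ?scale0r ?addr0 ?se//.
  by rewrite mulr_le0_ge0 ?invr_ge0 ?len_ge0// oppr_le0.
pose tr w := if pselect (extendable w) is left h then F (mksub h) else w.1.
have trE w (h : extendable w) : tr w = F (mksub h).
  rewrite /tr; case: pselect => // h'; congr F; apply: set_val_inj.
  by rewrite !mksubK.
have trV (w : set_type extendable) : tr (set_val w) = F w.
  by rewrite (trE _ (set_valP' w)); congr F; apply: set_val_inj; rewrite mksubK.
exists tr; split.
- apply/within_set_type; rewrite (_ : (fun x => _) = F)//.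
  exact/funext.
- move=> w h; rewrite (trE _ h) Fend /G mksubK es; last exact: ptK.
  rewrite ptE mul1r addrAC subrr add0r pev_ge1 ?lerDl ?len_ge0//.
  have [l0|l0] := eqVneq (len w) 0.
    by move: l0 => /normr0_eq0 /eqP; rewrite subr_eq0 => /eqP ->; rewrite subrr scaler0 addr0.
  by rewrite divff// clamp_ge1// scale1r addrC subrK.
- move=> z; have h : extendable (z, e (pend z)).
    by split => //=; rewrite finset.setUid; case: (eK (pend z)).
  rewrite (trE _ h); apply: paths_ext; first by rewrite Fs /m mksubK.
  move=> t t0 t1; rewrite Fev /G mksubK ptE /= subrr scaler0 addr0 se.
  by rewrite /len /= subrr normr0 addr0 mulr1 clamp_id.
Qed.

End PathSpace.

(** * A collar of the boundary of a simplex *)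

Section SimplexCollar.
Context {R : realType} {n : nat} (F : {set 'I_n}).
Hypothesis F0 : F != finset.set0.
Implicit Types x : 'rV[R]_n.

Let k : R := #|F|%:R.

Let k_gt0 : 0 < k.
Proof. by rewrite ltr0n card_gt0. Qed.

Definition on_simplex x := [/\ forall j, 0 <= x ord0 j,
  \sum_(j < n) x ord0 j = 1 & supp x \subset F].

(** The default 1 does not disturb the minimum, since coordinates in the simplex are at most 1. *)
Definition min_coord x : R := \big[Num.min/1]_(j in F) x ord0 j.

Lemma ct_min_coord (X : topologicalType) (f : X -> 'rV[R]_n) :
  continuous f -> continuous (fun y => min_coord (f y)).
Proof.
move=> cf; rewrite /min_coord; elim: (index_enum _) => [|j r ih].
  by under eq_fun do rewrite big_nil; exact: ct_cst.
under eq_fun do rewrite big_cons; case: (j \in F) => //.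
by apply: ct_min => //; exact: ct_coord.
Qed.

Lemma min_coord_le x j : j \in F -> min_coord x <= x ord0 j.
Proof. by move=> jF; rewrite /min_coord (bigD1 j)//= ge_min lexx. Qed.

Lemma min_coord_ge0 x : on_simplex x -> 0 <= min_coord x.
Proof.
move=> [x0 _ _]; rewrite /min_coord; elim/big_ind : _ => // a b a0 b0.
by rewrite le_min a0 b0.
Qed.

Lemma coord_le1 x j : on_simplex x -> x ord0 j <= 1.
Proof.
move=> [x0 x1 _]; rewrite -x1 (bigD1 j)//= lerDl; apply: sumr_ge0 => i _; exact: x0.
Qed.

Lemma min_coord_attained x : on_simplex x -> exists2 j, j \in F & x ord0 j = min_coord x.
Proof.
move=> xF; have [j0 j0F] : exists j, j \in F by exact/set0Pn.
have [hE|[j jF]] : min_coord x = 1 \/ exists2 j, j \in F & x ord0 j = min_coord x.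
- rewrite /min_coord; elim/big_ind : _ => [|a b ha hb|j jF]; first by left.
  + by rewrite /Num.min; case: ifP.
  + by right; exists j.
- exists j0 => //; apply/eqP; rewrite eq_le hE coord_le1//= -hE; exact: min_coord_le.
- by exists j.
Qed.

Lemma sum_simplex x : supp x \subset F -> \sum_(j < n) x ord0 j = \sum_(j in F) x ord0 j.
Proof.
move=> xF; rewrite (bigID (mem F))/= [X in _ + X]big1 ?addr0// => j jF.
apply/eqP; apply: contraNT jF => xj.
by apply: (fintype.subsetP xF); rewrite inE.
Qed.

Lemma card_min_coord x : on_simplex x -> k * min_coord x <= 1.
Proof.
move=> xF; have [_ x1 xs] := xF; rewrite -x1 sum_simplex// /k -sum1_card natr_sum mulr_suml.
by apply: ler_sum => j jF; rewrite mul1r; exact: min_coord_le.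
Qed.

(* Pushes the outer half of the simplex radially to the boundary; the cutoff
   makes the push continuous at the barycentre. *)
Let cutoff x : R := Num.min (min_coord x) (k^-1 - min_coord x).

Let cutoff_lt x : on_simplex x -> 2^-1 <= 1 - k * cutoff x.
Proof.
move=> xF; have h : cutoff x * 2 <= k^-1.
  have h1 : cutoff x <= min_coord x by rewrite /cutoff ge_min lexx.
  have h2 : cutoff x <= k^-1 - min_coord x by rewrite /cutoff ge_min lexx orbT.
  by lra.
have : k * (cutoff x * 2) <= 1.
  by move: h; rewrite -(ler_pM2l k_gt0) divff// lt0r_neq0.
by lra.
Qed.

Let cutoff_ge0 x : on_simplex x -> 0 <= cutoff x.
Proof.
move=> xF; rewrite /cutoff le_min min_coord_ge0//= subr_ge0.
by rewrite -(ler_pM2l k_gt0) divff ?gt_eqF// card_min_coord.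
Qed.

Definition simplex_push x : 'rV[R]_n :=
  \row_j ((x ord0 j - (if j \in F then cutoff x else 0)) / (1 - k * cutoff x)).

Lemma simplex_push_on x : on_simplex x -> on_simplex (simplex_push x).
Proof.
move=> xF; have [x0 x1 xs] := xF; have d0 := cutoff_lt xF.
have dp : 0 < 1 - k * cutoff x by apply: lt_le_trans d0; rewrite invr_gt0.
split.
- move=> j; rewrite mxE; apply: divr_ge0; last exact: ltW.
  case: ifP => jF; rewrite ?subr0// subr_ge0.
  by apply: le_trans (min_coord_le x jF); rewrite /cutoff ge_min lexx.
- under eq_bigr do rewrite mxE.
  rewrite -mulr_suml sumrB x1 -big_mkcond/= sumr_const -mulr_natl.
  by rewrite divff// gt_eqF.
- apply/fintype.subsetP => j; rewrite inE mxE; apply: contraR => jF.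
  rewrite (negbTE jF) subr0 mulf_eq0; apply/orP; left.
  by apply: contraNT jF => xj; apply: (fintype.subsetP xs); rewrite inE.
Qed.

(** Depth at most 1 means that the smallest coordinate is at most half its value at the barycentre;
    there [cutoff] equals [min_coord] and the push reaches the boundary. *)
Definition simplex_depth x : R := 2 * (k * min_coord x).

Lemma ct_simplex_depth (X : topologicalType) (f : X -> 'rV[R]_n) :
  continuous f -> continuous (fun y => simplex_depth (f y)).
Proof. by move=> cf; have cm := ct_min_coord cf; rewrite /simplex_depth; cts. Qed.

Lemma simplex_push_bd x : on_simplex x -> simplex_depth x <= 1 ->
  supp (simplex_push x) != F.
Proof.
move=> xF xd; have [j jF jx] := min_coord_attained xF.
have cE : cutoff x = min_coord x.
  apply/min_idPl; rewrite lerBrDr -(ler_pM2l k_gt0) divff ?gt_eqF//.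
  by move: xd; rewrite /simplex_depth; lra.
apply: contraTneq jF => <-; rewrite inE mxE negbK.
case: ifP => jF'; first by rewrite jx cE subrr mul0r.
have [_ _ xs] := xF; rewrite subr0 (_ : x ord0 j = 0) ?mul0r//.
apply/eqP; apply: contraFT jF' => xj.
by apply: (fintype.subsetP xs); rewrite inE.
Qed.

Lemma min_coord_bd x : on_simplex x -> supp x != F -> min_coord x = 0.
Proof.
move=> xF xne; have [x0 _ xs] := xF.
have [j jF xj] : exists2 j, j \in F & x ord0 j = 0.
  have : supp x \proper F by rewrite finset.properEneq xne.
  by move=> /fintype.properP[_ [j jF]]; rewrite inE negbK => /eqP xj; exists j.
by apply/eqP; rewrite eq_le min_coord_ge0// -xj min_coord_le.
Qed.

Lemma simplex_push_id x : on_simplex x -> supp x != F -> simplex_push x = x.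
Proof.
move=> xF xne; have m0 := min_coord_bd xF xne.
have c0 : cutoff x = 0 by rewrite /cutoff m0; apply/min_idPl; rewrite subr0 invr_ge0 ltW.
apply/rowP => j; rewrite mxE c0 mulr0 subr0 divr1.
by case: ifP; rewrite subr0.
Qed.

Lemma simplex_depth_bd x : on_simplex x -> supp x != F -> simplex_depth x = 0.
Proof. by move=> xF xne; rewrite /simplex_depth min_coord_bd// !mulr0. Qed.

Lemma ct_simplex_push (X : topologicalType) (f : X -> 'rV[R]_n) : continuous f ->
  (forall y, on_simplex (f y)) -> continuous (fun y => simplex_push (f y)).
Proof.
move=> cf fF; have cm := ct_min_coord cf.
have cc : continuous (fun y => cutoff (f y)) by rewrite /cutoff; cts.
apply: ct_row => j; apply: ct_mul.
  by apply: ct_add; [exact: ct_coord|case: (j \in F); cts].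
apply: ct_inv; first by cts.
by move=> y; rewrite gt_eqF// (lt_le_trans _ (cutoff_lt (fF y)))// invr_gt0.
Qed.

Lemma on_simplex_conv x y c : on_simplex x -> on_simplex y -> 0 <= c -> c <= 1 ->
  on_simplex (x + c *: (y - x)).
Proof.
move=> [x0 x1 xs] [y0 y1 ys] c0 c1; split.
- by move=> i; rewrite !mxE; have := x0 i; have := y0 i; nra.
- under eq_bigr do rewrite !mxE.
  by rewrite big_split /= -mulr_sumr sumrB x1 y1 subrr mulr0 addr0.
- by apply: fintype.subset_trans (supp_conv _ _ _) _; rewrite finset.subUset xs ys.
Qed.

End SimplexCollar.

(** * A finite model of the filtered path space *)

Lemma closed_inclusion (T : topologicalType) (S1 S2 : set T) (h : S1 `<=` S2) : closed S1 ->
  forall C, closed C ->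
  closed ((fun x : set_type S1 => mksub (h _ (set_valP' x)) : set_type S2) @` C).
Proof.
move=> clS C clC.
have oC : open (~` C) by exact: closed_openC.
have [V oV VC] : exists2 V : set T, open V & set_val @^-1` V = ~` C.
  by case: oC => V oV VC; exists V.
rewrite (_ : _ @` _ = set_val @^-1` (S1 `&` ~` V)).
  have cv : continuous (@set_val T S2) by exact: ct_val.
  move/continuous_closedP : cv; apply; apply: closedI => //.
  exact: open_closedC.
have CV (x : set_type S1) : C x <-> ~ V (set_val x).
  have -> : V (set_val x) = (~ C x) by rewrite -[LHS]/((set_val @^-1` V) x) VC.
  by split => [Cx|/contrapT].
apply/seteqP; split => y /=.
- by move=> [x Cx <-]; rewrite mksubK; split; [exact: set_valP'|exact: (proj1 (CV x) Cx)].
- move=> [S1y nV]; exists (mksub S1y); last by apply: set_val_inj; rewrite !mksubK.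
  by apply: (proj2 (CV _)); rewrite mksubK.
Qed.

Section PathModel.
Context {R : realType} {n : nat} (K : simplicial_complex n).
Variables (M B : topologicalType) (p : M -> B) (e : B -> 'rV[R]_n) (s : 'rV[R]_n -> B).
Hypotheses (cp : continuous p) (ce : continuous e) (eK : forall b, polyhedron K (e b))
  (cs : {within polyhedron K, continuous s}) (se : forall b, s (e b) = b)
  (es : forall x, polyhedron K x -> e (s x) = x).
Hypothesis hfib : forall b : B, homotopy_finite R (hofiber R p b).

Local Notation paths := (@paths R M B p).
Local Notation J := {set 'I_n}.

Let car (z : paths) : J := supp (e (pend z)).

Variable tr : paths * 'rV[R]_n -> paths.
Hypotheses (ctr : {within extendable K e, continuous tr})
  (etr : forall w, extendable K e w -> e (pend (tr w)) = w.2)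
  (trid : forall z, tr (z, e (pend z)) = z).

Definition paths_over (L : {set J}) : set paths := [set z | car z \in L].

Definition path_fsp (L : {set J}) : fsp J :=
  @Fsp J (set_type (paths_over L)) (fun t => [set z | car (set_val z) \subset t]).

Definition paths_in (F : J) : set paths := [set z | car z \subset F].

Lemma closed_paths_in (F : J) : closed (paths_in F).
Proof.
rewrite (_ : paths_in F = \bigcap_(i in [set i | i \notin F])
    [set z | `|e (pend z) ord0 i| <= 0]).
  apply: closed_bigI => i _; apply: closed_leF; last by cts.
  apply: ct_norm; apply: ct_coord; apply: (ct_comp ce); exact: ct_pend.
apply/seteqP; split => z.
- move=> /fintype.subsetP zF i /= iF; rewrite normr_le0.
  by apply: contraNT iF => ei; apply: zF; rewrite /car inE.
- move=> h; apply/fintype.subsetP => i; rewrite /car inE; apply: contraR => iF.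
  by have := h i iF; rewrite /= normr_le0.
Qed.

Lemma car_neq0 z : car z != finset.set0.
Proof. by apply: supp_neq0; case: (eK (pend z)). Qed.

Lemma closed_paths_over (L : simplicial_complex n) : closed (paths_over (faces L)).
Proof.
rewrite (_ : paths_over _ = \bigcup_(F in [set` enum (faces L)]) paths_in F).
  by apply: closed_bigcup => [|F _]; [exact: finite_seq|exact: closed_paths_in].
apply/seteqP; split => z.
- by move=> zL; exists (car z); rewrite /= ?mem_enum// /paths_in /=.
- move=> [F /=]; rewrite mem_enum => FL zF.
  exact: (faces_sub FL zF (car_neq0 z)).
Qed.

Lemma on_simplex_pend z (F : J) : car z \subset F -> on_simplex F (e (pend z)).
Proof. by move=> zF; have [x0 x1 _] := eK (pend z). Qed.

Lemma extendable_in z y (F : J) : F \in faces K -> car z \subset F -> on_simplex F y ->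
  extendable K e (z, y).
Proof.
move=> FK zF [y0 y1 yF]; split => /=; first exact: polyhedron_face y0 y1 yF FK.
have h : supp (e (pend z)) :|: supp y \subset F by rewrite finset.subUset zF yF.
apply: (faces_sub FK h).
apply: contraTneq (car_neq0 z) => E; rewrite negbK -finset.subset0 -E.
exact: finset.subsetUl.
Qed.

Lemma car_tr z y : extendable K e (z, y) -> car (tr (z, y)) = supp y.
Proof. by move=> h; rewrite /car etr. Qed.

(* The part of the path space over a closed simplex deformation retracts to the
   homotopy fibre over any of its vertices. *)
Lemma paths_in_cANE (F : J) : F \in faces K ->
  exists2 Z, cANE R Z & fequiv R (plain (set_type (paths_in F))) (plain Z).
Proof.
move=> FK; have [i0 i0F] : exists i, i \in F.
  by apply/set0Pn; apply: contraTneq FK => ->; exact: faces_neq0.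
pose y0 : 'rV[R]_n := \row_j (j == i0)%:R.
have y0F : on_simplex F y0.
  split.
  - by move=> j; rewrite mxE ler0n.
  - rewrite (bigD1 i0)//= mxE eqxx big1 ?addr0// => j ji.
    by rewrite mxE (negbTE ji).
  - apply/fintype.subsetP => j; rewrite inE mxE.
    by have [->|_] := eqVneq j i0; rewrite ?eqxx.
have [Y hY fY] := hfib (s y0).
have [Z hZ YZ] := finite_CW_cANE hY; exists Z => //.
apply: (fequiv_trans _ YZ); apply: (fequiv_trans _ (homotopy_equivalent_fequiv fY)).
have y0K : polyhedron K y0 by case: y0F => *; apply: polyhedron_face FK.
have ext (z : set_type (paths_in F)) : extendable K e (set_val z, y0).
  by apply: (extendable_in FK (set_valP' z)); exact: y0F.
have endy z : extendable K e (z, y0) -> pend (tr (z, y0)) = s y0.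
  by move=> h; rewrite -(se (pend _)) etr.
have fP (z : set_type (paths_in F)) :
    [set w : M * {compact-open, unitI R -> B} | [/\ continuous (w.2 : unitI R -> B),
      w.2 (I0 R) = p w.1 & w.2 (I1 R) = s y0]] (set_val (tr (set_val z, y0))).
  have [c0 c1] := set_valP' (tr (set_val z, y0)); split => //.
  by rewrite -(endy _ (ext z)) /pend /pev to_I1.
have gP (w : hofiber R p (s y0)) : [set w : M * {compact-open, unitI R -> B} |
    continuous (w.2 : unitI R -> B) /\ w.2 (I0 R) = p w.1] (set_val w).
  by have [c0 c1 _] := set_valP' w.
have gend (w : hofiber R p (s y0)) : pend (mksub (gP w) : paths) = s y0.
  by rewrite /pend /pev mksubK to_I1//; have [] := set_valP' w.
have gF (w : hofiber R p (s y0)) : paths_in F (mksub (gP w) : paths).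
  by rewrite /paths_in /= /car gend es//; case: y0F.
pose f z : hofiber R p (s y0) := mksub (fP z).
pose g w : set_type (paths_in F) := mksub (gF w).
have ctrz : continuous (fun z : set_type (paths_in F) => tr (set_val z, y0)).
  apply: (ct_within (f := fun z : set_type (paths_in F) => (set_val z, y0)) _ ext ctr).
  by apply: ct_pair; [exact: ct_val|exact: ct_cst].
have cf : continuous f by apply: (ct_mksub fP); apply: (ct_comp (@ct_val _ _) ctrz).
have cg : continuous g.
  by apply: (ct_mksub gF); apply: (ct_mksub gP); exact: ct_val.
exists f; split; first exact: fmor_aon.
exists g; split; first exact: fmor_aon.
- pose y (z : set_type (paths_in F) * R) :=
    y0 + clamp z.2 *: (e (pend (set_val z.1)) - y0).
  have yF z : on_simplex F (y z).
    apply: on_simplex_conv; rewrite ?clamp_ge0 ?clamp_le1//.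
    exact: (on_simplex_pend (set_valP' z.1)).
  have ey z : extendable K e (set_val z.1, y z).
    by apply: (extendable_in FK) => //; exact: (set_valP' z.1).
  have HP z : paths_in F (tr (set_val z.1, y z)).
    by rewrite /paths_in /= car_tr//; case: (yF z).
  apply: (fhom_aon _ (H := fun z => mksub (HP z))).
  + apply: (ct_mksub HP).
    apply: (ct_within (f := fun z => (set_val z.1, y z)) _ ey ctr).
    have c1 : continuous (fun z : set_type (paths_in F) * R => set_val z.1).
      by apply: (ct_comp (@ct_val _ _)); cts.
    apply: ct_pair => //; rewrite /y.
    have c2 : continuous (fun z : set_type (paths_in F) * R => e (pend (set_val z.1))).
      by apply: (ct_comp ce); apply: (ct_comp (@ct_pend _ _ _ p)).
    by cts.
  + move=> z; apply: set_val_inj; rewrite /g /f !mksubK /y /= clamp_le0// scale0r addr0.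
    by apply: set_val_inj; rewrite !mksubK.
  + move=> z; apply: set_val_inj; rewrite !mksubK /y /= clamp_ge1// scale1r.
    by rewrite addrC subrK trid.
- apply: fhom_eq; first by apply: fmor_aon; cts.
  move=> w; apply: set_val_inj; rewrite /f /g !mksubK.
  have e1 : e (pend (mksub (gP w) : paths)) = y0 by rewrite gend es.
  by have := trid (mksub (gP w)); rewrite e1 => ->; rewrite mksubK.
Qed.

End PathModel.

Definition inc (T : Type) (S1 S2 : set T) (h : S1 `<=` S2) (x : set_type S1) : set_type S2 :=
  mksub (h _ (set_valP' x)).

Lemma incK (T : Type) (S1 S2 : set T) (h : S1 `<=` S2) (x : set_type S1) :
  set_val (inc h x) = set_val x.
Proof. exact: mksubK. Qed.

Lemma ct_inc (T : topologicalType) (S1 S2 : set T) (h : S1 `<=` S2) :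
  continuous (inc h).
Proof. by apply: (ct_mksub (fun x => h _ (set_valP' x))); exact: ct_val. Qed.

(** * Induction over the simplices *)

Section ModelInduction.
Context {R : realType} {n : nat} (K : simplicial_complex n).
Variables (M B : topologicalType) (p : M -> B) (e : B -> 'rV[R]_n) (s : 'rV[R]_n -> B).
Hypotheses (cp : continuous p) (ce : continuous e) (eK : forall b, polyhedron K (e b))
  (cs : {within polyhedron K, continuous s}) (se : forall b, s (e b) = b)
  (es : forall x, polyhedron K x -> e (s x) = x).
Hypothesis hfib : forall b : B, homotopy_finite R (hofiber R p b).

Local Notation paths := (@paths R M B p).
Local Notation J := {set 'I_n}.
Local Notation pathsF := (@path_fsp R n M B p e).
Local Notation over := (@paths_over R n M B p e).
Local Notation within_face := (@paths_in R n M B p e).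

Let car (z : paths) : J := supp (e (pend z)).

Variable tr : paths * 'rV[R]_n -> paths.
Hypotheses (ctr : {within extendable K e, continuous tr})
  (etr : forall w, extendable K e w -> e (pend (tr w)) = w.2)
  (trid : forall z, tr (z, e (pend z)) = z).

(** Monotonicity and closure under intersections are what makes the pieces of the total space closed
    under intersections. *)
Definition lattice_filtered (G : fsp J) : Prop :=
  [/\ forall (t t' : J) (g : G), fset t g -> fset t' g -> fset (t :&: t') g,
      forall (t t' : J) (g : G), t \subset t' -> fset t g -> fset t' g,
      forall g : G, ~ fset (finset.set0 : J) g
    & forall g : G, fset (finset.setT : J) g].

Definition finite_model (X : fsp J) : Prop := exists G : fsp J,
  [/\ cANE R G, forall t, compact (@fset _ G t), forall t, ANE R (@fset _ G t),
      lattice_filtered G & fequiv R X G].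

Section Step.
Variables (L L' : simplicial_complex n) (F : J).
Hypotheses (LK : faces L \subset faces K) (FL : F \in faces L)
  (L'E : faces L' = faces L :\ F).

Let FK : F \in faces K. Proof. exact: (fintype.subsetP LK). Qed.

Let F0 : F != finset.set0.
Proof. by apply: contraTneq FL => ->; exact: faces_neq0. Qed.

Let bd : set paths := within_face F `&` over (faces L').

Let h_i : bd `<=` within_face F. Proof. by move=> z []. Qed.
Let h_w : bd `<=` over (faces L'). Proof. by move=> z []. Qed.
Let h_X : within_face F `<=` over (faces L).
Proof. by move=> z zF; apply: (faces_sub FL zF); exact: car_neq0 eK _. Qed.
Let h_F : over (faces L') `<=` over (faces L).
Proof. by move=> z; rewrite /paths_over /= L'E in_setD1 => /andP[]. Qed.

Let b (t : J) : Prop := F \subset t.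
(** Paths ending on the boundary of [F] have smaller carriers, but in the pushout these are
    accounted for by the part over [L']. Hence [X] can carry the all-or-nothing filtration, and the
    unfiltered model of the face suffices. *)
Let X : fsp J := aon b (set_type (within_face F)).
Let A : fsp J := aon b (set_type bd).
Let i : A -> X := inc h_i.
Let w : A -> pathsF (faces L') := inc h_w.
Let iX : X -> pathsF (faces L) := inc h_X.
Let iF : pathsF (faces L') -> pathsF (faces L) := inc h_F.

Let bdP z : bd z <-> car z \subset F /\ car z != F.
Proof.
rewrite /bd /paths_in /paths_over /= L'E in_setD1; split.
  by move=> [zF /andP[]].
move=> [zF zne]; split => //; rewrite zne /=.
exact: (@h_X z zF).
Qed.

Let Fi : fmor i. Proof. by apply: fmor_aon; exact: ct_inc. Qed.

Let Fw : fmor w.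
Proof.
apply: fmor_aonl => [|t x bt]; first exact: ct_inc.
by rewrite /= incK; apply: fintype.subset_trans bt; have [] := set_valP' x.
Qed.

Let FX : fmor iX.
Proof.
apply: fmor_aonl => [|t x bt]; first exact: ct_inc.
by rewrite /= incK; apply: fintype.subset_trans bt; exact: (set_valP' x).
Qed.

Let FF : fmor iF.
Proof. by split => [|t x]; [exact: ct_inc|rewrite /= incK]. Qed.

Let po : is_pushout i w iX iF.
Proof.
apply: closed_pushout.
- exact: ct_inc.
- exact: ct_inc.
- by apply: closed_inclusion; exact: closed_paths_in.
- by apply: closed_inclusion; exact: (closed_paths_over ce eK).
- by move=> a; apply: set_val_inj; rewrite !incK.
- move=> q; have qL : car (set_val q) \in faces L by exact: (set_valP' q).
  have [qF|qF] := eqVneq (car (set_val q)) F.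
    have h : within_face F (set_val q) by rewrite /paths_in /= -/(car _) qF.
    by left; exists (mksub h); apply: set_val_inj; rewrite incK mksubK.
  have h : over (faces L') (set_val q).
    by rewrite /paths_over /= L'E in_setD1 -/(car _) qF.
  by right; exists (mksub h); apply: set_val_inj; rewrite incK mksubK.
- by move=> x y /(congr1 set_val); rewrite !incK => /set_val_inj.
- move=> x y /(congr1 set_val); rewrite !incK => xy.
  have h : bd (set_val x) by split; [exact: set_valP'|rewrite xy; exact: set_valP'].
  by exists (mksub h); apply: set_val_inj; rewrite incK mksubK.
- by move=> x x' /(congr1 set_val); rewrite !incK => /set_val_inj ->; left.
Qed.

Let onF (x : X) : on_simplex F (e (pend (set_val x))).
Proof. exact: (on_simplex_pend eK (set_valP' x)). Qed.

Let push (x : X) : 'rV[R]_n := simplex_push F (e (pend (set_val x))).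

Let tgt (z : X * R) : 'rV[R]_n :=
  e (pend (set_val z.1)) + clamp z.2 *: (push z.1 - e (pend (set_val z.1))).

Let tgtF z : on_simplex F (tgt z).
Proof.
apply: on_simplex_conv; rewrite ?clamp_ge0 ?clamp_le1//.
by apply: simplex_push_on => //; exact: onF.
Qed.

Let tgt_ext z : extendable K e (set_val z.1, tgt z).
Proof. by apply: (extendable_in eK FK (set_valP' z.1)); exact: tgtF. Qed.

Let HP z : within_face F (tr (set_val z.1, tgt z)).
Proof. by rewrite /paths_in /= etr//; case: (tgtF z). Qed.

(** The collar of the simplex lifted to paths: the end is transported along the segment to its push.
    Regularity of transport makes this stationary over the boundary, where the push is the
    identity. *)
Let H (z : X * R) : X := mksub (HP z).

Let ct_epend : continuous (fun x : X => e (pend (set_val x))).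
Proof. by apply: (ct_comp ce); apply: (ct_comp (@ct_pend _ _ _ p)); exact: ct_val. Qed.

Let ct_push : continuous push.
Proof. by apply: ct_simplex_push => // x; exact: onF. Qed.

Let ct_H : continuous H.
Proof.
apply: (ct_mksub HP); apply: (ct_within (f := fun z => (set_val z.1, tgt z)) _ tgt_ext ctr).
have c1 := ct_epend; have c2 := ct_push; apply: ct_pair.
  by apply: (ct_comp (@ct_val _ _)); cts.
have c3 : continuous (fun z : X * R => e (pend (set_val z.1))).
  by apply: (ct_comp c1); cts.
by rewrite /tgt; cts.
Qed.

Let H_0 x : H (x, 0) = x.
Proof.
by apply: set_val_inj; rewrite mksubK /tgt /= clamp_le0// scale0r addr0 trid.
Qed.

Let H_i a t : H (i a, t) = i a.
Proof.
apply: set_val_inj; rewrite mksubK /tgt /push /= incK.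
have /bdP[aF ane] := set_valP' a.
by rewrite simplex_push_id ?subrr ?scaler0 ?addr0 ?trid//; exact: (on_simplex_pend eK aF).
Qed.

Let depth (x : X) : R := simplex_depth F (e (pend (set_val x))).

Lemma path_pushout : fequiv R (@dmf R J X A (pathsF (faces L')) i w) (pathsF (faces L)).
Proof.
have QF t y : fset t (iF y) -> fset t y by rewrite /= incK.
have QX t x : fset t (iX x) -> fset t x \/ exists y, iX x = iF y.
  rewrite /= incK => xt; have [xF|xF] := eqVneq (car (set_val x)) F.
    by left; rewrite /= /b -xF.
  right; have h : over (faces L') (set_val x).
    by have [] := (proj2 (bdP (set_val x))) (conj (set_valP' x) xF).
  by exists (mksub h); apply: set_val_inj; rewrite !incK mksubK.
have [[a0]|noA] := pselect (inhabited A); last first.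
  exact: (@fequiv_empty_pushout R J X A (pathsF (faces L')) (pathsF (faces L))
    i w iX iF noA FX FF po QF QX).
have bd1 x : depth x <= 1 -> bd (tr (set_val x, tgt (x, 1))).
  move=> x1; apply/bdP; rewrite /car etr; last exact: (tgt_ext (x, 1)).
  split; first by case: (tgtF (x, 1)).
  rewrite /tgt /= clamp_ge1// scale1r addrC subrK.
  exact: simplex_push_bd.
pose rho (x : X) : A := if pselect (bd (tr (set_val x, tgt (x, 1)))) is left h
  then mksub h else a0.
have rhoE x : bd (tr (set_val x, tgt (x, 1))) ->
    set_val (rho x) = tr (set_val x, tgt (x, 1)).
  by move=> h; rewrite /rho; case: pselect => // h'; rewrite mksubK.
apply: (@fequiv_collar_pushout R J X A (pathsF (faces L')) (pathsF (faces L))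
  i w iX iF depth H rho Fi Fw FX FF po QF QX).
- by apply: ct_simplex_depth; exact: ct_epend.
- exact: ct_H.
- apply/within_set_type; apply: ct_sub.
  rewrite (_ : (fun x => _) = fun x : set_type [set x | depth x <= 1] =>
    set_val (H (set_val x, 1))).
    apply: (ct_comp (@ct_val _ _)); apply: (ct_comp ct_H).
    by apply: ct_pair; [exact: ct_val|exact: ct_cst].
  apply/funext => x; rewrite mksubK rhoE//; apply: bd1; exact: (set_valP' x).
- move=> a; rewrite /depth incK; have /bdP[aF ane] := set_valP' a.
  by rewrite simplex_depth_bd//; exact: (on_simplex_pend eK aF).
- exact: H_0.
- exact: H_i.
- move=> x x1; apply: set_val_inj; rewrite incK rhoE ?mksubK//; exact: bd1.
- move=> a; apply: set_val_inj.
  have E : tr (set_val (i a), tgt (i a, 1)) = set_val a.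
    by have := congr1 set_val (H_i a 1); rewrite mksubK incK.
  by rewrite rhoE E//; exact: set_valP'.
- by [].
- by [].
Qed.

(** In the cylinder for the path space over [L], the part over the face is replaced by a compact ANE
    [Z], the part over [L'] by its model [G], and the part over the boundary of [F] by the step of
    [G] at [F]. Then the attaching map is made injective. *)
Lemma model_step : finite_model (pathsF (faces L')) -> finite_model (pathsF (faces L)).
Proof.
move=> [G [hG cG aG [Gi Gm G0 GT] [g [Fg [f [Ff fg gf]]]]]].
have [Z hZ XZ] : exists2 Z, cANE R Z & fequiv R (plain (set_type (within_face F))) (plain Z).
  by apply: (@paths_in_cANE R n K M B p e s) FK.
have [a ha] := fequiv_aon b XZ.
pose GF := [set x : G | fset F x].
pose A' : fsp J := aon b (set_type GF).
pose i' : A' -> G := set_val.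
have ci' : continuous i' by exact: ct_val.
have Fi' : fmor i'.
  by apply: fmor_aonl => // t x bt; exact: (Gm _ _ _ bt (set_valP' x)).
have bdF (y : pathsF (faces L')) : fset F y -> bd (set_val y).
  by move=> yF; split => //; exact: set_valP'.
have wF (x : A) : fset F (w x) by rewrite /= incK; have [] := set_valP' x.
have [cf jf] := Ff; have [cg jg] := Fg.
have fbd (x : A') : bd (set_val (f (set_val x))) by apply: bdF; exact: (jf F _ (set_valP' x)).
have gbd (x : A) : GF (g (w x)) by apply: jg.
pose fA x : A := mksub (fbd x); pose gA x : A' := mksub (gbd x).
have FfA : fmor fA.
  apply: fmor_aon; apply: (ct_mksub fbd); apply: (ct_comp (@ct_val _ _)).
  exact: (ct_comp cf ci').
have FgA : fmor gA.
  by apply: fmor_aon; apply: (ct_mksub gbd); apply: (ct_comp cg); exact: ct_inc.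
have fi x : f (i' x) = w (fA x) by apply: set_val_inj; rewrite incK mksubK.
have gi x : g (w x) = i' (gA x) by rewrite /i' mksubK.
(* The homotopies between [G] and the path space are filtered, so they restrict to the step at [F];
   this gives homotopies of the arrows [i'] and [w]. *)
have id' : arrow_id (R := R) i' (fun x => g (f x)) (fun x => gA (fA x)).
  have [E [cE E0 E1 EJ]] := gf.
  have EF (z : A' * R) : GF (E (set_val z.1, z.2)) by exact: (EJ F _ _ (set_valP' z.1)).
  exists E, (fun z => mksub (EF z)); split; [by []|split => //|by move=> x t; rewrite /i' mksubK].
  - apply: (ct_mksub EF); apply: (ct_comp cE); apply: ct_pair; last by cts.
    by apply: (ct_comp ci'); cts.
  - move=> x t t0; apply: set_val_inj; rewrite mksubK /= E0//.
    by rewrite -/(i' (gA (fA x))) -gi -fi.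
  - by move=> x t t1; apply: set_val_inj; rewrite mksubK /= E1.
have idw : arrow_id (R := R) w (fun x => f (g x)) (fun x => fA (gA x)).
  have [E [cE E0 E1 EJ]] := fg.
  have EF (z : A * R) : bd (set_val (E (w z.1, z.2))).
    by apply: bdF; apply: EJ; exact: wF.
  exists E, (fun z => mksub (EF z)); split; [by []|split => //|].
  - apply: (ct_mksub EF); apply: (ct_comp (@ct_val _ _)); apply: (ct_comp cE).
    have cw : continuous w by exact: ct_inc.
    by cts.
  - move=> x t t0; apply: set_val_inj; rewrite mksubK /= E0//=.
  - by move=> x t t1; apply: set_val_inj; rewrite mksubK /= E1// incK.
  - by move=> x t; apply: set_val_inj; rewrite incK mksubK.
have [Fa _] := ha; have Fai := fmor_comp Fi Fa.
have src := fhe_dmc_source Fi' Fw Fai Ff FfA Fg FgA fi gi id' idw.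
have [caif _] := fmor_comp FfA Fai.
have cGF : compact [set: set_type GF] by apply: compact_set_type; exact: cG.
have hGF : cANE R (set_type GF).
  split => //; last by apply: (proj1 (ANE_set_type _)); exact: aG.
  have [_ eG _] := hG.
  by apply: (embeddable_inj (f := set_val)); [exact: ct_val|exact: set_val_inj|].
have [|F' [w' [cw' hD cD aD eD]]] := attach_cANE (b := b) ci' (@set_val_inj _ _) caif hG
  hGF hZ cG aG.
  by move=> t x bt; exact: (Gm _ _ _ bt (set_valP' x)).
exists (@dmf R J G A' (aon b F') i' w'); split => //.
- split.
  + move=> t t' d; case: d => [x|x u|y]; rewrite /= /dmc_fset.
    * exact: Gi.
    * by move=> bt bt'; rewrite /= /b finset.subsetI bt bt'.
    * by move=> bt bt'; rewrite /= /b finset.subsetI bt bt'.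
  + move=> t t' d tt'; case: d => [x|x u|y]; rewrite /= /dmc_fset.
    * exact: Gm.
    * by move=> bt; exact: fintype.subset_trans bt tt'.
    * by move=> bt; exact: fintype.subset_trans bt tt'.
  + move=> d; case: d => [x|x u|y]; rewrite /= /dmc_fset.
    * exact: G0.
    * by rewrite /= /b finset.subset0 (negbTE F0).
    * by rewrite /= /b finset.subset0 (negbTE F0).
  + move=> d; case: d => [x|x u|y]; rewrite /= /dmc_fset.
    * exact: GT.
    * exact: finset.subsetT.
    * exact: finset.subsetT.
- apply: fequiv_trans (fequiv_sym path_pushout) _.
  apply: (fequiv_trans (fequiv_dmc_swap Fi Fw)).
  apply: (fequiv_trans (ex_intro _ _ (fhe_dmc_target Fw Fi ha))).
  apply: (fequiv_trans (fequiv_sym (ex_intro _ _ src))).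
  exact: eD.
Qed.

End Step.

Lemma path_model (L : simplicial_complex n) : faces L \subset faces K ->
  finite_model (pathsF (faces L)).
Proof.
move: {2}#|faces L| (erefl #|faces L|) => r; elim: r L => [|r ih] L Lr LK.
  have noL (z : pathsF (faces L)) : False.
    have nL (x : J) : x \notin faces L by rewrite (cards0_eq Lr) finset.in_set0.
    exact: (negP (nL _) (set_valP' z)).
  have full (t : J) : @fset _ (pathsF (faces L)) t = set0.
    by apply/seteqP; split => x // _; case: (noL x).
  exists (pathsF (faces L)); split.
  - by apply: empty_cANE => -[/noL].
  - by move=> t; rewrite full; exact: compact0.
  - by move=> t; rewrite full; exact: ANE_set0.
  - by split => [t t'|t t'|g|g]; try (move=> g); case: (noL g).
  - exact: fequiv_refl.
have [F1 F1L] : exists F, F \in faces L by apply/set0Pn; rewrite -card_gt0 Lr.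
(* A face of largest cardinality is a proper face of no other, so the remaining faces form a
   complex. *)
pose F := [arg max_(F > F1 in faces L) #|F|]%N.
have [FL Fmax] : F \in faces L /\ forall F', F' \in faces L -> (#|F'| <= #|F|)%N.
  by rewrite /F; case: arg_maxnP => // F' FL' hF; split.
have L'0 : finset.set0 \notin faces L :\ F.
  by rewrite in_setD1 negb_and faces_neq0 orbT.
have L'sub (t u : J) : t \in faces L :\ F -> u \subset t -> u != finset.set0 ->
    u \in faces L :\ F.
  rewrite !in_setD1 => /andP[tF tL] ut u0; rewrite (faces_sub tL ut u0) andbT.
  apply: contraNneq tF => uF; rewrite eq_sym -uF eqEcard ut uF /=.
  exact: Fmax.
pose L' := SimplicialComplex L'0 L'sub.
apply: (@model_step L L' F) => //; apply: ih.
- by apply/eqP; rewrite -eqSS -Lr (cardsD1 F (faces L)) FL.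
- by apply: fintype.subset_trans LK; exact: finset.subsetDl.
Qed.

End ModelInduction.

(** * Truncation of barycentric coordinates *)

Section Truncation.
Context {R : realType} {n : nat}.
Implicit Types (x v : 'rV[R]_n) (c th : R).

Definition simplex x : Prop := (forall i, 0 <= x ord0 i) /\ \sum_(i < n) x ord0 i = 1.

(** The norm is the sup norm, which is the largest coordinate when all are nonnegative. *)
Definition amax x : {set 'I_n} := [set i | x ord0 i == `|x|]%SET.

Definition normalize v : 'rV[R]_n := (\sum_(i < n) v ord0 i)^-1 *: v.

Lemma coord_le_norm v i : v ord0 i <= `|v|.
Proof.
apply: le_trans (ler_norm _) _; rewrite [leRHS]mx_normrE.
exact: (@le_bigmax _ _ _ 0 (fun ij => `|v ij.1 ij.2|) (ord0, i)).
Qed.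

Lemma norm_eq_coord v c i : (forall j, 0 <= v ord0 j) -> (forall j, v ord0 j <= c) ->
  v ord0 i = c -> `|v| = c.
Proof.
move=> v0 vc vi; apply/eqP; rewrite eq_le -{2}vi coord_le_norm andbT [leLHS]mx_normrE.
apply/bigmax_leP; split => [|[a j] _]; first by rewrite -vi.
by rewrite (ord1 a) /= ger0_norm.
Qed.

Lemma sum_gt0_coord v : (forall j, 0 <= v ord0 j) -> 0 < \sum_(j < n) v ord0 j ->
  exists i, 0 < v ord0 i.
Proof.
move=> v0 v1; apply/existsP; apply/contraT => /existsPn h.
move: v1; rewrite big1 ?ltxx// => i _; apply/eqP; rewrite eq_le v0 andbT.
by have := h i; rewrite -leNgt.
Qed.

Lemma norm_attained v : (forall j, 0 <= v ord0 j) -> 0 < \sum_(j < n) v ord0 j ->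
  exists2 i, v ord0 i = `|v| & 0 < `|v|.
Proof.
move=> v0 v1; have [i0 vi0] := sum_gt0_coord v0 v1.
pose i := [arg max_(i > i0) (v ord0 i)]%O.
have iE : `|v| = v ord0 i.
  apply: (norm_eq_coord (i := i)) => // j.
  by rewrite /i; case: arg_maxP => // k _; exact.
exists i => //; rewrite iE /i; case: arg_maxP => // k _ /(_ i0 isT); exact: lt_le_trans.
Qed.

Lemma normalize_simplex v : (forall j, 0 <= v ord0 j) -> 0 < \sum_(j < n) v ord0 j ->
  simplex (normalize v).
Proof.
move=> v0 v1; split.
- by move=> i; rewrite mxE mulr_ge0// invr_ge0 ltW.
- by under eq_bigr do rewrite mxE; rewrite -mulr_sumr mulVf// gt_eqF.
Qed.

Lemma supp_normalize v : 0 < \sum_(j < n) v ord0 j -> supp (normalize v) = supp v.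
Proof.
by move=> v1; apply/setP => i; rewrite !inE mxE mulf_eq0 invr_eq0 gt_eqF.
Qed.

Lemma amax_normalize v : 0 < \sum_(j < n) v ord0 j -> amax (normalize v) = amax v.
Proof.
move=> v1; apply/setP => i; rewrite !inE mxE normrZ gtr0_norm ?invr_gt0//.
by rewrite (inj_eq (mulfI _))// invr_eq0 gt_eqF.
Qed.

Lemma normalize_id x : simplex x -> normalize x = x.
Proof. by move=> [_ x1]; rewrite /normalize x1 invr1 scale1r. Qed.

Lemma amax_supp x : simplex x -> amax x \subset supp x.
Proof.
move=> [x0 x1]; have [|i _ xp] := norm_attained x0; first by rewrite x1.
by apply/fintype.subsetP => j; rewrite !inE => /eqP ->; rewrite gt_eqF.
Qed.

Lemma amax_neq0 x : simplex x -> amax x != finset.set0.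
Proof.
move=> [x0 x1]; have [|i xi _] := norm_attained x0; first by rewrite x1.
by apply/set0Pn; exists i; rewrite inE xi.
Qed.

Lemma ct_normalize (X : topologicalType) (f : X -> 'rV[R]_n) : continuous f ->
  (forall z, \sum_(j < n) f z ord0 j != 0) -> continuous (fun z => normalize (f z)).
Proof.
move=> cf f0; apply: ct_scale => //; apply: ct_inv => //; apply: ct_sum => i.
by cts.
Qed.

(** A point splits into its truncation and the excess; [low] and [top] are these two parts projected
    back to the simplex. Bounding [th] by 1/2 keeps the truncation away from 0. *)
Definition cut th x : 'rV[R]_n := \row_i Num.min (x ord0 i) ((1 - th) * `|x|).

Definition low th x := normalize (cut th x).
Definition top th x := normalize (x - cut th x).

Section At.
Variables (th : R) (x : 'rV[R]_n).
Hypotheses (xs : simplex x) (th0 : 0 <= th) (th1 : th <= 1 / 2).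

Let x0 : forall i, 0 <= x ord0 i. Proof. by case: xs. Qed.
Let xp : exists2 i, x ord0 i = `|x| & 0 < `|x|.
Proof. by apply: norm_attained => //; case: xs => _ ->. Qed.

Let c0 : 0 < (1 - th) * `|x|.
Proof. by case: xp => i _ h; apply: mulr_gt0 => //; move: th1; lra. Qed.

Lemma cut_ge0 i : 0 <= cut th x ord0 i.
Proof. by rewrite mxE le_min x0 ltW. Qed.

Lemma cut_le i : cut th x ord0 i <= x ord0 i.
Proof. by rewrite mxE ge_min lexx. Qed.

Let cut_at i : x ord0 i = `|x| -> cut th x ord0 i = (1 - th) * `|x|.
Proof. by move=> xi; rewrite mxE xi; apply/min_idPr; rewrite ler_piMl//; move: th0; lra. Qed.

Lemma cut_sum_gt0 : 0 < \sum_(i < n) cut th x ord0 i.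
Proof.
case: xp => i xi _; rewrite (bigD1 i)//= ltr_pwDl//; first by rewrite cut_at.
by apply: sumr_ge0 => j _; exact: cut_ge0.
Qed.

Lemma rest_sum_gt0 : 0 < th -> 0 < \sum_(i < n) (x - cut th x) ord0 i.
Proof.
move=> thp; case: xp => i xi np; rewrite (bigD1 i)//= ltr_pwDl//.
  by rewrite 2!mxE cut_at// xi; move: np thp; nra.
by apply: sumr_ge0 => j _; rewrite 2!mxE subr_ge0 cut_le.
Qed.

Lemma low_simplex : simplex (low th x).
Proof. by apply: normalize_simplex; [exact: cut_ge0|exact: cut_sum_gt0]. Qed.

Lemma top_simplex : 0 < th -> simplex (top th x).
Proof.
move=> thp; apply: normalize_simplex; last exact: rest_sum_gt0.
by move=> j; rewrite 2!mxE subr_ge0 cut_le.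
Qed.

Lemma supp_low : supp (low th x) \subset supp x.
Proof.
rewrite supp_normalize; last exact: cut_sum_gt0.
apply/fintype.subsetP => i; rewrite !inE; apply: contraNneq => xi.
by rewrite eq_le cut_ge0 -{1}xi cut_le.
Qed.

Lemma supp_top : 0 < th -> supp (top th x) \subset supp x.
Proof.
move=> thp; rewrite supp_normalize; last exact: rest_sum_gt0.
apply/fintype.subsetP => i; rewrite !inE; apply: contraNneq => xi.
have : cut th x ord0 i = 0 by apply/eqP; rewrite eq_le cut_ge0 -{1}xi cut_le.
by move=> ci; rewrite 2!mxE ci xi subrr.
Qed.

Let amax_low_in i : (1 - th) * `|x| <= x ord0 i -> i \in amax (low th x).
Proof.
move=> xi; rewrite amax_normalize; last exact: cut_sum_gt0.
have ci : cut th x ord0 i = (1 - th) * `|x| by rewrite mxE; apply/min_idPr.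
rewrite inE ci; apply/eqP; symmetry; apply: (norm_eq_coord (i := i)) => //.
- exact: cut_ge0.
- by move=> j; rewrite mxE ge_min lexx orbT.
Qed.

Lemma amax_low : amax x \subset amax (low th x).
Proof.
apply/fintype.subsetP => i; rewrite inE => /eqP xi; apply: amax_low_in.
by rewrite xi ler_piMl//; move: th0; lra.
Qed.

(** A coordinate with nonzero excess lies above the threshold, and its truncation is then the
    maximum. *)
Lemma top_amax_low : 0 < th -> supp (top th x) \subset amax (low th x).
Proof.
move=> thp; rewrite supp_normalize; last exact: rest_sum_gt0.
apply/fintype.subsetP => i; rewrite inE => h; apply: amax_low_in.
rewrite leNgt; apply: contraNN h => h; rewrite 3!mxE; apply/eqP.
by rewrite (min_idPl (ltW h)) subrr.
Qed.

End At.

Lemma low0 x : simplex x -> low 0 x = x.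
Proof.
move=> xs; rewrite /low (_ : cut 0 x = x) ?normalize_id//; apply/rowP => i.
by rewrite mxE subr0 mul1r; apply/min_idPl; exact: coord_le_norm.
Qed.

Lemma ct_cut (X : topologicalType) (th : X -> R) (f : X -> 'rV[R]_n) : continuous th ->
  continuous f -> continuous (fun z => cut (th z) (f z)).
Proof.
move=> ct cf; apply: ct_row => i; apply: ct_min; first by cts.
by cts.
Qed.

Lemma ct_low (X : topologicalType) (th : X -> R) (f : X -> 'rV[R]_n) : continuous th ->
  continuous f -> (forall z, simplex (f z)) -> (forall z, 0 <= th z) ->
  (forall z, th z <= 1 / 2) -> continuous (fun z => low (th z) (f z)).
Proof.
move=> ct cf fs t0 t1; apply: ct_normalize; first exact: ct_cut.
by move=> z; rewrite gt_eqF// (cut_sum_gt0 (fs z)).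
Qed.

Lemma ct_top th (X : topologicalType) (f : X -> 'rV[R]_n) : 0 < th -> th <= 1 / 2 ->
  continuous f -> (forall z, simplex (f z)) -> continuous (fun z => top th (f z)).
Proof.
move=> t0 t1 cf fs; apply: ct_normalize.
  by apply: ct_vadd => //; apply: ct_vopp; apply: ct_cut => //; exact: ct_cst.
by move=> z; apply: lt0r_neq0; apply: rest_sum_gt0 => //; exact: ltW.
Qed.

End Truncation.

(** * The total space *)

Section TotalSpace.
Context {R : realType} {n : nat} (K : simplicial_complex n).
Variables (B : topologicalType) (e : B -> 'rV[R]_n) (s : 'rV[R]_n -> B).
Hypotheses (ce : continuous e) (eK : forall b, polyhedron K (e b))
  (cs : {within polyhedron K, continuous s}) (se : forall b, s (e b) = b).

Local Notation J := {set 'I_n}.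

Lemma simplex_e b : simplex (e b).
Proof. by have [x0 x1 _] := eK b. Qed.

Let e_norm_gt0 b : 0 < `|e b|.
Proof. by have [x0 x1] := simplex_e b; have [|i] := norm_attained x0; rewrite ?x1. Qed.

(** The conditions on [sg] and [rh] are part of the set, so that all pairs can serve as indices and
    the irrelevant ones give the empty set. *)
Definition cell (sg rh : J) : set B :=
  [set b | [/\ sg != finset.set0, rh \in faces K, sg \subset amax (e b)
             & supp (e b) \subset rh]].

(** A cubical chart: after division by the largest coordinate, a point of a cell is 1 on [sg], free
    in [0, 1] on the rest of [rh], and 0 elsewhere. *)
Definition fill (sg rh : J) (c : 'rV[R]_n) : 'rV[R]_n :=
  \row_i (if i \in sg then 1 else if i \in rh then clamp (c ord0 i) else 0).

Section Cell.
Variables (sg rh : J).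
Hypotheses (sg0 : sg != finset.set0) (sgrh : sg \subset rh) (rhK : rh \in faces K).

Let fill_bd c i : 0 <= fill sg rh c ord0 i <= 1.
Proof. by rewrite mxE; do 2?case: ifP => _; rewrite ?lexx ?ler01// clamp_ge0 clamp_le1. Qed.

Let fill_ge0 c i : 0 <= fill sg rh c ord0 i. Proof. by have /andP[] := fill_bd c i. Qed.

Let fill_le1 c i : fill sg rh c ord0 i <= 1. Proof. by have /andP[] := fill_bd c i. Qed.

Let fill_sum c : 0 < \sum_(i < n) fill sg rh c ord0 i.
Proof.
have /set0Pn[i isg] := sg0; rewrite (bigD1 i)//= ltr_pwDl//.
  by rewrite mxE isg ltr01.
by apply: sumr_ge0 => j _; exact: fill_ge0.
Qed.

Let supp_fill c : supp (normalize (fill sg rh c)) \subset rh.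
Proof.
rewrite supp_normalize//; apply/fintype.subsetP => i; rewrite inE mxE.
case: ifP => [isg _|_]; first exact: (fintype.subsetP sgrh).
by case: ifP => //; rewrite eqxx.
Qed.

Let amax_fill c : sg \subset amax (normalize (fill sg rh c)).
Proof.
rewrite amax_normalize//; apply/fintype.subsetP => i isg; rewrite inE.
have fi : fill sg rh c ord0 i = 1 by rewrite mxE isg.
by rewrite fi (norm_eq_coord (fill_ge0 c) (fill_le1 c) fi).
Qed.

Let fillK c : polyhedron K (normalize (fill sg rh c)).
Proof.
have [x0 x1] := normalize_simplex (fill_ge0 c) (fill_sum c).
exact: polyhedron_face x0 x1 (supp_fill c) rhK.
Qed.

Definition cell_param (c : 'rV[R]_n) : B := s (normalize (fill sg rh c)).

Lemma ct_cell_param : continuous cell_param.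
Proof.
apply: (ct_within (f := fun c => normalize (fill sg rh c)) _ fillK cs).
apply: ct_normalize => [|c]; last by rewrite lt0r_neq0.
apply: ct_row => i; case: (i \in sg); first by cts.
by case: (i \in rh); [apply: ct_clamp; cts|cts].
Qed.

Hypothesis es : forall x, polyhedron K x -> e (s x) = x.

Lemma cell_param_in c : cell sg rh (cell_param c).
Proof. by split => //; rewrite /cell_param es. Qed.

Lemma cell_paramK b : cell sg rh b -> cell_param (`|e b|^-1 *: e b) = b.
Proof.
move=> [_ _ /fintype.subsetP amb /fintype.subsetP sub].
rewrite /cell_param (_ : fill sg rh _ = `|e b|^-1 *: e b).
  have [b0 b1] := simplex_e b; have bp := e_norm_gt0 b.
  rewrite /normalize; under eq_bigr do rewrite mxE.
  by rewrite -mulr_sumr b1 mulr1 invrK scalerA divff ?scale1r// gt_eqF.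
have bp := e_norm_gt0 b; have [b0 _] := simplex_e b.
apply/rowP => i; rewrite !mxE; case: ifP => [isg|_].
  by have := amb _ isg; rewrite inE => /eqP ->; rewrite mulVf// gt_eqF.
case: ifP => [_|irh].
  rewrite clamp_id//; first by rewrite mulr_ge0// invr_ge0 ltW.
  by rewrite mulrC ler_pdivrMr// mul1r coord_le_norm.
have : i \notin supp (e b) by apply: contraFN irh => /sub.
by rewrite inE negbK => /eqP ->; rewrite mulr0.
Qed.

End Cell.

Hypothesis es : forall x, polyhedron K x -> e (s x) = x.

Lemma cell_sub sg rh b : cell sg rh b -> sg \subset rh.
Proof.
move=> [_ _ h1 h2]; apply: fintype.subset_trans h2.
by apply: fintype.subset_trans h1 _; apply: amax_supp; exact: simplex_e.
Qed.

Lemma ANE_cell sg rh : ANE R (cell sg rh).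
Proof.
have [[b0 cb0]|noc] := pselect (exists b, cell sg rh b); last first.
  rewrite (_ : cell sg rh = set0); first exact: ANE_set0.
  by apply/seteqP; split => // b cb; case: noc; exists b.
have sr := cell_sub cb0; have [s0 rK _ _] := cb0.
apply: (@ANE_nbhd_retract R B (cell sg rh) n 1 setT (fun b => `|e b|^-1 *: e b)
  (cell_param sg rh)) => //.
- apply: continuous_subspaceT; apply: ct_scale => //.
  by apply: ct_inv => [|b]; [exact: ct_vnorm|rewrite gt_eqF].
- exact: openT.
- by apply: continuous_subspaceT; exact: ct_cell_param.
- by move=> c _; exact: cell_param_in.
- by move=> b cb; exact: cell_paramK cb.
- move=> b j _; rewrite mxE normrM normfV normr_id mulrC ler_pdivrMr// mul1r.
  by have [b0' _] := simplex_e b; rewrite ger0_norm// coord_le_norm.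
Qed.

Lemma closed_cell sg rh : closed (cell sg rh).
Proof.
have [s0|s0] := boolP (sg != finset.set0); last first.
  rewrite (_ : cell sg rh = set0); first exact: closed0.
  by apply/seteqP; split => // b [] /(negP s0).
have [rK|rK] := boolP (rh \in faces K); last first.
  rewrite (_ : cell sg rh = set0); first exact: closed0.
  by apply/seteqP; split => // b [_] /(negP rK).
rewrite (_ : cell sg rh = \bigcap_(i in [set i | i \in sg]) [set b | `|e b| <= e b ord0 i]
   `&` \bigcap_(i in [set i | i \notin rh]) [set b | `|e b ord0 i| <= 0]).
  apply: closedI; apply: closed_bigI => i _; apply: closed_leF; try by cts.
apply/seteqP; split => b.
- move=> [_ _ /fintype.subsetP h1 /fintype.subsetP h2]; split => i /= hi.
    by have := h1 _ hi; rewrite inE => /eqP ->.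
  have : i \notin supp (e b) by apply: contraNN hi => /h2.
  by rewrite inE negbK normr_le0.
- move=> [h1 h2]; split => //; apply/fintype.subsetP => i.
    by move=> /h1 /= hi; rewrite inE eq_le coord_le_norm.
  rewrite inE; apply: contraR => /h2 /=; by rewrite normr_le0.
Qed.

(** [B] is a finite union of images of cubes under the charts of the cells. *)
Lemma compact_base : compact [set: B].
Proof.
pose F (i : J * J) : set B := [set b | [/\ i.1 != finset.set0, i.1 \subset i.2,
  i.2 \in faces K & exists2 c : 'rV[R]_n, (forall j, 0 <= c ord0 j <= 1)
    & cell_param i.1 i.2 c = b]].
rewrite (_ : setT = [set b | exists2 i, i \in enum {: J * J} & F i b]).
  apply: compact_bigcup_seq => i.
  have [/and3P[i0 i12 iK]|ni] := boolP [&& i.1 != finset.set0, i.1 \subset i.2 &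
    i.2 \in faces K]; last first.
    rewrite (_ : F i = set0); first exact: compact0.
    by apply/seteqP; split => // b [i0 i12 iK _]; move: ni; rewrite i0 i12 iK.
  rewrite (_ : F i = cell_param i.1 i.2 @` [set c : 'rV[R]_n | forall j, 0 <= c ord0 j <= 1]).
    apply: compact_image; first exact: ct_cell_param.
    pose I := [set t : R | 0 <= t <= 1].
    have cI : compact I by exact: compact_interval.
    exact: (@rV_compact R n (fun=> I) (fun=> cI)).
  apply/seteqP; split => b; first by move=> [_ _ _ [c c1 <-]]; exists c.
  by move=> [c c1 <-]; split => //; exists c.
apply/seteqP; split => // b _; exists (amax (e b), supp (e b)); first by rewrite mem_enum.
have sb := simplex_e b; have [_ _ bK] := eK b.
have cb : cell (amax (e b)) (supp (e b)) b by split => //; exact: amax_neq0.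
split => //=; [exact: amax_neq0|exact: amax_supp|].
have bp := e_norm_gt0 b; have [b0 _] := sb.
exists (`|e b|^-1 *: e b) => [j|]; last exact: cell_paramK cb.
rewrite mxE mulrC; apply/andP; split; first by rewrite mulr_ge0// invr_ge0 ltW.
by rewrite ler_pdivrMr// mul1r coord_le_norm.
Qed.

Lemma embeddable_base : embeddable R B.
Proof. by exists n, e; split => // b b' /(congr1 s); rewrite !se. Qed.

Variable G : fsp J.
Hypotheses (hG : cANE R G) (cG : forall t, compact (@fset _ G t))
  (aG : forall t, ANE R (@fset _ G t)) (lG : lattice_filtered G).

(* The fibre of [spread_total] over [b] is the filtration step of [G] at the set of
   maximal coordinates of [b], which is upper semicontinuous in [b]. *)
Definition spread_total : set (G * B) := [set w | @fset _ G (amax (e w.2)) w.1].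

Let piece (i : J * (J * J)) : set (G * B) := @fset _ G i.1 `*` cell i.2.1 i.2.2.

Let pieceI i j : exists k, piece i `&` piece j = piece k.
Proof.
have [Gi Gm _ _] := lG.
have [[w0 [[_ [s0 rK _ _]] [_ [s0' rK' _ _]]]]|no] := pselect (exists w, (piece i `&` piece j) w);
    last first.
  (* A cell with empty [sg] is empty, so this index represents the empty intersection. *)
  exists (finset.set0, (finset.set0, finset.set0)); apply/seteqP; split => w.
  - by move=> ijw; case: no; exists w.
  - by move=> [_ [/=]]; rewrite eqxx.
exists (i.1 :&: j.1, (i.2.1 :|: j.2.1, i.2.2 :&: j.2.2)).
apply/seteqP; split => -[g b] /=.
- move=> [[/= gi [_ _ h1 h2]] [/= gj [_ _ h1' h2']]]; split; first exact: Gi.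
  have [x0 x1 _] := eK b; split => /=.
  + by apply: contraNneq s0 => h; rewrite -finset.subset0 -h finset.subsetUl.
  + apply: (faces_sub rK); first exact: finset.subsetIl.
    apply: contraNneq (supp_neq0 x1) => h.
    by rewrite -finset.subset0 -h finset.subsetI h2.
  + by rewrite finset.subUset h1.
  + by rewrite finset.subsetI h2.
- move=> [/= gij [_ _]]; rewrite finset.subUset finset.subsetI.
  move=> /andP[h1 h1'] /andP[h2 h2']; split; split => //=.
  + by apply: Gm gij; exact: finset.subsetIl.
  + by apply: Gm gij; exact: finset.subsetIr.
Qed.

Let pieceJ i (l : seq (J * (J * J))) :
  exists k, piece i `&` [set w | forall j, j \in l -> piece j w] = piece k.
Proof.
elim: l i => [|j l ih] i.
  by exists i; apply/seteqP; split => w; [move=> []|split].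
have [k hk] := pieceI i j; have [k' hk'] := ih k; exists k'; rewrite -hk' -hk.
apply/seteqP; split => w.
- move=> [wi wl]; split; first by split => //; apply: wl; rewrite inE eqxx.
  by move=> j' j'l; apply: wl; rewrite inE j'l orbT.
- move=> [[wi wj] wl]; split => // j'; rewrite inE => /orP[/eqP -> //|]; exact: wl.
Qed.

Let pieces : seq (J * (J * J)) :=
  seq.filter (fun i : J * (J * J) => i.1 \subset i.2.1) (enum {: J * (J * J)}).

Let spread_pieces : spread_total = [set w | exists2 i, i \in pieces & piece i w].
Proof.
have [_ Gm _ _] := lG.
apply/seteqP; split => -[g b] /=.
- move=> gb; exists (amax (e b), (amax (e b), supp (e b))).
    by rewrite mem_filter mem_enum /= andbT.
  have [_ _ bK] := eK b; split => //; split => //; apply: amax_neq0; exact: simplex_e.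
- move=> [[t [sg rh]]]; rewrite mem_filter /= => /andP[tsg _] [/= gt [_ _ h1 _]].
  by apply: Gm gt; exact: fintype.subset_trans h1.
Qed.

Let closed_piece i : closed (piece i).
Proof.
have [_ eG _] := hG.
have clG : closed (@fset _ G i.1) by apply: compact_closed => //; exact: embeddable_hausdorff eG.
rewrite (_ : piece i = fst @^-1` (@fset _ G i.1) `&` snd @^-1` (cell i.2.1 i.2.2)).
  apply: closedI.
  - apply: (closed_comp _ clG); exact: in1W (ct_fst (f := fun w : G * B => w) (@ct_id _)).
  - apply: (closed_comp _ (@closed_cell _ _)).
    exact: in1W (ct_snd (f := fun w : G * B => w) (@ct_id _)).
by apply/seteqP; split => w.
Qed.

Lemma cANE_spread_total : cANE R (set_type spread_total).
Proof.
have [kG eG _] := hG; have clt : closed spread_total.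
  rewrite spread_pieces (_ : [set _ | _] = \bigcup_(i in [set` pieces]) piece i).
    by apply: closed_bigcup => [|i _]; [exact: finite_seq|exact: closed_piece].
  by apply/seteqP; split => w [i il iw]; exists i.
split.
- apply: compact_set_type; apply: (@subclosed_compact _ _ (setT `*` setT)) => //.
  by apply: compact_setX => //; exact: compact_base.
- apply: (embeddable_inj (f := set_val)); [exact: ct_val|exact: set_val_inj|].
  by apply: embeddable_prod => //; exact: embeddable_base.
- apply: (proj1 (ANE_set_type _)); rewrite spread_pieces.
  apply: ANE_bigcup_seq => [|i l]; first exact: closed_piece.
  have [k ->] := pieceJ i l; apply: ANE_setX => //; exact: ANE_cell.
Qed.

End TotalSpace.

(** * Comparison of the total space with the path space *)

Section Spread.
Context {R : realType} {n : nat} (K : simplicial_complex n).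
Variables (M B : topologicalType) (p : M -> B) (e : B -> 'rV[R]_n) (s : 'rV[R]_n -> B).
Hypotheses (ce : continuous e) (eK : forall b, polyhedron K (e b))
  (cs : {within polyhedron K, continuous s}) (se : forall b, s (e b) = b)
  (es : forall x, polyhedron K x -> e (s x) = x).

Local Notation paths := (@paths R M B p).
Local Notation J := {set 'I_n}.

Variable tr : paths * 'rV[R]_n -> paths.
Hypotheses (ctr : {within extendable K e, continuous tr})
  (etr : forall w, extendable K e w -> e (pend (tr w)) = w.2)
  (trid : forall z, tr (z, e (pend z)) = z).

Variables (G : fsp J) (phi : G -> paths) (psi : paths -> G)
  (HG : G * R -> G) (HP : paths * R -> paths).
Hypotheses (lG : lattice_filtered G)
  (cphi : continuous phi) (cpsi : continuous psi) (cHG : continuous HG) (cHP : continuous HP)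
  (phiF : forall (t : J) (g : G), fset t g -> supp (e (pend (phi g))) \subset t)
  (psiF : forall (t : J) z, supp (e (pend z)) \subset t -> @fset _ G t (psi z))
  (HG0 : forall g, HG (g, 0) = psi (phi g)) (HG1 : forall g, HG (g, 1) = g)
  (HGF : forall (t : J) (g : G) a, fset t g -> @fset _ G t (HG (g, a)))
  (HP0 : forall z, HP (z, 0) = phi (psi z)) (HP1 : forall z, HP (z, 1) = z)
  (HPF : forall z a, supp (e (pend (HP (z, a)))) \subset supp (e (pend z))).

Local Notation E := (set_type (spread_total e (G := G))).

Let ct_tr (X : topologicalType) (f : X -> paths) (y : X -> 'rV[R]_n) : continuous f ->
  continuous y -> (forall x, extendable K e (f x, y x)) -> continuous (fun x => tr (f x, y x)).
Proof.
move=> cf cy h; apply: (ct_within (f := fun x => (f x, y x)) _ h ctr).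
exact: ct_pair.
Qed.

Let ct_s (X : topologicalType) (f : X -> 'rV[R]_n) : continuous f ->
  (forall x, polyhedron K (f x)) -> continuous (fun x => s (f x)).
Proof. by move=> cf h; exact: (ct_within cf h cs). Qed.

Let supp_K b : supp (e b) \in faces K. Proof. by case: (eK b). Qed.

Lemma polyhedron_low th b : 0 <= th -> th <= 1 / 2 -> polyhedron K (low th (e b)).
Proof.
move=> th0 th1; have sb := simplex_e eK b; have [x0 x1] := low_simplex sb th0 th1.
exact: polyhedron_face x0 x1 (supp_low sb th0 th1) (supp_K b).
Qed.

Lemma ct_s_low (X : topologicalType) (th : X -> R) (b : X -> B) : continuous th ->
  continuous b -> (forall x, 0 <= th x) -> (forall x, th x <= 1 / 2) ->
  continuous (fun x => s (low (th x) (e (b x)))).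
Proof.
move=> cth cb th0 th1; apply: ct_s => [|x]; last exact: polyhedron_low.
by apply: ct_low => // [|x]; [exact: ct_comp|exact: (simplex_e eK)].
Qed.

Variable th : R.
Hypotheses (thp : 0 < th) (th1 : th <= 1 / 2).
Let th0 : 0 <= th. Proof. exact: ltW. Qed.

Let on_e b (F : J) : supp (e b) \subset F -> on_simplex F (e b).
Proof. by move=> bF; have [x0 x1 _] := eK b. Qed.

Let on_low b (F : J) : supp (e b) \subset F -> on_simplex F (low th (e b)).
Proof.
move=> bF; have sb := simplex_e eK b; have [x0 x1] := low_simplex sb th0 th1; split => //.
by apply: fintype.subset_trans bF; exact: supp_low.
Qed.

Let on_top b (F : J) : supp (e b) \subset F -> on_simplex F (top th (e b)).
Proof.
move=> bF; have sb := simplex_e eK b; have [x0 x1] := top_simplex sb th0 thp; split => //.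
by apply: fintype.subset_trans bF; exact: supp_top.
Qed.

Let ct_e_pend : continuous (fun z : paths => e (pend z)).
Proof. by apply: (ct_comp ce); exact: ct_pend. Qed.

Let ct_top_e (X : topologicalType) (b : X -> B) : continuous b ->
  continuous (fun x => top th (e (b x))).
Proof. by move=> cb; apply: ct_top => // [|x]; [exact: ct_comp|exact: (simplex_e eK)]. Qed.

Let ct_low_e (X : topologicalType) (b : X -> B) : continuous b ->
  continuous (fun x => low th (e (b x))).
Proof.
move=> cb; apply: ct_low => //; [exact: ct_cst|exact: ct_comp|].
by move=> x; exact: (simplex_e eK).
Qed.

Let x_ (w : E) : 'rV[R]_n := e (set_val w).2.

Let phi_amax (w : E) : supp (e (pend (phi (set_val w).1))) \subset amax (x_ w).
Proof. by apply: phiF; exact: (set_valP' w). Qed.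

Let phi_supp (w : E) : supp (e (pend (phi (set_val w).1))) \subset supp (x_ w).
Proof. by apply: fintype.subset_trans (phi_amax w) _; apply: amax_supp; exact: (simplex_e eK). Qed.

Let ext_u w : extendable K e (phi (set_val w).1, x_ w).
Proof. by apply: (extendable_in eK (supp_K _) (phi_supp w)); exact: on_e. Qed.

(** [phi] gives a path ending in the face of the maximal coordinates of the base point; transport
    inside its carrier brings the end to that point exactly. *)
Definition unspread (w : E) : paths := tr (phi (set_val w).1, e (set_val w).2).

Lemma pend_unspread w : pend (unspread w) = (set_val w).2.
Proof. by rewrite -[LHS]se etr// se. Qed.

Let ct_val1 : continuous (fun w : E => (set_val w).1).
Proof. by apply: (ct_fst (f := set_val)); exact: ct_val. Qed.

Let ct_val2 : continuous (fun w : E => (set_val w).2).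
Proof. by apply: (ct_snd (f := set_val)); exact: ct_val. Qed.

Lemma ct_unspread : continuous unspread.
Proof. exact: (ct_tr (ct_comp cphi ct_val1) (ct_comp ce ct_val2) ext_u). Qed.

Let ext_top (z : paths) : extendable K e (z, top th (e (pend z))).
Proof. by apply: (extendable_in eK (supp_K (pend z))) => //; exact: on_top. Qed.

Let spread_in (z : paths) : spread_total e (psi (tr (z, top th (e (pend z)))), s (low th (e (pend z)))).
Proof.
rewrite /spread_total /= es; last exact: polyhedron_low.
by apply: psiF; rewrite etr//; apply: top_amax_low => //; exact: (simplex_e eK).
Qed.

(** The path is transported to [top] before [psi] is applied: its carrier then lies in the set of
    maximal coordinates of [low], which is the step required over the new base point. *)
Definition spread (z : paths) : E := mksub (spread_in z).

Lemma spreadE z : set_val (spread z) = (psi (tr (z, top th (e (pend z)))), s (low th (e (pend z)))).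
Proof. exact: mksubK. Qed.

Lemma ct_spread : continuous spread.
Proof.
have c1 := @ct_pend R M B p.
apply: (ct_mksub spread_in); apply: ct_pair; last by apply: ct_s_low => //; exact: ct_cst.
by apply: (ct_comp cpsi); apply: ct_tr => //; [exact: ct_id|exact: ct_top_e].
Qed.

Let shrink (t : R) : 0 <= t -> t <= 1 -> 0 <= (1 - t) * th /\ (1 - t) * th <= th.
Proof. by move: th0 => h t0 t1; split; nra. Qed.

Let conv_tr (w : paths) (F : J) (x y : 'rV[R]_n) c : F \in faces K ->
  supp (e (pend w)) \subset F -> on_simplex F x -> on_simplex F y -> 0 <= c -> c <= 1 ->
  extendable K e (w, x + c *: (y - x)).
Proof. by move=> FK wF xF yF c0 c1; apply: (extendable_in eK FK wF); exact: on_simplex_conv. Qed.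

(** [HP] undoes [psi] and [phi] on the path transported to [top], without enlarging the carrier, so
    transport to [low] stays possible throughout. Then both targets move along segments to the true
    end, where transport is trivial by regularity. *)
Lemma unspreadK : @fhom R unit (plain paths) (plain paths)
  (fun z => unspread (spread z)) (fun z => z).
Proof.
have c1 := @ct_pend R M B p.
pose b z := pend z; pose T z := tr (z, top th (e (pend z))).
have suppT z : supp (e (pend (T z))) \subset supp (e (pend z)).
  by rewrite etr//; apply: supp_top => //; exact: (simplex_e eK).
have cT : continuous T by apply: ct_tr => //; [exact: ct_id|exact: ct_top_e].
have extA (za : paths * R) : extendable K e (HP (T za.1, za.2), low th (e (pend za.1))).
  apply: (extendable_in eK (supp_K (pend za.1))); last exact: on_low.
  by apply: fintype.subset_trans (HPF _ _) _.
apply: (@fhom_trans _ _ (plain paths) (plain paths) _ (fun z => tr (T z, low th (e (pend z))))).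
  apply: (@fhomI _ _ (plain paths) (plain paths) _ _
    (fun za => tr (HP (T za.1, za.2), low th (e (pend za.1))))) => //=.
  - apply: ct_tr => //.
      by apply: (ct_comp cHP); apply: ct_pair; [apply: (ct_comp cT)|]; cts.
    by apply: ct_low_e; apply: (ct_comp c1); cts.
  - by move=> z; rewrite HP0 /unspread spreadE /= es; last exact: polyhedron_low.
  - by move=> z; rewrite HP1.
pose y (za : paths * R) := top th (e (pend za.1)) + clamp za.2 *:
  (e (pend za.1) - top th (e (pend za.1))).
pose x (za : paths * R) := low th (e (pend za.1)) + clamp za.2 *:
  (e (pend za.1) - low th (e (pend za.1))).
have ext1 za : extendable K e (za.1, y za).
  apply: (conv_tr (supp_K (pend za.1))) => //; rewrite ?clamp_ge0 ?clamp_le1//.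
  - exact: on_top.
  - exact: on_e.
have ext2 za : extendable K e (tr (za.1, y za), x za).
  apply: (conv_tr (supp_K (pend za.1))) => //; rewrite ?clamp_ge0 ?clamp_le1//.
  - rewrite etr//=; have [_ _] : on_simplex (supp (e (pend za.1))) (y za); last by [].
    apply: on_simplex_conv; rewrite ?clamp_ge0 ?clamp_le1//; [exact: on_top|exact: on_e].
  - exact: on_low.
  - exact: on_e.
have cp1 : continuous (fun za : paths * R => pend za.1) by apply: (ct_comp c1); cts.
have ce1 : continuous (fun za : paths * R => e (pend za.1)) by exact: (ct_comp ce).
have ct1 := ct_top_e cp1; have cl1 := ct_low_e cp1.
apply: (@fhomI _ _ (plain paths) (plain paths) _ _
    (fun za => tr (tr (za.1, y za), x za))) => //=.
- have cy : continuous y by rewrite /y; cts.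
  have cx : continuous x by rewrite /x; cts.
  by apply: ct_tr => //; apply: ct_tr => //; cts.
- by move=> z; rewrite /x /y /= clamp_le0// !scale0r !addr0.
- move=> z; rewrite /x /y /= clamp_ge1// !scale1r ![_ + (e _ - _)]addrC !subrK.
  by rewrite trid trid.
Qed.

Let near (w w' : E) : Prop := exists a, [/\ 0 <= a, a <= th &
  (set_val w').2 = s (low a (e (set_val w).2))].

Let amax_shrink (w : E) a (g : G) : 0 <= a -> a <= th -> @fset _ G (amax (x_ w)) g ->
  spread_total e (g, s (low a (x_ w))).
Proof.
move=> a0 a1 gw; have a2 : a <= 1 / 2 by exact: le_trans a1 th1.
rewrite /spread_total /= es; last exact: polyhedron_low.
have [_ Gm _ _] := lG; apply: Gm gw; apply: amax_low => //; exact: (simplex_e eK).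
Qed.

(** Over the fixed point [low] both transports are contracted to the end of the path given by [phi],
    and [HG] is run. Only the last stage, in which the threshold drops to 0, moves the point of
    [B]. *)
Lemma spreadK : exists H : E * R -> E, [/\ continuous H,
  forall w t, t <= 0 -> H (w, t) = spread (unspread w), forall w t, 1 <= t -> H (w, t) = w
  & forall w t, exists a, [/\ 0 <= a, a <= th & (set_val (H (w, t))).2 = s (low a (e (set_val w).2))]].
Proof.
(* Points serve as indices: a filtered homotopy from [S] to [T] moves each [w] only over truncations
   of its base point, and [fhom_trans] concatenates such homotopies with the control intact. *)
pose S := @Fsp E E (fun w => [set w]); pose T := @Fsp E E near.
pose g1 (w : E) := (set_val w).1; pose b1 (w : E) := (set_val w).2.
have lowin w : spread_total e (g1 w, s (low th (x_ w))).
  by apply: amax_shrink => //; exact: (set_valP' w).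
pose lowE w : E := mksub (lowin w).
have phiin w : spread_total e (psi (phi (g1 w)), s (low th (x_ w))).
  by apply: amax_shrink => //; apply: psiF; apply: phi_amax.
pose phiE w : E := mksub (phiin w).
have cg1 : continuous (fun za : E * R => g1 za.1) by apply: (ct_comp ct_val1); cts.
have cb1 : continuous (fun za : E * R => b1 za.1) by apply: (ct_comp ct_val2); cts.
have cx : continuous (fun za : E * R => x_ za.1) by exact: (ct_comp ce).
have cslow : continuous (fun za : E * R => s (low th (x_ za.1))).
  by apply: ct_s_low => //; exact: ct_cst.
suff [H [cH H0 H1 HJ]] : @fhom R E S T (fun w => spread (unspread w)) (fun w => w).
  by exists H; split => // w t; apply: HJ.
apply: (@fhom_trans _ _ S T _ phiE); [|apply: (@fhom_trans _ _ S T _ lowE)].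
- have eu w : e (pend (unspread w)) = x_ w by rewrite pend_unspread.
  pose x0 (za : E * R) := e (pend (phi (g1 za.1))).
  have cx0 : continuous x0.
    by apply: (ct_comp ct_e_pend); exact: (ct_comp cphi).
  pose x (za : E * R) := x_ za.1 + clamp za.2 *: (x0 za - x_ za.1).
  pose y (za : E * R) := top th (x_ za.1) + clamp za.2 *: (x0 za - top th (x_ za.1)).
  have cy : continuous y by have := ct_top_e cb1 => c; rewrite /y; cts.
  have cX : continuous x by rewrite /x; cts.
  have on0 (za : E * R) : on_simplex (supp (x_ za.1)) (x0 za) by apply: on_e; exact: phi_supp.
  have ext1 (za : E * R) : extendable K e (phi (g1 za.1), x za).
    apply: (conv_tr (supp_K (b1 za.1))) => //; rewrite ?clamp_ge0 ?clamp_le1//.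
    - exact: phi_supp.
    - exact: on_e.
    - exact: on0.
  have ext2 : forall q : E * R, extendable K e (tr (phi (g1 q.1), x q), y q).
    move=> q; apply: (conv_tr (supp_K (b1 q.1))) => //; rewrite ?clamp_ge0 ?clamp_le1//.
    - rewrite etr//=; have [_ _] : on_simplex (supp (x_ q.1)) (x q); last exact.
      by apply: on_simplex_conv; rewrite ?clamp_ge0 ?clamp_le1//; exact: on_e.
    - exact: on_top.
    - exact: on0.
  have Hin (za : E * R) : spread_total e (psi (tr (tr (phi (g1 za.1), x za), y za)), s (low th (x_ za.1))).
    rewrite /spread_total /= es; last exact: polyhedron_low.
    apply: psiF; rewrite etr//=; apply: fintype.subset_trans (supp_conv _ _ _) _.
    rewrite finset.subUset top_amax_low//=; last exact: (simplex_e eK).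
    apply: fintype.subset_trans (phi_amax _) _; apply: amax_low => //; exact: (simplex_e eK).
  apply: (@fhomI _ _ S T _ _ (fun za => mksub (Hin za))).
  + apply: (ct_mksub Hin); apply: ct_pair => //; apply: (ct_comp cpsi).
    apply: ct_tr => //; apply: ct_tr => //; exact: (ct_comp cphi).
  + move=> w; apply: set_val_inj; rewrite mksubK spreadE eu.
    by rewrite /x /y /= clamp_le0// !scale0r !addr0.
  + move=> w; apply: set_val_inj; rewrite !mksubK.
    rewrite /x /y /= clamp_ge1// !scale1r ![_ + (x0 _ - _)]addrC !subrK.
    by rewrite /x0 /= trid trid.
  + by move=> w w' t t0 t1 /= ->; exists th; rewrite mksubK; split.
- have Hin (za : E * R) : spread_total e (HG (g1 za.1, za.2), s (low th (x_ za.1))).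
    by apply: amax_shrink => //; apply: HGF; exact: (set_valP' za.1).
  apply: (@fhomI _ _ S T _ _ (fun za => mksub (Hin za))).
  + by apply: (ct_mksub Hin); apply: ct_pair => //; apply: (ct_comp cHG); cts.
  + by move=> w; apply: set_val_inj; rewrite !mksubK /= HG0.
  + by move=> w; apply: set_val_inj; rewrite !mksubK /= HG1.
  + by move=> w w' t t0 t1 /= ->; exists th; rewrite mksubK; split.
- have sh (t : R) := shrink (clamp_ge0 t) (clamp_le1 t).
  have Hin (za : E * R) : spread_total e (g1 za.1, s (low ((1 - clamp za.2) * th) (x_ za.1))).
    by have [h1 h2] := sh za.2; apply: amax_shrink => //; exact: (set_valP' za.1).
  apply: (@fhomI _ _ S T _ _ (fun za => mksub (Hin za))).
  + apply: (ct_mksub Hin); apply: ct_pair => //; apply: ct_s_low => //; first by cts.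
    * by move=> za; have [] := sh za.2.
    * by move=> za; have [_ h] := sh za.2; exact: le_trans th1.
  + by move=> w; apply: set_val_inj; rewrite !mksubK /= clamp_le0// subr0 mul1r.
  + move=> w; apply: set_val_inj; rewrite !mksubK /= clamp_ge1// subrr mul0r low0 ?se//.
      by rewrite -surjective_pairing.
    exact: (simplex_e eK).
  + move=> w w' t t0 t1 /= ->; exists ((1 - clamp t) * th); rewrite mksubK.
    by have [] := sh t; split.
Qed.

End Spread.

(** * Approximate lifting *)

Section Metric.
Context {R : realType}.

Lemma mdistC (B : metricType R) (b b' : B) : mdist b b' = mdist b' b.
Proof. exact: metric_sym. Qed.

Lemma ct_mdist (X : topologicalType) (B : metricType R) (f g : X -> B) :
  continuous f -> continuous g -> continuous (fun x => mdist (f x) (g x)).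
Proof.
move=> cf cg x; apply/(@cvgrPdist_lt _ _ _ (nbhs x)) => eps eps0.
have e2 : 0 < eps / 2 by rewrite divr_gt0.
have near_ (k : X -> B) : continuous k -> \forall y \near x, mdist (k x) (k y) < eps / 2.
  move=> ck; near=> y; have : ball (k x) (eps / 2) (k y).
    by near: y; exact: (ck x _ (nbhsx_ballx (k x) _ e2)).
  by rewrite ballEmdist.
have hf := near_ _ cf; have hg := near_ _ cg.
near=> y.
have dfy : mdist (f x) (f y) < eps / 2 by near: y.
have dgy : mdist (g x) (g y) < eps / 2 by near: y.
have t1 := metric_triangle (f x) (f y) (g x); have t2 := metric_triangle (f y) (g y) (g x).
have t3 := metric_triangle (f y) (f x) (g y); have t4 := metric_triangle (f x) (g x) (g y).
rewrite ltr_norml; move: t1 t2 t3 t4; rewrite (mdistC (f y) (f x)) (mdistC (g y) (g x)) => *.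
by apply/andP; split; lra.
Unshelve. all: by end_near. Qed.

(** The tube lemma, as uniformity over a compact factor. *)
Lemma near_compact (X T : topologicalType) (F : X * T -> R) (x : X) eps :
  compact [set: T] -> continuous F -> 0 < eps ->
  \forall y \near x, forall t, `|F (y, t) - F (x, t)| < eps.
Proof.
move=> /compact_near_coveringP cT cF eps0.
have := cT X (nbhs x) (fun y t => `|F (y, t) - F (x, t)| < eps) _.
move=> h; suff : \forall y \near x, [set: T] `<=` (fun t => `|F (y, t) - F (x, t)| < eps).
  by apply: filterS => y hy t; exact: hy.
apply: h => t _.
pose D (w : T * X) := `|F (w.2, w.1) - F (x, w.1)|.
have cD : continuous D.
  have c1 : continuous (fun w : T * X => F (w.2, w.1)) by apply: (ct_comp cF); cts.
  have c2 : continuous (fun w : T * X => F (x, w.1)) by apply: (ct_comp cF); cts.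
  by rewrite /D; cts.
have D0 : D (t, x) < eps by rewrite /D /= subrr normr0.
exact: (cD (t, x) _ (lt_nbhsl D0)).
Qed.

Lemma ct_sup (X T : topologicalType) (F : X * T -> R) : compact [set: T] -> T ->
  continuous F -> continuous (fun x => sup (range (fun t => F (x, t)))).
Proof.
move=> cT t0 cF x.
have hs y : has_sup (range (fun t => F (y, t))).
  split; first by exists (F (y, t0)); exists t0.
  have : compact (range (fun t => F (y, t))).
    by apply: compact_image => //; apply: (@ct_comp T _ R F (fun t => (y, t)) cF); cts.
  move=> /compact_bounded[m [_ hm]]; exists (m + 1) => r hr.
  by apply: le_trans (ler_norm _) _; apply: hm => //; rewrite ltrDl.
apply/(@cvgrPdist_lt _ _ _ (nbhs x)) => eps eps0.
have e2 : 0 < eps / 2 by rewrite divr_gt0.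
have := near_compact x cT cF e2; apply: filterS => y hy.
have le_sup y1 y2 : (forall t, `|F (y1, t) - F (y2, t)| < eps / 2) ->
    sup (range (fun t => F (y1, t))) <= sup (range (fun t => F (y2, t))) + eps / 2.
  move=> h; apply: ge_sup; first by have [] := hs y1.
  move=> _ [t _ <-]; have := h t; rewrite ltr_norml => /andP[_ ht].
  have : F (y2, t) <= sup (range (fun t => F (y2, t))).
    by apply: ub_le_sup; [have [] := hs y2|exists t].
  by move: ht; lra.
have h1 := le_sup _ _ hy; have h2 : _ := le_sup x y _.
rewrite ltr_norml; apply/andP; split.
  by move: h1 eps0; lra.
have /h2 : forall t, `|F (x, t) - F (y, t)| < eps / 2 by move=> t; rewrite distrC.
by move: eps0; lra.
Qed.

(** The switch between the two phases is governed by the distance [m] that the track has reached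
    from its start, not by time: [X] is arbitrary, so no time is small uniformly. As [m] vanishes at
    time 0, the lift starts exactly at [f]. *)
Lemma approximate_fibrationI (M E : topologicalType) (B : metricType R) (p : M -> B)
    (q : E -> B) (u : E -> @paths R M B p) :
  continuous q -> continuous u -> (forall w, pend (u w) = q w) ->
  (forall eps, 0 < eps -> exists (v : @paths R M B p -> E) (H : E * R -> E),
    [/\ continuous v /\ continuous H, forall z, mdist (q (v z)) (pend z) <= eps,
        forall w, H (w, 0) = v (u w), forall w, H (w, 1) = w
      & forall w t, mdist (q (H (w, t))) (q w) <= eps]) ->
  approximate_fibration q.
Proof.
move=> cq cu uq hv eps eps0; split => // X h f ch cf fh.
(* The worst case is [m] between [d] and [2 * d]: the error of [v] is at most [d], and both the
   delayed and the actual position are within [2 * d] of the start. *)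
pose d := eps / 5; have d0 : 0 < d by rewrite divr_gt0.
have [v [H [[cv cH] vd H0 H1 Hd]]] := hv d d0.
have cI := @ct_to_I R; have cIv := @ct_val _ [set t : R | 0 <= t <= 1].
pose h' (z : X * R) := h (z.1, to_I z.2).
have ch' : continuous h' by apply: (ct_comp ch); cts.
have [L [cL L0 Lh]] : exists L : X * R -> @paths R M B p,
    [/\ continuous L, forall x, L (x, 0) = u (f x)
      & forall x t, pend (L (x, t)) = h' (x, clamp t)].
  apply: path_lift => //; first exact: ct_comp.
  by move=> x; rewrite uq fh /h' to_I0.
(* The last parameter is a fraction of the elapsed time, so the supremum over it is taken over the
   fixed compact interval and is continuous. *)
pose F (w : X * unitI R * unitI R) := mdist (h (w.1.1, I0 R))
  (h' (w.1.1, set_val w.2 * set_val w.1.2)).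
have cF : continuous F.
  apply: ct_mdist; first by apply: (ct_comp ch); cts.
  apply: (ct_comp ch'); apply: ct_pair; first by cts.
  by apply: ct_mul; apply: (ct_comp cIv); cts.
have kI : compact [set: unitI R] by exact: (compact_set_type (@compact_interval R)).
pose m z := sup (range (fun t => F (z, t))).
have cm : continuous m by exact: ct_sup kI (I0 R) cF.
have hs z : has_sup (range (fun t => F (z, t))).
  split; first by exists (F (z, I0 R)); exists (I0 R).
  have : compact (range (fun t => F (z, t))).
    by apply: compact_image => //; apply: (@ct_comp _ _ R F (fun t => (z, t)) cF); cts.
  move=> /compact_bounded[k [_ hk]]; exists (k + 1) => r hr.
  by apply: le_trans (ler_norm _) _; apply: hk => //; rewrite ltrDl.
have m_ge z c : 0 <= c -> c <= 1 -> mdist (h (z.1, I0 R)) (h' (z.1, c * set_val z.2)) <= m z.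
  move=> c0 c1; apply: ub_le_sup; first by have [] := hs z.
  by exists (to_I c); rewrite /F /= ?to_I_val ?clamp_id.
have m0 x : m (x, I0 R) = 0.
  rewrite /m (_ : range (fun t => F (x, I0 R, t)) = [set 0]) ?sup1//; apply/seteqP; split => r.
    by move=> [t _ <-]; rewrite /F /= val_I0 mulr0 /h' to_I0// mdistxx.
  by move=> ->; exists (I0 R) => //; rewrite /F /= val_I0 mulr0 /h' to_I0// mdistxx.
(* While [m] grows from 0 to [d], [H] runs backwards from 1 to 0. While it grows from [d] to
   [2 * d], the fraction of the elapsed time at which the strict lift is read grows from 0 to 1. At
   [m = d] both give [v (u (f x))]. *)
pose A (z : X * unitI R) := H (f z.1, 1 - m z / d).
pose C (z : X * unitI R) := v (L (z.1, clamp ((m z - d) / d) * set_val z.2)).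
exists (fun z => if m z - d <= 0 then A z else C z); split.
- apply: paste.
  + by cts.
  + apply: (ct_comp cH); apply: ct_pair; first by apply: (ct_comp cf); cts.
    by cts.
  + apply: (ct_comp cv); apply: (ct_comp cL); apply: ct_pair; first by cts.
    apply: ct_mul; last by apply: (ct_comp cIv); cts.
    by apply: ct_clamp; cts.
  + move=> z /eqP; rewrite subr_eq0 => /eqP mz.
    by rewrite /A /C mz divff ?gt_eqF// !subrr mul0r clamp_le0// mul0r H0 L0.
- by move=> x; rewrite m0 sub0r oppr_le0 (ltW d0) /A m0 mul0r subr0 H1.
- move=> z; have hz : h' (z.1, set_val z.2) = h z by rewrite /h' /= to_IK -surjective_pairing.
  have tz : 0 <= set_val z.2 <= 1 by exact: (set_valP' z.2).
  have [t0 t1] := andP tz.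
  have mz : mdist (h (z.1, I0 R)) (h z) <= m z.
    by have := m_ge z 1 ler01 (lexx _); rewrite mul1r hz.
  have e5 : eps = d + d + d + d + d by rewrite /d; field.
  have [zd|zd] := leP (m z - d) 0.
    have := Hd (f z.1) (1 - m z / d); have := metric_triangle (q (A z)) (q (f z.1)) (h z).
    by rewrite fh; move: mz zd d0 e5; rewrite /A; lra.
  set c := clamp ((m z - d) / d); have c0 : 0 <= c by exact: clamp_ge0.
  have c1 : c <= 1 by exact: clamp_le1.
  have ctz : clamp (c * set_val z.2) = c * set_val z.2.
    by rewrite clamp_id ?mulr_ge0// mulr_ile1.
  have Ch : mdist (q (C z)) (h' (z.1, c * set_val z.2)) <= d.
    by have := vd (L (z.1, c * set_val z.2)); rewrite Lh ctz.
  have := metric_triangle (q (C z)) (h' (z.1, c * set_val z.2)) (h z).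
  have [m2|m2] := leP (2 * d) (m z).
    have cE : c = 1 by rewrite /c clamp_ge1// ler_pdivlMr// mul1r; move: m2; lra.
    by move: Ch; rewrite cE mul1r hz mdistxx; move: d0 e5; lra.
  have := metric_triangle (h' (z.1, c * set_val z.2)) (h (z.1, I0 R)) (h z).
  have := m_ge z c c0 c1; rewrite (mdistC (h' _) (h (z.1, I0 R))).
  by move: Ch mz m2 d0 e5; lra.
Qed.

End Metric.

(** * The approximate fibration attached to a map to a complex *)

Section Assembly.
Context {R : realType} {n : nat} (K : simplicial_complex n).
Variables (M B : topologicalType) (p : M -> B) (e : B -> 'rV[R]_n) (s : 'rV[R]_n -> B).
Hypotheses (cp : continuous p) (ce : continuous e) (eK : forall b, polyhedron K (e b))
  (cs : {within polyhedron K, continuous s}) (se : forall b, s (e b) = b)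
  (es : forall x, polyhedron K x -> e (s x) = x).

Local Notation paths := (@paths R M B p).

(** [E], [q] and [u] are fixed before the threshold: one and the same [q] has to serve for every
    precision, and only [v] and [H] vary. *)
Lemma spread_exists : (forall b : B, homotopy_finite R (hofiber R p b)) ->
  exists (E : topologicalType) (q : E -> B) (u : E -> paths),
  [/\ cANE R E, continuous q, continuous u, forall w, pend (u w) = q w &
   forall th, 0 < th -> th <= 1 / 2 -> exists (v : paths -> E) (H : E * R -> E),
     [/\ continuous v, forall z, q (v z) = s (low th (e (pend z))),
         @fhom R unit (plain paths) (plain paths) (fun z => u (v z)) (fun z => z), continuous H
       & [/\ forall w t, t <= 0 -> H (w, t) = v (u w), forall w t, 1 <= t -> H (w, t) = w
           & forall w t, exists a, [/\ 0 <= a, a <= th & q (H (w, t)) = s (low a (e (q w)))]]]].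
Proof.
move=> hfib; have [tr [ctr etr trid]] := transport_exists p ce eK cs se es.
have [G [hG cG aG lG [h [[ch hF] [k [[ck kF] kh hk]]]]]] :=
  path_model ce eK se es hfib ctr etr trid (fintype.subxx (faces K)).
have inK (z : paths) : paths_over e (faces K) z by have [] := eK (pend z).
pose psi z := h (mksub (inK z)); pose phi g := set_val (k g).
have cmk : continuous (fun z => mksub (inK z)) by apply: (ct_mksub inK); exact: ct_id.
have [HG [cHG HG0 HG1 HGF]] := hk.
have [HQ [cHQ HQ0 HQ1 HQF]] := kh.
pose HP (w : paths * R) := set_val (HQ (mksub (inK w.1), w.2)).
have cHP : continuous HP.
  apply: (ct_comp (@ct_val _ _)); apply: (ct_comp cHQ); apply: ct_pair; last by cts.
  by apply: (ct_comp cmk); cts.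
have cphi : continuous phi by apply: (ct_comp (@ct_val _ _)).
have cpsi : continuous psi by exact: (ct_comp ch).
have phiF (t : {set 'I_n}) (g : G) : fset t g -> supp (e (pend (phi g))) \subset t.
  by move=> tg; exact: (kF t g tg).
have psiF (t : {set 'I_n}) z : supp (e (pend z)) \subset t -> @fset _ G t (psi z).
  by move=> zt; apply: hF; rewrite /= mksubK.
have HG0' g : HG (g, 0) = psi (phi g).
  rewrite HG0// /psi /phi; congr h; apply: set_val_inj; by rewrite mksubK.
have HP0 z : HP (z, 0) = phi (psi z) by rewrite /HP HQ0.
have HP1 z : HP (z, 1) = z by rewrite /HP HQ1// mksubK.
have HPF z a : supp (e (pend (HP (z, a)))) \subset supp (e (pend z)).
  by apply: (HQF (supp (e (pend z)))); rewrite /= mksubK.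
exists (set_type (spread_total e (G := G))), (fun w => (set_val w).2), (unspread tr phi).
split.
- exact: cANE_spread_total.
- by apply: (ct_snd (f := set_val)); exact: ct_val.
- exact: ct_unspread.
- exact: pend_unspread.
move=> th thp th1; have [H [cH H0 H1 HJ]] := spreadK ce eK cs se es ctr etr trid lG cphi cpsi
  cHG phiF psiF HG0' (fun g => HG1 g 1 (lexx _)) HGF thp th1.
exists (spread eK es etr psiF thp th1), H; split.
- exact: ct_spread.
- by move=> z; rewrite spreadE.
- exact: (unspreadK ce eK es ctr etr trid cHP psiF HP0 HP1 HPF thp th1).
- exact: cH.
- by split.
Qed.

(** The deformation shortens each path towards its starting point. *)
Lemma constant_paths : exists c : M -> paths, [/\ continuous c, forall m, pend (c m) = p m &
  @fhe R unit (plain M) (plain paths) c].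
Proof.
have cst := @ct_pstart R M B p; have cev := @ct_pev R M B p.
have [c [cc c0 cev' c1]] := @paths_mk R M B p M (fun m => m) (fun z => p z.1) (@ct_id _)
  (ct_comp cp (ct_fst (@ct_id _))) (fun m => erefl).
exists c; split => //; split; first exact: fmor_aon.
exists (@pstart R M B p); split; first exact: fmor_aon.
  by apply: fhom_eq => //; apply: fmor_aon; exact: ct_comp.
pose g (w : (paths * R) * R) := pev (w.1.1, clamp w.2 * clamp w.1.2).
have [D [cD D0 Dev _]] : exists D : paths * R -> paths, [/\ continuous D,
    forall w, pstart (D w) = pstart w.1, forall w t, pev (D w, t) = g (w, clamp t)
    & forall w, pend (D w) = g (w, 1)].
  apply: paths_mk.
  - by apply: (ct_comp cst); cts.
  - apply: (ct_comp cev); apply: ct_pair; first by cts.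
    by apply: ct_mul; apply: ct_clamp; cts.
  - by move=> w; rewrite /g clamp_le0// mul0r pev_le0.
apply: (@fhomI _ _ (plain paths) (plain paths) _ _ D) => //.
- move=> z; apply: paths_ext; first by rewrite D0 c0.
  by move=> t t0 t1; rewrite Dev cev' /g /= (clamp_le0 (lexx _)) mulr0 pev_le0.
- move=> z; apply: paths_ext; first by rewrite D0.
  by move=> t t0 t1; rewrite Dev /g /= clampK clamp_id// clamp_ge1// mulr1.
Qed.

End Assembly.

Section Conclusion.
Context {R : realType} {n : nat} (K : simplicial_complex n).
Variables (M : topologicalType) (B : metricType R) (p : M -> B)
  (e : B -> 'rV[R]_n) (s : 'rV[R]_n -> B).
Hypotheses (cp : continuous p) (ce : continuous e) (eK : forall b, polyhedron K (e b))
  (cs : {within polyhedron K, continuous s}) (se : forall b, s (e b) = b)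
  (es : forall x, polyhedron K x -> e (s x) = x).

Lemma low_close eps : 0 < eps -> exists th, [/\ 0 < th, th <= 1 / 2 &
  forall a b, 0 <= a -> a <= th -> mdist (s (low a (e b))) b <= eps].
Proof.
(* [hc] clips to [0, 1/2], the range for which truncation is known to be continuous; this makes [D]
   continuous on the whole product, and the tube lemma applies at 0. *)
move=> eps0; pose hc (t : R) := clamp (2 * t) / 2.
have hc_bd t : 0 <= hc t /\ hc t <= 1 / 2.
  by rewrite /hc; have := clamp_ge0 (2 * t); have := clamp_le1 (2 * t); split; lra.
pose D (w : R * B) := mdist (s (low (hc w.1) (e w.2))) w.2.
have cD : continuous D.
  have c2 : continuous (fun w : R * B => hc w.1) by rewrite /hc; cts.
  have c1 : continuous (fun w : R * B => w.2) by cts.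
  apply: ct_mdist => //; apply: (ct_s_low ce eK cs) => // w; by have [] := hc_bd w.1.
have D0 b : D (0, b) = 0.
  rewrite /D /hc /= mulr0 clamp_le0// mul0r low0 ?se ?mdistxx//.
  exact: (simplex_e eK).
have := near_compact 0 (compact_base eK cs se) cD eps0.
move=> /nbhs_ballP[r /= r0 hr].
exists (Num.min (r / 2) (1 / 2)); split; first by rewrite lt_min !divr_gt0.
  by rewrite ge_min lexx orbT.
move=> a b a0; rewrite le_min => /andP[ar a2].
have : ball (0 : R) r a by rewrite /ball /= sub0r normrN ger0_norm//; move: r0 ar; lra.
move=> /hr /(_ b); rewrite D0 subr0 /D /= => h.
have hca : hc a = a by rewrite /hc clamp_id ?mulr_ge0//; move: a2; lra.
by move: h; rewrite hca ger0_norm ?mdist_ge0// => /ltW.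
Qed.

Lemma approximate_fibration_model : (forall b : B, homotopy_finite R (hofiber R p b)) ->
  exists (E : topologicalType) (f : M -> E) (q : E -> B),
    [/\ compact [set: E], ENR R E, homotopy_equivalence R f,
        approximate_fibration q & homotopic R (q \o f) p].
Proof.
move=> hfib; have [E [q [u [hE cq cu uq hv]]]] := spread_exists ce eK cs se es hfib.
have [c [cc cpend [Fc hc]]] := @constant_paths R M B p cp.
(* Any admissible threshold gives the homotopy equivalence; 1/2 is the largest. *)
have h0 : 0 < 1 / 2 :> R by rewrite divr_gt0.
have [v [H [cv qv uv cH [H0 H1 _]]]] := hv (1 / 2) h0 (lexx _).
exists E, (fun m => v (c m)), q; split.
- by case: hE.
- exact: cANE_ENR.
- apply/homotopy_equivalence_fhe.
  apply: (@fhe_comp _ _ (plain M) (plain (@paths R M B p)) (plain E) c v) => //.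
  split; first exact: fmor_aon.
  exists u; split; [exact: fmor_aon|exact: uv|].
  apply: (@fhomI _ _ (plain E) (plain E) _ _ H) => // w.
  + exact: H0.
  + exact: H1.
- apply: (approximate_fibrationI cq cu uq) => eps eps0.
  have [th [th0 th1 hth]] := low_close eps0.
  have [v' [H' [cv' qv' _ cH' [H0' H1' Hq]]]] := hv th th0 th1.
  exists v', H'; split => //.
  + by move=> z; rewrite qv'; apply: hth => //; exact: ltW.
  + by move=> w; exact: H0'.
  + by move=> w; exact: H1'.
  + by move=> w t; have [a [a0 a1 ->]] := Hq w t; exact: hth.
- apply/homotopic_fhom.
  apply: (@fhomI _ _ (plain M) (plain B) _ _
    (fun w => s (low ((1 - clamp w.2) / 2) (e (p w.1))))) => //.
  + apply: (ct_s_low ce eK cs).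
    * by cts.
    * by apply: (ct_comp cp); cts.
    * by move=> w; have := clamp_le1 w.2; lra.
    * by move=> w; have := clamp_ge0 w.2; lra.
  + by move=> m; rewrite /= qv cpend clamp_le0// subr0.
  + by move=> m; rewrite /= clamp_ge1// subrr mul0r low0 ?se//; exact: (simplex_e eK).
Qed.

End Conclusion.

Theorem theorem4p1 (R : realType) (M : topologicalType) (B : metricType R)
    (p : M -> B) (hp : continuous p)
    (hB : finite_simplicial_complex R B)
    (hfib : forall b : B, homotopy_finite R (hofiber R p b)) :
  exists (E : topologicalType) (f : M -> E) (q : E -> B),
    [/\ compact [set: E], ENR R E, homotopy_equivalence R f,
        approximate_fibration q & homotopic R (q \o f) p].
Proof.
(* A point of [B] is wanted as the value of [s] off the polyhedron. If there is none, [M] is empty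
   as well and [p] itself is the approximate fibration. *)
have [[b0]|noB] := pselect (inhabited B); last first.
  have noM (m : M) : False by apply: noB; exact: (inhabits (p m)).
  have hM : cANE R M by apply: empty_cANE => -[/noM].
  exists M, id, p; split.
  - by case: hM.
  - exact: cANE_ENR.
  - by apply/homotopy_equivalence_fhe; exact: fhe_id.
  - move=> eps eps0; split => // X h f ch cf fh.
    by exists (fun z => f z.1); split => [z|x|z] //; case: (noM (f z.1)).
  - by apply/homotopic_fhom; apply: fhom_refl; exact: fmor_aon.
have [n [K [f [g [cf cg fg gf]]]]] := hB.
pose e b : 'rV[R]_n := set_val (g b).
pose s (x : 'rV[R]_n) : B :=
  if pselect (polyhedron K x) is left h then f (mksub h) else b0.
have sK x (h : polyhedron K x) : s x = f (mksub h).
  by rewrite /s; case: pselect => // h'; congr f; apply: set_val_inj; rewrite !mksubK.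
have eK b : polyhedron K (e b) by exact: (set_valP' (g b)).
apply: (@approximate_fibration_model R n K M B p e s) => //.
- by apply: (ct_comp (@ct_val _ _)).
- apply/within_set_type; rewrite (_ : (fun x => _) = f)//; apply/funext => x.
  by rewrite (sK _ (set_valP' x)); congr f; apply: set_val_inj; rewrite mksubK.
- by move=> b; rewrite (sK _ (eK b)) -[RHS]gf; congr f; apply: set_val_inj; rewrite mksubK.
- by move=> x h; rewrite (sK _ h) /e fg mksubK.
Qed.
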